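(* Let $s\ge 0$ and $i\ge 0$ be integers. As a representation of the symmetric group $\mathfrak S_s$, $$H^i(\Gamma_{1,s};\mathbf k)\cong\begin{cases}P_{(s-i,1^i)} & \text{if } i \text{ is even},\\ 0 & \text{if } i\text{ is odd}.\end{cases}$$ In particular, for every $k\ge 0$, $H^{2k}(\Gamma_{1,2k+1};\mathbf k)\cong P_{(1^{2k+1})}$, which is the one-dimensional space $\mathbf k$ with the alternating (sign) action.
   Context: $\mathbf k$ is a field of characteristic zero. Let $X$ be a finite connected graph of rank $n$ (i.e. $\pi_1(X)$ is free of rank $n$) with $s$ distinct marked points $x_1,\dots,x_s$. The group $\Gamma_{n,s}$ is the group of homotopy classes of self-homotopy equivalences of $X$ fixing each $x_i$, where homotopies are also required to fix each $x_i$; up to isomorphism it depends only on $n$ and $s$. In particular $\Gamma_{n,0}=\mathrm{Out}(F_n)$ and $\Gamma_{n,1}=\mathrm{Aut}(F_n)$. Action of $\mathfrak S_s$: for a permutation $\sigma$ choose a homotopy equivalence $f:X\to X$ permuting the marked points according to $\sigma$; conjugation by $f$ is an automorphism of $\Gamma_{n,s}$, well defined up to inner automorphisms, so it induces an action of $\mathfrak S_s$ on the homology and cohomology of $\Gamma_{n,s}$. $P_\lambda$ denotes the irreducible $\mathfrak S_s$-representation over $\mathbf k$ corresponding to the partition $\lambda$ of $s$, with $P_{(s)}$ the trivial representation and $P_{(1^s)}$ the alternating one; exponents denote repeated parts. $P_{(s-i,1^i)}$ is read as $0$ when $(s-i,1^i)$ is not a partition (i.e. when $i>0$ and $i\ge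 s$). *)

(* Defs.v *)
From HB Require Import structures.
From mathcomp Require Import all_boot all_order all_algebra all_fingroup.
From mathcomp Require Import generic_quotient ring_quotient.
From mathcomp Require Import all_classical all_reals all_analysis.
From mathcomp Require Import ring lra.

Set Implicit Arguments.
Unset Strict Implicit.
Unset Printing Implicit Defensive.

Import Order.TTheory GRing.Theory Num.Theory.
Import numFieldNormedType.Exports.

Local Open Scope classical_set_scope.
Local Open Scope ring_scope.
Local Open Scope quotient_scope.

Section WithinContinuity.
Context {T U V : topologicalType}.

Lemma within_comp (A : set T) (B : set U) (f : T -> U) (g : U -> V) :
  (forall t, A t -> B (f t)) ->
  {within A, continuous f} -> {within B, continuous g} ->
  {within A, continuous (g \o f)}.
Proof.
move=> fAB /subspace_continuousP cf /subspace_continuousP cg.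
apply/subspace_continuousP => t At W /= nW.
have := cg _ (fAB _ At) _ nW; rewrite /= nbhs_simpl /within /= => /(cf _ At).
rewrite /= !nbhs_simpl /within /=; apply: filterS => s + As.
by move=> /(_ As); apply; exact: fAB.
Qed.

Lemma within_pair (A : set T) (f : T -> U) (g : T -> V) :
  {within A, continuous f} -> {within A, continuous g} ->
  {within A, continuous (fun t => (f t, g t))}.
Proof.
move=> /subspace_continuousP cf /subspace_continuousP cg.
by apply/subspace_continuousP => t At; apply: cvg_pair; [exact: cf|exact: cg].
Qed.

Lemma within_eq (A : set T) (f g : T -> U) :
  (forall t, A t -> f t = g t) ->
  {within A, continuous f} -> {within A, continuous g}.
Proof.
move=> fg; apply: subspace_eq_continuous => t; rewrite inE => At; exact: fg.
Qed.

Lemma closed_setX (A : set T) (B : set U) :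
  closed A -> closed B -> closed (A `*` B).
Proof.
move=> cA cB.
have -> : A `*` B = (fst @^-1` A) `&` (snd @^-1` B) by [].
apply: closedI; apply: preimage_closed => // z _.
- exact: cvg_fst.
- exact: cvg_snd.
Qed.

End WithinContinuity.

Section Homotopy.
Context {R : realType}.

Definition homotopic_rel (T Y : topologicalType) (D A : set T)
    (f g : T -> Y) : Prop :=
  exists H : T * R -> Y,
    [/\ {within D `*` `[0, 1], continuous H},
        forall t, D t -> H (t, 0) = f t,
        forall t, D t -> H (t, 1) = g t &
        forall a u, A a -> 0 <= u <= 1 -> H (a, u) = f a].

Context {T Y : topologicalType} (D A : set T).
Hypothesis (AD : A `<=` D) (Dcl : closed D).

Let cfst : {within D `*` `[0, 1], continuous (@fst T R)}.
Proof. by apply: continuous_subspaceT => z; exact: cvg_fst. Qed.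
Let csnd : {within D `*` `[0, 1], continuous (@snd T R)}.
Proof. by apply: continuous_subspaceT => z; exact: cvg_snd. Qed.

Lemma homotopic_eq (f g : T -> Y) : {within D, continuous f} ->
  (forall t, D t -> f t = g t) -> homotopic_rel D A f g.
Proof.
move=> cf fg; exists (f \o fst); split => //.
by apply: within_comp cf; [move=> t []|exact: cfst].
Qed.

Lemma homotopic_refl (f : T -> Y) : {within D, continuous f} ->
  homotopic_rel D A f f.
Proof. by move=> cf; exact: homotopic_eq. Qed.

Lemma homotopic_sym (f g : T -> Y) :
  homotopic_rel D A f g -> homotopic_rel D A g f.
Proof.
move=> [H [cH H0 H1 HA]]; exists (H \o (fun z => (z.1, 1 - z.2))); split => /=.
- apply: within_comp cH.
    by move=> [t u] [/= Dt]; rewrite !in_itv /= => ?; split => //; lra.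
  apply: within_pair => //; apply: continuous_subspaceT => z.
  by apply: cvgB; [exact: cvg_cst|exact: cvg_snd].
- by move=> t Dt; rewrite subr0 H1.
- by move=> t Dt; rewrite subrr H0.
- move=> a u Aa u01.
  have A1 : H (a, 1) = f a by apply: HA => //; lra.
  rewrite -H1; last exact: AD.
  by rewrite A1 HA//; lra.
Qed.

Lemma homotopic_trans (f g h : T -> Y) :
  homotopic_rel D A f g -> homotopic_rel D A g h -> homotopic_rel D A f h.
Proof.
move=> [H [cH H0 H1 HA]] [K [cK K0 K1 KA]].
pose L (z : T * R) := if z.2 <= 2^-1 then H (z.1, 2 * z.2)
                      else K (z.1, 2 * z.2 - 1).
have cl2 : forall a b : R, closed (D `*` `[a, b]).
  by move=> a b; apply: closed_setX => //; exact: interval_closed.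
exists L; split.
- have -> : D `*` `[0, 1] = D `*` `[0, 2^-1] `|` D `*` `[2^-1, 1] :> set (T * R).
    apply/seteqP; split => [[t u] [/= Dt]|[t u] [] [/= Dt]]; rewrite !in_itv /=.
    + by case: (leP u 2^-1) => ? ?; [left|right]; split => //=; lra.
    + by move=> ?; split => //=; lra.
    + by move=> ?; split => //=; lra.
  apply: withinU_continuous => //.
  + apply: (@within_eq _ _ _ (H \o (fun z => (z.1, 2 * z.2)))).
      by move=> [t u] [/= _]; rewrite in_itv /= /L /= => /andP[_ ->].
    apply: within_comp cH.
      by move=> [t u] [/= Dt]; rewrite !in_itv /= => ?; split => //; lra.
    apply: within_pair; apply: continuous_subspaceT => z; first exact: cvg_fst.
    by apply: cvgM; [exact: cvg_cst|exact: cvg_snd].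
  + apply: (@within_eq _ _ _ (K \o (fun z => (z.1, 2 * z.2 - 1)))).
      move=> [t u] [/= Dt]; rewrite in_itv /= /L /= => /andP[u1 u2].
      case: leP => // u3; have -> : u = 2^-1 by lra.
      by rewrite mulfV// subrr K0// H1.
    apply: within_comp cK.
      by move=> [t u] [/= Dt]; rewrite !in_itv /= => ?; split => //; lra.
    apply: within_pair; apply: continuous_subspaceT => z; first exact: cvg_fst.
    apply: cvgB; last exact: cvg_cst.
    by apply: cvgM; [exact: cvg_cst|exact: cvg_snd].
- by move=> t Dt; rewrite /L /= invr_ge0 ler0n mulr0 H0.
- move=> t Dt; rewrite /L /= ifF; last by apply/negbTE; rewrite -ltNge; lra.
  by rewrite (_ : 2 * 1 - 1 = 1) ?K1//; lra.
- move=> a u Aa u01; rewrite /L /=.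
  have fg : f a = g a.
    by rewrite -H1; [rewrite HA//; lra|exact: AD].
  case: leP => u2; first by rewrite HA//; lra.
  by rewrite fg KA//; lra.
Qed.

End Homotopy.

Arguments homotopic_rel R {T Y} D A f g.

Section FundamentalGroup.
Context (R : realType) (X : topologicalType) (b : X).
Implicit Types f g h : R -> X.

Local Notation path f := {within `[0%R, 1%R], continuous f}.
Local Notation homotopic :=
  (@homotopic_rel R R X `[0%R, 1%R]%classic [set 0%R; 1%R]%classic).

Definition is_loop f : Prop := [/\ path f, f 0 = b & f 1 = b].

Definition loop : Type := {f : R -> X | `[< is_loop f >]}.
HB.instance Definition _ := Choice.on loop.

Definition loop_homotopic : rel loop :=
  fun p q => `[< homotopic (val p) (val q) >].

Let bdI : [set 0; 1 : R] `<=` `[0, 1].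
Proof. by move=> t [] ->; rewrite /= in_itv /=; lra. Qed.

Let clI : closed (`[0, 1] : set R).
Proof. exact: interval_closed. Qed.

Lemma loopP (p : loop) : is_loop (val p).
Proof. exact/asboolP/(valP p). Qed.

Lemma loop_homotopic_equiv : equiv_class_of loop_homotopic.
Proof.
split=> [p|p q|q p r].
- by apply/asboolP/homotopic_refl; have [] := loopP p.
- by apply/asboolP/asboolP => /homotopic_sym; apply.
- move=> /asboolP pq /asboolP qr.
  by apply/asboolP; exact: homotopic_trans pq qr.
Qed.
Canonical loop_homotopic_rel := EquivRelPack loop_homotopic_equiv.

Definition fundamental_group := {eq_quot loop_homotopic}.
HB.instance Definition _ := Choice.on fundamental_group.
HB.instance Definition _ := EqQuotient.on fundamental_group.

Definition concat f g : R -> X :=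
  fun t => if t <= 2^-1 then f (2 * t) else g (2 * t - 1).

Definition reverse f : R -> X := fun t => f (1 - t).

Lemma within_paste (S : topologicalType) (D : set S) (F G : R * S -> X) :
  closed D ->
  {within `[0, 1] `*` D, continuous F} -> {within `[0, 1] `*` D, continuous G} ->
  (forall d, D d -> F (1, d) = G (0, d)) ->
  {within `[0, 1] `*` D, continuous (fun z =>
     if z.1 <= 2^-1 then F (2 * z.1, z.2) else G (2 * z.1 - 1, z.2))}.
Proof.
move=> clD cF cG FG.
have -> : `[0, 1] `*` D =
    `[0, 2^-1] `*` D `|` `[2^-1, 1] `*` D :> set (R * S).
  apply/seteqP; split => [[u t] [/= + Dt]|[u t] [] [/= + Dt]]; rewrite !in_itv /=.
  + by case: (leP u 2^-1) => ? ?; [left|right]; split => //=; lra.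
  + by move=> ?; split => //=; lra.
  + by move=> ?; split => //=; lra.
have cl2 (p q : R) : closed (`[p, q] `*` D).
  by apply: closed_setX => //; exact: interval_closed.
apply: withinU_continuous => //.
- apply: (@within_eq _ _ _ (F \o (fun z => (2 * z.1, z.2)))).
    by move=> [u t] [/= + _]; rewrite in_itv /= => /andP[_ ->].
  apply: within_comp cF.
    by move=> [u t] [/= + Dt]; rewrite !in_itv /= => ?; split => //=; lra.
  apply: within_pair; apply: continuous_subspaceT => z; last exact: cvg_snd.
  by apply: cvgM; [exact: cvg_cst|exact: cvg_fst].
- apply: (@within_eq _ _ _ (G \o (fun z => (2 * z.1 - 1, z.2)))).
    move=> [u t] [/= + Dt]; rewrite in_itv /= => /andP[u1 u2].
    case: leP => // u3; have -> : u = 2^-1 by lra.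
    by rewrite mulfV// subrr FG.
  apply: within_comp cG.
    by move=> [u t] [/= + Dt]; rewrite !in_itv /= => ?; split => //=; lra.
  apply: within_pair; apply: continuous_subspaceT => z; last exact: cvg_snd.
  by apply: cvgB; [apply: cvgM; [exact: cvg_cst|exact: cvg_fst]|exact: cvg_cst].
Qed.

Lemma path_concat f g : path f -> path g -> f 1 = g 0 -> path (concat f g).
Proof.
move=> cf cg fg.
pose P (z : R * R) := if z.1 <= 2^-1 then (f \o fst) (2 * z.1, z.2)
                      else (g \o fst) (2 * z.1 - 1, z.2).
have cfst : {within `[0, 1] `*` [set: R], continuous (@fst R R)}.
  by apply: continuous_subspaceT => z; exact: cvg_fst.
have cfs h : path h -> {within `[0, 1] `*` [set: R], continuous (h \o fst)}.
  by move=> ch; apply: within_comp cfst ch => t [].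
have cP : {within `[0, 1] `*` [set: R], continuous P}.
  by apply: within_paste => //; exact: cfs.
apply: (@within_eq _ _ _ (P \o (fun t => (t, 0)))) => //.
apply: within_comp cP => //.
by apply: within_pair; apply: continuous_subspaceT => z; [exact: cvg_id|exact: cvg_cst].
Qed.

Lemma concat_loop f g : is_loop f -> is_loop g -> is_loop (concat f g).
Proof.
move=> [cf f0 f1] [cg g0 g1]; split.
- by apply: path_concat => //; rewrite f1.
- by rewrite /concat invr_ge0 ler0n mulr0.
- rewrite /concat ifF; last by apply/negbTE; rewrite -ltNge; lra.
  by rewrite (_ : 2 * 1 - 1 = 1)//; lra.
Qed.

Lemma homotopic_reparam f (phi psi : R -> R) :
  path f -> continuous phi -> continuous psi ->
  (forall t, 0 <= t <= 1 -> 0 <= phi t <= 1) ->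
  (forall t, 0 <= t <= 1 -> 0 <= psi t <= 1) ->
  phi 0 = psi 0 -> phi 1 = psi 1 -> homotopic (f \o phi) (f \o psi).
Proof.
move=> cf cphi cpsi phi01 psi01 e0 e1.
exists (f \o (fun z => (1 - z.2) * phi z.1 + z.2 * psi z.1)); split => /=.
- apply: within_comp cf.
    move=> [t u] [/=]; rewrite !in_itv /= => t01 u01.
    have := phi01 _ t01; have := psi01 _ t01; nra.
  apply: continuous_subspaceT => z; apply: cvgD; apply: cvgM.
  + by apply: cvgB; [exact: cvg_cst|exact: cvg_snd].
  + by apply: (continuous_comp (f := fst)); [exact: cvg_fst|exact: cphi].
  + exact: cvg_snd.
  + by apply: (continuous_comp (f := fst)); [exact: cvg_fst|exact: cpsi].
- by move=> t _; rewrite subr0 mul1r mul0r addr0.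
- by move=> t _; rewrite subrr mul0r mul1r add0r.
- by move=> a u [] -> _; rewrite ?e0 ?e1 -mulrDl subrK mul1r.
Qed.

Lemma homotopic_concat f f' g g' : f 1 = g 0 ->
  homotopic f f' -> homotopic g g' -> homotopic (concat f g) (concat f' g').
Proof.
move=> fg [F [cF F0 F1 FA]] [G [cG G0 G1 GA]].
exists (fun z => if z.1 <= 2^-1 then F (2 * z.1, z.2) else G (2 * z.1 - 1, z.2)).
split => /=.
- apply: within_paste => // u; rewrite /= in_itv /= => u01.
  by rewrite FA//; [rewrite GA//; left|right].
- move=> t; rewrite in_itv /= /concat => t01.
  by case: leP => t2; rewrite ?F0 ?G0//= in_itv /=; lra.
- move=> t; rewrite in_itv /= /concat => t01.
  by case: leP => t2; rewrite ?F1 ?G1//= in_itv /=; lra.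
- move=> a u [] -> u01; rewrite /concat.
    by rewrite invr_ge0 ler0n mulr0 FA//; left.
  rewrite ifF; last by apply/negbTE; rewrite -ltNge; lra.
  rewrite ifF; last by apply/negbTE; rewrite -ltNge; lra.
  by rewrite (_ : 2 * 1 - 1 = 1) ?GA//; [right|lra].
Qed.

Lemma reverse_loop f : is_loop f -> is_loop (reverse f).
Proof.
move=> [cf f0 f1]; split.
- apply: (@within_comp R R X `[0, 1] `[0, 1] (fun t => 1 - t) f _ _ cf).
    by move=> t /=; rewrite !in_itv /=; lra.
  by apply: continuous_subspaceT => t; apply: cvgB; [exact: cvg_cst|exact: cvg_id].
- by rewrite /reverse subr0.
- by rewrite /reverse subrr.
Qed.

Lemma cst_loop : is_loop (cst b).
Proof. by split => //; apply: continuous_subspaceT => t; exact: cvg_cst. Qed.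

Definition loop_one : loop := exist _ (cst b) (introT (asboolP _) cst_loop).

Definition loop_mul (p q : loop) : loop :=
  exist _ (concat (val p) (val q))
    (introT (asboolP _) (concat_loop (loopP p) (loopP q))).

Definition loop_inv (p : loop) : loop :=
  exist _ (reverse (val p)) (introT (asboolP _) (reverse_loop (loopP p))).

Definition pi1_one : fundamental_group := \pi_fundamental_group loop_one.
Definition pi1_mul (p q : fundamental_group) : fundamental_group :=
  \pi_fundamental_group (loop_mul (repr p) (repr q)).
Definition pi1_inv (p : fundamental_group) : fundamental_group :=
  \pi_fundamental_group (loop_inv (repr p)).

Lemma pi1_eqP (p q : loop) :
  homotopic (val p) (val q) <-> \pi_fundamental_group p = \pi_fundamental_group q.
Proof.
split => [pq|/eqmodP/asboolP//].
by apply/eqmodP/asboolP.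
Qed.

Lemma pi1_mulE (p q : loop) :
  pi1_mul (\pi_fundamental_group p) (\pi_fundamental_group q) =
  \pi_fundamental_group (loop_mul p q).
Proof.
apply/pi1_eqP => /=; apply: homotopic_concat.
- by have [_ _ ->] := loopP (repr (\pi_fundamental_group p));
    have [_ -> _] := loopP (repr (\pi_fundamental_group q)).
- by apply/pi1_eqP; rewrite reprK.
- by apply/pi1_eqP; rewrite reprK.
Qed.

Lemma loop_path (p : loop) : path (val p).
Proof. by have [] := loopP p. Qed.

Lemma loop0 (p : loop) : sval p 0 = b.
Proof. by have [] := loopP p. Qed.

Lemma loop1 (p : loop) : sval p 1 = b.
Proof. by have [] := loopP p. Qed.

Let c_aff (a c : R) : continuous (fun t : R => a * t + c).
Proof.
move=> t; apply: cvgD; last exact: cvg_cst.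
by apply: cvgM; [exact: cvg_cst|exact: cvg_id].
Qed.

(* Every group law of pi_1 compares two reparametrisations of one loop. *)
Lemma pi1_reparam (p q r : loop) (phi psi : R -> R) :
  continuous phi -> continuous psi ->
  (forall t, 0 <= t <= 1 -> 0 <= phi t <= 1) ->
  (forall t, 0 <= t <= 1 -> 0 <= psi t <= 1) ->
  phi 0 = psi 0 -> phi 1 = psi 1 ->
  (forall t, 0 <= t <= 1 -> val q t = val p (phi t)) ->
  (forall t, 0 <= t <= 1 -> val r t = val p (psi t)) ->
  \pi_fundamental_group q = \pi_fundamental_group r.
Proof.
move=> cphi cpsi phi01 psi01 e0 e1 qE rE; apply/pi1_eqP.
have h := homotopic_reparam (@loop_path p) cphi cpsi phi01 psi01 e0 e1.
apply: (homotopic_trans bdI clI (g := val p \o phi)).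
  by apply: homotopic_eq (@loop_path q) _ => t; rewrite /= in_itv; exact: qE.
apply: (homotopic_trans bdI clI h).
apply: (homotopic_sym bdI); apply: homotopic_eq (@loop_path r) _ => t.
by rewrite /= in_itv; exact: rE.
Qed.

Lemma pi1_mulA : associative pi1_mul.
Proof.
move=> p q r; rewrite -[p]reprK -[q]reprK -[r]reprK.
move: (repr p) (repr q) (repr r) => {}p {}q {}r.
rewrite (pi1_mulE p q) (pi1_mulE q r) !pi1_mulE; apply/esym.
apply: (@pi1_reparam (loop_mul p (loop_mul q r)) _ _
  ((fun t => 2 * t + 0) \min
  ((fun t => 1 * t + 4^-1) \min (fun t => 2^-1 * t + 2^-1))) (fun t => 1 * t + 0)).
- by apply: min_fun_continuous; [|apply: min_fun_continuous]; exact: c_aff.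
- exact: c_aff.
- by move=> t t01 /=; rewrite !minEle; repeat case: ifP; lra.
- by move=> t t01 /=; lra.
- by rewrite /= !minEle; repeat case: ifP; lra.
- by rewrite /= !minEle; repeat case: ifP; lra.
- move=> t t01 /=; rewrite /concat /= !minEle.
  (do ! case: ifP); move=> *; first [by exfalso; lra|f_equal; lra].
- by move=> t _; rewrite mul1r addr0.
Qed.

Lemma pi1_mul1g : left_id pi1_one pi1_mul.
Proof.
move=> p; rewrite -[p]reprK /pi1_one pi1_mulE; move: (repr p) => {}p.
apply: (@pi1_reparam p _ _
  ((fun t => 0 * t + 0) \max (fun t => 2 * t + (- 1))) (fun t => 1 * t + 0)).
- by apply: max_fun_continuous; exact: c_aff.
- exact: c_aff.
- by move=> t t01 /=; rewrite !maxEle; repeat case: ifP; lra.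
- by move=> t t01 /=; lra.
- by rewrite /= !maxEle; repeat case: ifP; lra.
- by rewrite /= !maxEle; repeat case: ifP; lra.
- move=> t t01 /=; rewrite /concat /= !maxEle.
  (do ! case: ifP); move=> *; first [by exfalso; lra
    |by apply: (etrans (esym (loop0 p))); f_equal; lra|by f_equal; lra].
- by move=> t _; rewrite mul1r addr0.
Qed.

Lemma pi1_mulg1 : right_id pi1_one pi1_mul.
Proof.
move=> p; rewrite -[p]reprK /pi1_one pi1_mulE; move: (repr p) => {}p.
apply: (@pi1_reparam p _ _
  ((fun t => 2 * t + 0) \min (fun t => 0 * t + 1)) (fun t => 1 * t + 0)).
- by apply: min_fun_continuous; exact: c_aff.
- exact: c_aff.
- by move=> t t01 /=; rewrite !minEle; repeat case: ifP; lra.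
- by move=> t t01 /=; lra.
- by rewrite /= !minEle; repeat case: ifP; lra.
- by rewrite /= !minEle; repeat case: ifP; lra.
- move=> t t01 /=; rewrite /concat /= !minEle.
  (do ! case: ifP); move=> *; first [by exfalso; lra
    |by apply: (etrans (esym (loop1 p))); f_equal; lra|by f_equal; lra].
- by move=> t _; rewrite mul1r addr0.
Qed.

Lemma pi1_invE (p : loop) :
  pi1_inv (\pi_fundamental_group p) = \pi_fundamental_group (loop_inv p).
Proof.
apply/pi1_eqP => /=.
have : homotopic (val (repr (\pi_fundamental_group p))) (val p).
  by apply/pi1_eqP; rewrite reprK.
move=> [H [cH H0 H1 HA]]; exists (H \o (fun z => (1 - z.1, z.2))); split => /=.
- apply: within_comp cH.
    by move=> [t u] [/=]; rewrite !in_itv /= => ? ?; split => //; lra.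
  apply: within_pair; apply: continuous_subspaceT => z; last exact: cvg_snd.
  by apply: cvgB; [exact: cvg_cst|exact: cvg_fst].
- by move=> t; rewrite in_itv /= => t01; rewrite H0// /= in_itv /=; lra.
- by move=> t; rewrite in_itv /= => t01; rewrite H1// /= in_itv /=; lra.
- move=> a u [] -> u01; rewrite /reverse ?subr0 ?subrr HA//; first by right.
  by left.
Qed.

Lemma pi1_mulVg : left_inverse pi1_one pi1_inv pi1_mul.
Proof.
move=> p; rewrite -[p]reprK /pi1_one pi1_invE pi1_mulE; move: (repr p) => {}p.
apply: (@pi1_reparam p _ _
  ((fun t => (- 2) * t + 1) \max (fun t => 2 * t + (- 1))) (fun t => 0 * t + 1)).
- by apply: max_fun_continuous; exact: c_aff.
- exact: c_aff.
- by move=> t t01 /=; rewrite !maxEle; repeat case: ifP; lra.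
- by move=> t t01 /=; lra.
- by rewrite /= !maxEle; repeat case: ifP; lra.
- by rewrite /= !maxEle; repeat case: ifP; lra.
- move=> t t01 /=; rewrite /concat /reverse /= !maxEle.
  (do ! case: ifP); move=> *; first [by exfalso; lra|f_equal; lra].
- by move=> t _; rewrite mul0r add0r; exact: (esym (loop1 p)).
Qed.

Lemma pi1_mulgV : right_inverse pi1_one pi1_inv pi1_mul.
Proof.
move=> p; rewrite -[p]reprK /pi1_one pi1_invE pi1_mulE; move: (repr p) => {}p.
apply: (@pi1_reparam p _ _
  ((fun t => 2 * t + 0) \min (fun t => (- 2) * t + 2)) (fun t => 0 * t + 0)).
- by apply: min_fun_continuous; exact: c_aff.
- exact: c_aff.
- by move=> t t01 /=; rewrite !minEle; repeat case: ifP; lra.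
- by move=> t t01 /=; lra.
- by rewrite /= !minEle; repeat case: ifP; lra.
- by rewrite /= !minEle; repeat case: ifP; lra.
- move=> t t01 /=; rewrite /concat /reverse /= !minEle.
  (do ! case: ifP); move=> *; first [by exfalso; lra|f_equal; lra].
- by move=> t _; rewrite mul0r addr0; exact: (esym (loop0 p)).
Qed.

HB.instance Definition _ := isGroup.Build fundamental_group
  pi1_mulA pi1_mul1g pi1_mulg1 pi1_mulVg pi1_mulgV.

End FundamentalGroup.

Definition free_of_rank (G : groupType) (n : nat) : Prop :=
  exists a : 'I_n -> G, forall (K : groupType) (h : 'I_n -> K),
    exists! phi : G -> K,
      {morph phi : u v / (u * v)%g} /\ forall i, phi (a i) = h i.

Section Graph.
Context (R : realType) (X : topologicalType).

(* A finite 1-dimensional CW complex, given by its characteristic maps.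
   Finitely many cells in a Hausdorff space carry the weak topology. *)
Definition finite_graph : Prop :=
  hausdorff_space X /\
  exists (V : set X) (m : nat) (edge : 'I_m -> R -> X),
    [/\ finite_set V,
        forall e, [/\ {within `[0, 1], continuous (edge e)},
                      V (edge e 0) & V (edge e 1)],
        forall e t, 0 < t < 1 -> ~ V (edge e t),
        forall e e' t t', 0 < t < 1 -> 0 < t' < 1 ->
          edge e t = edge e' t' -> e = e' /\ t = t' &
        forall p, V p \/ exists e t, 0 < t < 1 /\ p = edge e t].

Definition has_rank (n : nat) : Prop :=
  exists b : X, free_of_rank (fundamental_group R b) n.

End Graph.

Section MappingGroup.
Context (R : realType) (X : topologicalType) (s : nat) (x : 'I_s -> X).

Local Notation homotopic :=
  (@homotopic_rel R X X [set: X]%classic (range x)).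

Definition preserves_marked (f : X -> X) : Prop :=
  forall i, range x (f (x i)).

(* Homotopy equivalences that may permute the marked points; all homotopies,
   including those exhibiting the homotopy inverse, are relative to them.
   [Gamma] below is the subgroup of classes fixing each marked point. *)
Definition is_marked_equiv (f : X -> X) : Prop :=
  [/\ continuous f, preserves_marked f &
      exists g : X -> X, [/\ continuous g, preserves_marked g,
        homotopic (g \o f) idfun & homotopic (f \o g) idfun]].

Definition marked_equiv : Type := {f : X -> X | `[< is_marked_equiv f >]}.
HB.instance Definition _ := Choice.on marked_equiv.

Definition marked_homotopic : rel marked_equiv :=
  fun f g => `[< homotopic (val f) (val g) >].

Let mT : range x `<=` [set: X]. Proof. by []. Qed.

Lemma homotopic_id (f : X -> X) : continuous f -> homotopic f f.
Proof. by move=> cf; apply: homotopic_refl; exact: continuous_subspaceT. Qed.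

Lemma homotopic_comp (f f' g g' : X -> X) :
  continuous f -> continuous g' -> preserves_marked g ->
  homotopic f f' -> homotopic g g' -> homotopic (f \o g) (f' \o g').
Proof.
move=> cf cg' pg [F [cF F0 F1 FA]] [G [cG G0 G1 GA]].
apply: (homotopic_trans mT closedT (g := f \o g')).
- exists (f \o G); split => /=.
  + by apply: (within_comp (B := setT)) cG _ => //; exact: continuous_subspaceT.
  + by move=> t _; rewrite G0.
  + by move=> t _; rewrite G1.
  + by move=> a u Aa u01; rewrite GA.
- exists (F \o (fun z => (g' z.1, z.2))); split => /=.
  + apply: within_comp cF; first by move=> [t u] [].
    apply: within_pair; apply: continuous_subspaceT => z; last exact: cvg_snd.
    by apply: (continuous_comp (f := fst)); [exact: cvg_fst|exact: cg'].
  + by move=> t _; rewrite F0.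
  + by move=> t _; rewrite F1.
  + move=> a u Aa u01; rewrite FA//.
    have -> : g' a = g a.
      by rewrite -G1// GA//; rewrite ler01 lexx.
    by case: Aa => i _ <-; exact: pg.
Qed.

Lemma marked_equivP (f : marked_equiv) : is_marked_equiv (val f).
Proof. exact/asboolP/(valP f). Qed.

Lemma marked_homotopic_equiv : equiv_class_of marked_homotopic.
Proof.
split=> [f|f g|g f h].
- by apply/asboolP/homotopic_id; have [] := marked_equivP f.
- by apply/asboolP/asboolP => /(homotopic_sym mT); apply.
- move=> /asboolP fg /asboolP gh.
  by apply/asboolP; exact: (homotopic_trans mT closedT fg gh).
Qed.
Canonical marked_homotopic_rel := EquivRelPack marked_homotopic_equiv.

Definition marked_mapping_group := {eq_quot marked_homotopic}.
HB.instance Definition _ := Choice.on marked_mapping_group.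
HB.instance Definition _ := EqQuotient.on marked_mapping_group.

Lemma id_marked_equiv : is_marked_equiv idfun.
Proof.
have cid : continuous (@idfun X) by move=> t; exact: cvg_id.
have pid : preserves_marked idfun by move=> i; exists i.
by split => //; exists idfun; split => //; exact: homotopic_id.
Qed.

Lemma comp_marked_equiv (f g : X -> X) :
  is_marked_equiv f -> is_marked_equiv g -> is_marked_equiv (f \o g).
Proof.
have pc (u v : X -> X) : preserves_marked u -> preserves_marked v ->
    preserves_marked (u \o v).
  by move=> pu pv i /=; have [j _ <-] := pv i; exact: pu.
have cc (u v : X -> X) : continuous u -> continuous v -> continuous (u \o v).
  by move=> cu cv t; apply: continuous_comp; [exact: cv|exact: cu].
have step (u u' v v' : X -> X) : continuous u -> continuous u' ->
    continuous v -> continuous v' -> preserves_marked v -> preserves_marked u ->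
    preserves_marked u' ->
    homotopic (u' \o u) idfun -> homotopic (v' \o v) idfun ->
    homotopic ((v' \o u') \o (u \o v)) idfun.
  move=> cu cu' cv cv' pv pu pu' hu hv.
  apply: (homotopic_trans mT closedT _ hv).
  apply: (homotopic_comp (f := v') (g := (u' \o u) \o v)) => //.
  - by apply: (pc (u' \o u) v) => //; exact: pc.
  - exact: homotopic_id.
  - by apply: (homotopic_comp (f' := idfun)) => //; [exact: cc|exact: homotopic_id].
move=> [cf pf [f' [cf' pf' hf hf']]] [cg pg [g' [cg' pg' hg hg']]].
split; [exact: cc|exact: pc|exists (g' \o f'); split].
- exact: cc.
- exact: pc.
- exact: step.
- exact: step.
Qed.

Lemma ex_marked_inverse (f : marked_equiv) : exists g : marked_equiv,
  homotopic (val g \o val f) idfun /\ homotopic (val f \o val g) idfun.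
Proof.
have [cf pf [g [cg pg h1 h2]]] := marked_equivP f.
have eg : is_marked_equiv g by split => //; exists (val f).
by exists (exist _ g (introT (asboolP _) eg)).
Qed.

Definition marked_one : marked_equiv :=
  exist _ idfun (introT (asboolP _) id_marked_equiv).
Definition marked_comp (f g : marked_equiv) : marked_equiv :=
  exist _ (val f \o val g) (introT (asboolP _)
    (comp_marked_equiv (marked_equivP f) (marked_equivP g))).
Definition marked_inv (f : marked_equiv) : marked_equiv :=
  projT1 (cid (ex_marked_inverse f)).

Definition mapping_one : marked_mapping_group :=
  \pi_marked_mapping_group marked_one.
Definition mapping_mul (f g : marked_mapping_group) : marked_mapping_group :=
  \pi_marked_mapping_group (marked_comp (repr f) (repr g)).
Definition mapping_inv (f : marked_mapping_group) : marked_mapping_group :=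
  \pi_marked_mapping_group (marked_inv (repr f)).

Lemma mapping_eqP (f g : marked_equiv) : homotopic (val f) (val g) <->
  \pi_marked_mapping_group f = \pi_marked_mapping_group g.
Proof.
split => [fg|/eqmodP/asboolP//].
by apply/eqmodP/asboolP.
Qed.

Lemma mapping_mulE (f g : marked_equiv) :
  mapping_mul (\pi_marked_mapping_group f) (\pi_marked_mapping_group g) =
  \pi_marked_mapping_group (marked_comp f g).
Proof.
apply/mapping_eqP => /=; apply: homotopic_comp.
- by have [] := marked_equivP (repr (\pi_marked_mapping_group f)).
- by have [] := marked_equivP g.
- by have [] := marked_equivP (repr (\pi_marked_mapping_group g)).
- by apply/mapping_eqP; rewrite reprK.
- by apply/mapping_eqP; rewrite reprK.
Qed.

Lemma mapping_mulA : associative mapping_mul.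
Proof.
move=> f g h; rewrite -[f]reprK -[g]reprK -[h]reprK.
move: (repr f) (repr g) (repr h) => {}f {}g {}h.
rewrite (mapping_mulE f g) (mapping_mulE g h) !mapping_mulE.
by congr (\pi_marked_mapping_group _); exact: val_inj.
Qed.

Lemma mapping_mul1g : left_id mapping_one mapping_mul.
Proof.
move=> f; rewrite -[f]reprK /mapping_one mapping_mulE.
by congr (\pi_marked_mapping_group _); exact: val_inj.
Qed.

Lemma mapping_mulg1 : right_id mapping_one mapping_mul.
Proof.
move=> f; rewrite -[f]reprK /mapping_one mapping_mulE.
by congr (\pi_marked_mapping_group _); exact: val_inj.
Qed.

Lemma mapping_mulVg : left_inverse mapping_one mapping_inv mapping_mul.
Proof.
move=> f; rewrite -[f in X in mapping_mul _ X]reprK /mapping_inv mapping_mulE.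
by apply/mapping_eqP; rewrite /= /marked_inv; case: cid => g [].
Qed.

Lemma mapping_mulgV : right_inverse mapping_one mapping_inv mapping_mul.
Proof.
move=> f; rewrite -[f in X in mapping_mul X _]reprK /mapping_inv mapping_mulE.
by apply/mapping_eqP; rewrite /= /marked_inv; case: cid => g [].
Qed.

HB.instance Definition _ := isGroup.Build marked_mapping_group
  mapping_mulA mapping_mul1g mapping_mulg1 mapping_mulVg mapping_mulgV.

Lemma mapping_markedE (f : marked_equiv) (i : 'I_s) :
  val (repr (\pi_marked_mapping_group f)) (x i) = val f (x i).
Proof.
have /mapping_eqP[H [_ _ H1 HA]] := reprK (\pi_marked_mapping_group f).
by rewrite -H1// HA// ler01 lexx.
Qed.

Definition fixes_marked : {pred marked_mapping_group} :=
  fun u => `[< forall i, val (repr u) (x i) = x i >].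

Lemma mapping_mulxE (u v : marked_mapping_group) (i : 'I_s) :
  val (repr (u * v)%g) (x i) = val (repr u) (val (repr v) (x i)).
Proof. exact: mapping_markedE. Qed.

Lemma mapping_mulVxE (u : marked_mapping_group) (i : 'I_s) :
  val (repr u^-1%g) (val (repr u) (x i)) = x i.
Proof. by rewrite -mapping_mulxE mulVg; exact: mapping_markedE. Qed.

Lemma fixes_marked_closed : group_closed fixes_marked.
Proof.
split => [|u v]; first by apply/asboolP => i; exact: mapping_markedE.
move=> /asboolP fu /asboolP fv; apply/asboolP => i.
by rewrite mapping_mulxE -[in LHS](fv i) mapping_mulVxE fu.
Qed.

Definition Gamma : Type := {u : marked_mapping_group | u \in fixes_marked}.
HB.instance Definition _ := SubChoice.on Gamma.
HB.instance Definition _ := SubChoice_isSubGroup.Build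
  marked_mapping_group fixes_marked Gamma fixes_marked_closed.

Lemma conj_fixes_marked (u : marked_mapping_group) (g : Gamma) :
  (val g ^ u)%g \in fixes_marked.
Proof.
apply/asboolP => i; rewrite /conjg !mapping_mulxE.
have [_ + _] := marked_equivP (repr u) => /(_ i)[j _ uj].
by have /asboolP gj := valP g; rewrite -uj gj uj mapping_mulVxE.
Qed.

Definition Gamma_conj (u : marked_mapping_group) (g : Gamma) : Gamma :=
  exist _ (val g ^ u)%g (conj_fixes_marked u g).

Lemma Gamma_conjM u : {morph Gamma_conj u : g h / (g * h)%g}.
Proof. by move=> g h; apply: val_inj; rewrite /= conjMg. Qed.
HB.instance Definition _ u :=
  isMultiplicative.Build Gamma Gamma (Gamma_conj u) (Gamma_conjM u).

(* The class of a chosen homotopy equivalence f with f (x i) = x (sigma i). *)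
Definition permuting_class (sigma : 'S_s) : marked_mapping_group :=
  xget 1%g 
    [set u : marked_mapping_group |
      forall i, val (repr u) (x i) = x (sigma i)]%classic.

End MappingGroup.

Section Cohomology.
Context (k : fieldType).

Definition cochain (G : groupType) (n : nat) : lmodType k :=
  {ffun 'I_n -> G} -> k^o.

Section Bar.
Context (G : groupType) (n : nat).

Definition face (j : 'I_n.+2) (g : {ffun 'I_n.+1 -> G}) : {ffun 'I_n -> G} :=
  [ffun i : 'I_n =>
     let a := g (widen_ord (leqnSn n) i) in let b := g (lift ord0 i) in
     if (i.+1 < j)%N then a else if i.+1 == j :> nat then (a * b)%g else b].

Definition bar_diff (c : cochain G n) : cochain G n.+1 :=
  fun g => \sum_(j < n.+2) (-1) ^+ j * c (face j g).

Lemma bar_diff_linear : linear bar_diff.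
Proof.
move=> a c c'; apply/funext => g.
transitivity (a * bar_diff c g + bar_diff c' g); last by [].
rewrite /bar_diff mulr_sumr -big_split /=; apply: eq_bigr => j _.
transitivity ((-1) ^+ j * (a * c (face j g) + c' (face j g))); first by [].
by rewrite mulrDr mulrCA.
Qed.
HB.instance Definition _ := GRing.isLinear.Build k
  (cochain G n) (cochain G n.+1) _ bar_diff bar_diff_linear.

Definition cocycles : {pred cochain G n} :=
  fun c => bar_diff c == 0.

Lemma cocycles_submod : submod_closed cocycles.
Proof.
split; first by rewrite unfold_in linear0.
move=> a c c'; rewrite !unfold_in => /eqP zc /eqP zc'.
by rewrite linearP /= zc zc' scaler0 addr0.
Qed.
HB.instance Definition _ := GRing.isSubmodClosed.Build k
  (cochain G n) cocycles cocycles_submod.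

Definition cocycle : Type := {c | c \in cocycles}.
HB.instance Definition _ := SubChoice.on cocycle.
HB.instance Definition _ := [SubChoice_isSubLmodule of cocycle by <:].

End Bar.

Definition is_coboundary (G : groupType) (n : nat) : cochain G n -> Prop :=
  match n with
  | 0%N => fun c => c = 0
  | m.+1 => fun c => exists b : cochain G m, c = bar_diff b
  end.

Lemma is_coboundary0 (G : groupType) (n : nat) :
  is_coboundary (0 : cochain G n).
Proof. by case: n => //= m; exists 0; rewrite linear0. Qed.

Lemma is_coboundaryP (G : groupType) (n : nat) a (c c' : cochain G n) :
  is_coboundary c -> is_coboundary c' -> is_coboundary (a *: c + c').
Proof.
case: n c c' => [|m] c c' /=; first by move=> -> ->; rewrite scaler0 addr0.
by move=> [b ->] [b' ->]; exists (a *: b + b'); rewrite linearP.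
Qed.

Section Quotient.
Context (G : groupType) (n : nat).

Definition coboundaries : {pred cocycle G n} :=
  fun c => `[< is_coboundary (val c) >].

Lemma coboundaries_submod : submod_closed coboundaries.
Proof.
split; first by apply/asboolP; rewrite linear0; exact: is_coboundary0.
move=> a c c' /asboolP bc /asboolP bc'; apply/asboolP.
by rewrite linearP; exact: is_coboundaryP.
Qed.
HB.instance Definition _ := GRing.isSubmodClosed.Build k (cocycle G n)
  coboundaries coboundaries_submod.

Definition cohomology : Type := Quotient.quot coboundaries.
HB.instance Definition _ := GRing.Zmodule.on cohomology.
HB.instance Definition _ := EqQuotient.on cohomology.

Lemma cohomology_eqP (c c' : cocycle G n) :
  is_coboundary (val c - val c') <-> \pi_cohomology c = \pi_cohomology c'.
Proof.
split => [h|/eqmodP/asboolP//].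
by apply/eqmodP; rewrite /= /Quotient.equiv; apply/asboolP.
Qed.

Definition cohomology_scale (a : k) (h : cohomology) : cohomology :=
  \pi_cohomology (a *: repr h).

Lemma cohomology_scaleE a (c : cocycle G n) :
  cohomology_scale a (\pi_cohomology c) = \pi_cohomology (a *: c).
Proof.
apply/cohomology_eqP.
have /cohomology_eqP := reprK (\pi_cohomology c).
move: (repr _) => c0 h; rewrite [val (a *: c0)]linearZ [val (a *: c)]linearZ.
rewrite -scalerBr -[X in is_coboundary X]addr0; apply: is_coboundaryP => //.
exact: is_coboundary0.
Qed.

Lemma cohomology_scaleA a b h :
  cohomology_scale a (cohomology_scale b h) = cohomology_scale (a * b) h.
Proof.
rewrite -[h]reprK; move: (repr h) => c.
by rewrite (cohomology_scaleE b) !cohomology_scaleE scalerA.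
Qed.

Lemma cohomology_scale1 : left_id 1 cohomology_scale.
Proof. by move=> h; rewrite -[h]reprK cohomology_scaleE scale1r. Qed.

Lemma cohomology_scaleDr : right_distributive cohomology_scale +%R.
Proof.
move=> a h h'; rewrite -[h]reprK -[h']reprK !cohomology_scaleE.
have piD (c c' : cocycle G n) : \pi_cohomology c + \pi_cohomology c' =
    \pi_cohomology (c + c') by rewrite !piE.
by rewrite !piD cohomology_scaleE scalerDr.
Qed.

Lemma cohomology_scaleDl h :
  {morph cohomology_scale^~ h : a b / a + b}.
Proof.
move=> a b; rewrite -[h]reprK !cohomology_scaleE scalerDl.
by rewrite !piE.
Qed.

HB.instance Definition _ := GRing.Zmodule_isLmodule.Build k cohomology
  cohomology_scaleA cohomology_scale1 cohomology_scaleDr cohomology_scaleDl.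

End Quotient.

Section Pullback.
Context (G K : groupType) (phi : Multiplicative.type G K) (n : nat).

Definition pullback_cochain (c : cochain K n) : cochain G n :=
  fun g => c [ffun i => phi (g i)].

End Pullback.

Lemma bar_diff_pullback (G K : groupType) (phi : Multiplicative.type G K)
    (n : nat) (c : cochain K n) :
  bar_diff (pullback_cochain phi c) = pullback_cochain phi (bar_diff c).
Proof.
apply/funext => g; apply: eq_bigr => j _; congr (_ * c _).
apply/ffunP => i; rewrite !ffunE /=.
by case: ifP => // _; case: ifP => // _; rewrite gmulfM.
Qed.

Section PullbackCohomology.
Context (G K : groupType) (phi : Multiplicative.type G K) (n : nat).

Lemma pullback_cocycle_subproof (c : cocycle K n) :
  pullback_cochain phi (val c) \in @cocycles G n.
Proof.
have := valP c; rewrite !unfold_in bar_diff_pullback => /eqP ->.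
by apply/eqP/funext.
Qed.

Definition pullback_cocycle (c : cocycle K n) : cocycle G n :=
  exist _ (pullback_cochain phi (val c)) (pullback_cocycle_subproof c).

Definition pullback (h : cohomology K n) : cohomology G n :=
  \pi_(cohomology G n) (pullback_cocycle (repr h)).

Lemma pullbackE (c : cocycle K n) :
  pullback (\pi_(cohomology K n) c) =
  \pi_(cohomology G n) (pullback_cocycle c).
Proof.
apply/cohomology_eqP.
have /cohomology_eqP := reprK (\pi_(cohomology K n) c).
move: (repr _) => c0 h.
change (is_coboundary (pullback_cochain phi (val c0 - val c))).
move: (val c0 - val c) h; case: n => [|m] e /=; first by move=> ->.
by move=> [b ->]; exists (pullback_cochain phi b); rewrite bar_diff_pullback.
Qed.

End PullbackCohomology.
End Cohomology.

Section SymmetricAction.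
Context (k : fieldType) (R : realType) (X : topologicalType).
Context (s : nat) (x : 'I_s -> X) (n : nat).

(* Pulling back along g |-> f^-1 g f makes this a left action. *)
Definition Gamma_act (sigma : 'S_s) (h : cohomology k (Gamma R x) n) :
    cohomology k (Gamma R x) n :=
  pullback (Gamma_conj (permuting_class R x sigma)) h.

End SymmetricAction.

Section Specht.
Context (k : fieldType) (s : nat).

(* 'S_s acts on the left through composition of functions, while mathcomp's
   product of permutations is (p * q) a = q (p a).  The group algebra is the
   space of functions on 'S_s, on which sigma sends the indicator of tau to that
   of sigma \o tau. *)
Definition group_algebra_act (sigma : 'S_s) (v : {ffun 'S_s -> k^o}) :
    {ffun 'S_s -> k^o} := [ffun tau : 'S_s => v (tau * sigma^-1)%g].

Lemma group_algebra_act_linear sigma : linear (group_algebra_act sigma).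
Proof. by move=> a u v; apply/ffunP => tau; rewrite !ffunE. Qed.
HB.instance Definition _ sigma := GRing.isLinear.Build k
  {ffun 'S_s -> k^o} {ffun 'S_s -> k^o} _ (group_algebra_act sigma)
  (group_algebra_act_linear sigma).

Lemma group_algebra_actM sigma tau v :
  group_algebra_act sigma (group_algebra_act tau v) =
  group_algebra_act (tau * sigma)%g v.
Proof. by apply/ffunP => u; rewrite !ffunE invMg mulgA. Qed.

(* The tableau of shape la filled with 0, 1, ..., s - 1 row by row. *)
Definition row_group (la : seq nat) : {set 'S_s} :=
  [set p : 'S_s | [forall a, reshape_index la (p a) == reshape_index la a]].

Definition col_group (la : seq nat) : {set 'S_s} :=
  [set q : 'S_s | [forall a, reshape_offset la (q a) == reshape_offset la a]].

(* The polytabloid \sum_(q in C) sgn(q) q {t}, with the tabloid {t} being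
   \sum_(p in R) p. *)
Definition polytabloid (la : seq nat) : {ffun 'S_s -> k^o} :=
  [ffun tau : 'S_s => \sum_(q in col_group la)
     \sum_(p in row_group la | (p * q)%g == tau) (-1) ^+ odd_perm q].

Definition is_partition (la : seq nat) : bool :=
  sorted geq la && (sumn la == s).

(* P_la; trailing zero parts are allowed, and P_la = 0 when la is not a
   partition of s. *)
Definition specht_space (la : seq nat) : {vspace {ffun 'S_s -> k^o}} :=
  if is_partition la then
    <<[seq group_algebra_act sigma (polytabloid la) | sigma : 'S_s]>>%VS
  else 0%VS.

Definition specht (la : seq nat) : vectType k := subvs_of (specht_space la).

Lemma specht_space_act la sigma v :
  v \in specht_space la -> group_algebra_act sigma v \in specht_space la.
Proof.
rewrite /specht_space; case: ifP => _; last first.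
  by rewrite !memv0 => /eqP ->; rewrite linear0.
move=> /(memv_img (linfun (group_algebra_act sigma))).
rewrite limg_span lfunE; apply: subvP; apply: sub_span => w /mapP[u + ->].
move=> /mapP[tau _ ->]; rewrite lfunE /= group_algebra_actM.
by apply/mapP; exists (tau * sigma)%g; rewrite ?mem_enum.
Qed.

Definition specht_act (la : seq nat) (sigma : 'S_s) (v : specht la) :
    specht la := vsproj (specht_space la) (group_algebra_act sigma (vsval v)).

Lemma specht_actE la sigma (v : specht la) :
  vsval (specht_act sigma v) = group_algebra_act sigma (vsval v).
Proof. by rewrite vsprojK// specht_space_act// subvsP. Qed.

Definition sign_act (sigma : 'S_s) (a : k^o) : k^o := (-1) ^+ odd_perm sigma * a.

Definition rep_iso (V W : lmodType k) (actV : 'S_s -> V -> V)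
    (actW : 'S_s -> W -> W) : Prop :=
  exists f : {linear V -> W},
    bijective f /\ forall sigma v, f (actV sigma v) = actW sigma (f v).

End Specht.

(* Main.v *)
(* A graph X of rank one is a K(Z,1): closing paths up along reference paths
   attaches to every path p an integer w(p), its winding, which together with
   the end points determines p up to homotopy.  A self-map f satisfies
   w(f p) = eps w(p) + c(p 1) - c(p 0), where eps is its degree, and two maps
   are homotopic relative to the marked points x_i iff they have the same eps
   and the same differences c(x_i) - c(x_0); every eps = 1, -1 and every c occur.
   Thus Gamma_{1,s} is Z^(s-1) extended by {1,-1}, and S_s permutes the
   coordinates of Z^s modulo the diagonal.

   For the cohomology, let the group act affinely on the coordinate lines of
   Z^(s-1).  Comparing the stabilisers of a vertex and of an edge of a line gives
   (half of) a Wang sequence, and Pascal's rule bounds dim H^i by 'C(s-1,i) for i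
   even and by 0 for i odd.  For i even, cup products of i coordinate cocycles
   map the group algebra of S_s equivariantly to H^i.  Alternating sums over
   commuting translations detect these classes: the map is injective on the
   Specht module of the hook (s-i,1^i), and its values at 'C(s-1,i) suitable
   polytabloids are independent, hence a basis. *)

Require Import Defs.
From mathcomp Require Import all_boot all_order all_algebra all_fingroup.
From mathcomp Require Import all_classical all_reals all_analysis.
From mathcomp Require Import ring lra zify.
From HB Require Import structures.
From Corelib Require Setoid Morphisms RelationClasses.

Set Implicit Arguments.
Unset Strict Implicit.
Unset Printing Implicit Defensive.

Import Order.TTheory GRing.Theory Num.Theory.
Import numFieldNormedType.Exports.
Local Open Scope classical_set_scope.
Local Open Scope ring_scope.

(** * Gluing maps and homotopies along the cells of a graph *)

(** Only half of the Wang sequence is needed because an upper bound and a detection argument meet at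
    the same binomial coefficient. A reflection reverses the edges of a line, so passing to an edge
    stabiliser twists the coefficients by the sign character; the bound therefore has to be proved
    for both characters at once, and parity decides which terms of Pascal's rule survive. For the
    same reason a product of an odd number of coordinate cocycles changes sign under reflections and
    gives no class with trivial coefficients. Characteristic zero serves to invert 2, the order of
    the smallest stabilisers, and the product of n! with the order of the row group, by which the
    detectors are scaled. Once the bound is attained, the detectors separate cohomology classes.
    Equivariance is then read off from values on translations, with no explicit primitive and
    without knowing how conjugation acts on reflections; the degree of the chosen permuting class
    remains an unknown sign, which occurs only to an even power. *)

Lemma within_finite_bigcup (T U : topologicalType) (I : choiceType)
    (A : set I) (C : I -> set T) (f : T -> U) :
  finite_set A -> (forall i, A i -> closed (C i)) ->
  (forall i, A i -> {within C i, continuous f}) ->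
  {within \bigcup_(i in A) C i, continuous f}.
Proof.
move=> finA clC cf; apply/continuous_closedP => W cW.
apply/closed_subspaceP; exists (\bigcup_(i in A) (C i `&` f @^-1` W)).
  apply: closed_bigcup => // i Ai.
  have /continuous_closedP/(_ _ cW)/closed_subspaceP[V cV VE] := cf _ Ai.
  by rewrite setIC -VE; apply: closedI => //; exact: clC.
apply/seteqP; split => t /=.
  by move=> [[i Ai [Cit ft]] _]; split => //; exists i.
by move=> [ft [i Ai Cit]]; split; exists i.
Qed.

(** A continuous map from a compact set to a Hausdorff space is closed, hence a quotient map onto
    its image, so continuity can be tested after pulling back. This recovers the weak topology of a
    finite graph. *)
Lemma within_compact_image (S T U : topologicalType) (K : set S)
    (phi : S -> T) (f : T -> U) :
  hausdorff_space T -> compact K -> {within K, continuous phi} ->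
  {within K, continuous (f \o phi)} ->
  closed (phi @` K) /\ {within phi @` K, continuous f}.
Proof.
move=> hT cK cphi cf; split.
  by apply: compact_closed => //; exact: continuous_compact.
apply/continuous_closedP => W cW.
have /continuous_closedP/(_ _ cW)/closed_subspaceP[V cV VE] := cf.
apply/closed_subspaceP; exists (phi @` (K `&` V)).
  apply: compact_closed => //; apply: continuous_compact.
    by apply: continuous_subspaceW cphi => t [].
  exact: compact_closedI.
have KV t : K t -> V t <-> W (f (phi t)).
  move=> Kt; have := congr1 (fun B : set S => B t) VE; rewrite /= /setI /=.
  move=> e; split => [Vt|Wt]; last by have [] : V t /\ K t by rewrite e.
  by have [] : W (from_subspace K (f \o phi) t) /\ K t by rewrite -e.
apply/seteqP; split => t /=.
  by move=> [[s [Ks Vs] <-] _]; split; [exact/KV|exists s].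
by move=> [Wf [s Ks ?]]; subst t; split; exists s => //; split => //; exact/KV.
Qed.

Lemma hausdorff_space_prod (S T : topologicalType) :
  hausdorff_space S -> hausdorff_space T -> hausdorff_space (S * T)%type.
Proof.
move=> hS hT [p u] [q v] cl; congr (_, _).
  apply: hS => A B nA nB; have [z [? ?]] := cl _ _ (@cvg_fst _ _ (nbhs p) (nbhs u) _ _ nA)
    (@cvg_fst _ _ (nbhs q) (nbhs v) _ _ nB).
  by exists z.1.
apply: hT => A B nA nB; have [z [? ?]] := cl _ _ (@cvg_snd _ _ (nbhs p) (nbhs u) _ _ nA)
  (@cvg_snd _ _ (nbhs q) (nbhs v) _ _ nB).
by exists z.2.
Qed.

Notation is_path f := {within `[0%R, 1%R], continuous f}.

Section Cells.
Context (R : realType) (X : topologicalType).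

(** The clauses of [finite_graph], with edges indexed by any finite type so that a subdivision can
    be indexed by [option E]. *)
Definition graph_cells (E : finType) (edge : E -> R -> X) (V : set X) : Prop :=
  [/\ finite_set V,
      forall e, [/\ is_path (edge e), V (edge e 0) & V (edge e 1)],
      forall e t, 0 < t < 1 -> ~ V (edge e t),
      forall e e' t t', 0 < t < 1 -> 0 < t' < 1 ->
        edge e t = edge e' t' -> e = e' /\ t = t' &
      forall p, V p \/ exists e t, 0 < t < 1 /\ p = edge e t].

Lemma path_affine (f : R -> X) (a d : R) :
  is_path f -> 0 <= a <= 1 -> 0 <= a + d <= 1 -> is_path (fun t => f (a + d * t)).
Proof.
move=> cf a01 d01; apply: (within_comp (f := fun t => a + d * t) _ _ cf).
  by move=> t /=; rewrite !in_itv /=; nra.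
apply: continuous_subspaceT => t; apply: cvgD; first exact: cvg_cst.
by apply: cvgM; [exact: cvg_cst|exact: cvg_id].
Qed.

Lemma subdivide_edge (E : finType) (edge : E -> R -> X) (V : set X) e0 t0 :
  graph_cells edge V -> 0 < t0 < 1 ->
  exists (E' : finType) (edge' : E' -> R -> X),
    graph_cells edge' (edge e0 t0 |` V).
Proof.
move=> [finV bd intV inj cov] t01.
(* [Some e0] becomes the part of [e0] before [t0] and [None] the part after it; every other edge
   keeps its parametrisation. *)
pose lo (o : option E) : R := if o is Some _ then 0 else t0.
pose len (o : option E) : R :=
  if o is Some e then if e == e0 then t0 else 1 else 1 - t0.
pose und (o : option E) := odflt e0 o.
exists (option E : finType), (fun o t => edge (und o) (lo o + len o * t)).
have inside o t : 0 < t < 1 -> 0 < lo o + len o * t < 1.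
  by case: o => [e|] /=; [case: eqP => _|]; nra.
have e0V : ~ V (edge e0 t0) by exact: intV.
split.
- by rewrite finite_setU; split => //; exact: finite_set1.
- move=> o; have [cf V0 V1] := bd (und o); split.
  + by apply: path_affine => //; case: o {cf V0 V1} => [e|] /=; try case: eqP => _; nra.
  + case: o cf V0 V1 => [e|] /= cf V0 V1.
      by rewrite mulr0 addr0; right.
    by rewrite mulr0 addr0; left.
  + case: o cf V0 V1 => [e|] /= cf V0 V1.
      case: eqP => [->|_]; first by rewrite mulr1 add0r; left.
      by rewrite mulr1 add0r; right.
    by rewrite mulr1 addrC subrK; right.
- move=> o t t1 [|]; last exact: intV (inside _ _ t1).
  move=> /(inj _ _ _ _ (inside o t t1) t01)[].
  by case: o => [e|] /= => [->|_]; rewrite ?eqxx; nra.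
- move=> o o' t t' t1 t1' /(inj _ _ _ _ (inside o t t1) (inside o' t' t1')).
  case: o => [e|]; case: o' => [e'|] /= [].
  + by move=> ->; case: eqP => _ h; split => //; nra.
  + by move=> ->; rewrite eqxx => h; exfalso; nra.
  + by move=> <-; rewrite eqxx => h; exfalso; nra.
  + by move=> _ h; split => //; nra.
- move=> p; case: (cov p) => [Vp|[e [t [t1 ->]]]]; first by left; right.
  case: (eqVneq e e0) => [->|ne]; last first.
    by right; exists (Some e), t; split => //=; rewrite (negbTE ne) add0r mul1r.
  have t0n0 : t0 != 0 by lra.
  have t0n1 : 1 - t0 != 0 by lra.
  have [tt|tt|->] := ltgtP t t0; last by left; left.
  + right; exists (Some e0), (t / t0); rewrite /= eqxx add0r [t0 * _]mulrC mulfVK//.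
    split => //; rewrite divr_gt0 ?ltr_pdivrMr ?mul1r //=; lra.
  + right; exists None, ((t - t0) / (1 - t0)).
    rewrite /= [(1 - t0) * _]mulrC mulfVK// [t0 + _]addrC subrK; split => //.
    by rewrite divr_gt0 ?ltr_pdivrMr ?mul1r //=; lra.
Qed.

(** Marked points have to be vertices, since maps and homotopies are built cell by cell and are
    prescribed at vertices. *)
Lemma cells_with_points (s : seq X) : finite_graph R X ->
  exists (E : finType) (edge : E -> R -> X) (V : set X),
    graph_cells edge V /\ forall p, p \in s -> V p.
Proof.
move=> [_ [V [m [edge gr]]]].
elim: s => [|p s [E' [edge' [V' [gr' sV']]]]].
  by exists ('I_m : finType), edge, V; split.
have [_ _ _ _ /(_ p)[Vp|[e [t [t01 pE]]]]] := gr'.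
  exists E', edge', V'; split => // q; rewrite in_cons => /orP[/eqP->//|].
  exact: sV'.
have [E'' [edge'' gr'']] := subdivide_edge e gr' t01.
exists E'', edge'', (edge' e t |` V'); split => // q.
rewrite in_cons => /orP[/eqP->|/sV']; last by right.
by left.
Qed.

Section Glue.
Context (E : finType) (edge : E -> R -> X) (V : set X).
Hypotheses (hX : hausdorff_space X) (gr : graph_cells edge V).

(** The open edges avoid [V] and one another, so a point has several parameters only at a vertex,
    where the conditions on [q] make the values agree. The target is a bare type because
    [wind_homotopic] glues whole tracks, that is, functions of time. *)
Lemma glue_cells (Y : Type) (phi : X -> Y) (q : E -> R -> Y) :
  (forall e, q e 0 = phi (edge e 0)) -> (forall e, q e 1 = phi (edge e 1)) ->
  exists f : X -> Y, (forall v, V v -> f v = phi v) /\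
    (forall e t, 0 <= t <= 1 -> f (edge e t) = q e t).
Proof.
have [_ bd intV inj cov] := gr; move=> q0 q1.
have h p : exists y, (V p -> y = phi p) /\
    (forall e t, 0 <= t <= 1 -> edge e t = p -> y = q e t).
  case: (cov p) => [Vp|[e [t [t01 ->]]]].
    exists (phi p); split => // e t t01 et.
    have [t0|t0|t0] := ltgtP t 0; [by exfalso; lra| |by rewrite t0 q0 -t0 et].
    have [t1|t1|t1] := ltgtP t 1; [|by exfalso; lra|by rewrite t1 q1 -t1 et].
    by exfalso; apply: (intV e t); rewrite ?t0 ?t1// et.
  exists (q e t); split => [Vp|e' t' t'01 ee'].
    by exfalso; exact: (intV e t).
  have [_ V0 V1] := bd e'.
  have t0 : t' != 0.
    by apply/eqP => t0; apply: (intV e t) => //; rewrite -ee' t0.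
  have t1 : t' != 1.
    by apply/eqP => t1; apply: (intV e t) => //; rewrite -ee' t1.
  by have [|<- <-] := inj _ _ _ _ _ t01 ee'; [lra|].
have [f fP] := choice h; exists f; split => [v|e t t01]; first by case: (fP v).
by have [_ h'] := fP (edge e t); exact: h'.
Qed.

Lemma cover_cells : [set: X] = (\bigcup_(e in [set: E]) edge e @` `[0, 1]) `|` V.
Proof.
have [_ _ _ _ cov] := gr; apply/seteqP; split => // p _.
case: (cov p) => [|[e [t [t01 ->]]]]; first by right.
by left; exists e => //; exists t => //=; rewrite in_itv /=; lra.
Qed.

(** The cylinder over the graph is a finite union of compact images of squares and of segments over
    vertices; the segments account for vertices lying on no edge. *)
Lemma homotopy_on_cells (Y : topologicalType) (H : X * R -> Y) :
  (forall e, {within `[0, 1] `*` `[0, 1],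
                continuous (fun z => H (edge e z.1, z.2))}) ->
  (forall v, V v -> is_path (fun u => H (v, u))) ->
  {within [set: X] `*` `[0, 1], continuous H}.
Proof.
move=> cE cV; have [finV bd _ _ _] := gr.
have hXR : hausdorff_space (X * R)%type.
  by apply: hausdorff_space_prod => //; exact: Rhausdorff.
pose Phi e (z : R * R) := (edge e z.1, z.2).
have cPhi e : {within `[0, 1] `*` `[0, 1], continuous (Phi e)}.
  apply: within_pair.
    have [ce _ _] := bd e.
    apply: within_comp ce; first by move=> [t u] [].
    by apply: continuous_subspaceT => z; exact: cvg_fst.
  by apply: continuous_subspaceT => z; exact: cvg_snd.
have K2 : compact (`[0, 1] `*` `[0, 1] : set (R * R)).
  by apply: compact_setX; exact: segment_compact.
have {}cE e := within_compact_image hXR K2 (cPhi e) (cE e).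
have cPsi (v : X) : is_path (fun u : R => (v, u)).
  by apply: within_pair; apply: continuous_subspaceT => z; [exact: cvg_cst|exact: cvg_id].
have {}cV v (Vv : V v) := within_compact_image hXR (@segment_compact R 0 1) (cPsi v) (cV _ Vv).
have -> : [set: X] `*` `[0, 1] =
    (\bigcup_(e in [set: E]) Phi e @` (`[0, 1] `*` `[0, 1])) `|`
    \bigcup_(v in V) (fun u : R => (v, u)) @` `[0, 1].
  have := cover_cells; move=> cov; apply/seteqP; split => [[p u] [_ /= u01]|].
    have : [set: X] p by [].
    rewrite cov => -[[e _ [t t01 <-]]|Vp].
      by left; exists e => //; exists (t, u).
    by right; exists p => //; exists u.
  move=> z [[e _ [[t u] [/= _ u01] <-]]|[v _ [u u01 <-]]]; first by split.
  by split.
have fE : finite_set [set: E] by exact: finite_finset.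
apply: withinU_continuous.
- by apply: closed_bigcup => // e _; have [] := cE e.
- by apply: closed_bigcup => // v /cV[].
- by apply: within_finite_bigcup => // e _; have [] := cE e.
- by apply: within_finite_bigcup => // v /cV[].
Qed.

Lemma continuous_on_cells (Y : topologicalType) (f : X -> Y) :
  (forall e, is_path (f \o edge e)) -> continuous f.
Proof.
(* A map is continuous as soon as the constant homotopy at it is, and restricting to time 0 gives it
   back. *)
move=> cf; have cH : {within [set: X] `*` `[0%R, 1%R], continuous (f \o fst : X * R -> Y)}.
  apply: homotopy_on_cells => [e|v _].
    apply: (within_comp (f := fst) _ _ (cf e)); first by move=> [t u] [].
    by apply: continuous_subspaceT => z; exact: cvg_fst.
  rewrite (_ : (fun u => _) = cst (f v)); last exact/funext.
  by apply: continuous_subspaceT => z; exact: cvg_cst.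
have h : {within [set: X], continuous f}.
  apply: (within_comp (f := fun p : X => (p, 0 : R)) _ _ cH).
    by move=> p _; split => //=; rewrite in_itv /= lexx ler01.
  by apply: within_pair; apply: continuous_subspaceT => p; [exact: cvg_id|exact: cvg_cst].
by move=> p; have := h p; rewrite /continuous_at nbhs_subspaceT.
Qed.

End Glue.
End Cells.

(** * Paths and their winding *)

Section PathGroupoid.
Context (R : realType) (X : topologicalType).

Local Notation homotopic :=
  (@homotopic_rel R R X `[0%R, 1%R]%classic [set 0%R; 1%R]%classic).

Let bdI : [set 0; 1 : R] `<=` `[0, 1].
Proof. by move=> t [] ->; rewrite /= in_itv /=; lra. Qed.

Let clI : closed (`[0, 1] : set R).
Proof. exact: interval_closed. Qed.

(** Keeping the end points in the type makes concatenation total, so that the groupoid laws up to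
    homotopy can be used for setoid rewriting. *)
Record pth (y z : X) := Pth {
  pth_val :> R -> X;
  pth_path : is_path pth_val;
  pth0 : pth_val 0 = y;
  pth1 : pth_val 1 = z }.

Definition pth_eq y z (p q : pth y z) : Prop := homotopic p q.

#[global] Instance pth_eq_equiv y z : RelationClasses.Equivalence (@pth_eq y z).
Proof.
split=> [p|p q|p q r]; first exact/homotopic_refl/pth_path.
- exact: homotopic_sym.
- exact: homotopic_trans.
Qed.

Lemma concat0 (f g : R -> X) : concat f g 0 = f 0.
Proof. by rewrite /concat invr_ge0 ler0n mulr0. Qed.

Lemma concat1 (f g : R -> X) : concat f g 1 = g 1.
Proof.
rewrite /concat ifF; last by apply/negbTE; rewrite -ltNge; lra.
by rewrite (_ : 2 * 1 - 1 = 1)//; lra.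
Qed.

Lemma pth_mul_path y z u (p : pth y z) (q : pth z u) : is_path (concat p q).
Proof. by apply: path_concat; [exact: pth_path|exact: pth_path|rewrite pth0 pth1]. Qed.

Definition pth_mul y z u (p : pth y z) (q : pth z u) : pth y u :=
  Pth (@pth_mul_path y z u p q) (etrans (concat0 p q) (pth0 p))
    (etrans (concat1 p q) (pth1 q)).

Lemma reverse_path (f : R -> X) : is_path f -> is_path (reverse f).
Proof.
move=> cf; apply: (@within_comp R R X `[0, 1] `[0, 1] (fun t => 1 - t) f _ _ cf).
  by move=> t /=; rewrite !in_itv /=; lra.
by apply: continuous_subspaceT => t; apply: cvgB; [exact: cvg_cst|exact: cvg_id].
Qed.

Lemma reverse0 (f : R -> X) : reverse f 0 = f 1.
Proof. by rewrite /reverse subr0. Qed.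

Lemma reverse1 (f : R -> X) : reverse f 1 = f 0.
Proof. by rewrite /reverse subrr. Qed.

Definition pth_inv y z (p : pth y z) : pth z y :=
  Pth (@reverse_path p (@pth_path y z p)) (etrans (reverse0 p) (pth1 p))
    (etrans (reverse1 p) (pth0 p)).

Lemma cst_path (y : X) : is_path (cst y : R -> X).
Proof. by apply: continuous_subspaceT => t; exact: cvg_cst. Qed.

Definition pth_one y : pth y y := Pth (@cst_path y) erefl erefl.

#[global] Instance pth_mul_proper y z u :
  Morphisms.Proper (Morphisms.respectful (@pth_eq y z)
    (Morphisms.respectful (@pth_eq z u) (@pth_eq y u))) (@pth_mul y z u).
Proof. by move=> p p' pp q q' qq; apply: homotopic_concat => //; rewrite pth0 pth1. Qed.

Lemma homotopic_reparam2 (p q r : R -> X) (phi psi : R -> R) :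
  is_path p -> is_path q -> is_path r ->
  continuous phi -> continuous psi ->
  (forall t, 0 <= t <= 1 -> 0 <= phi t <= 1) ->
  (forall t, 0 <= t <= 1 -> 0 <= psi t <= 1) ->
  phi 0 = psi 0 -> phi 1 = psi 1 ->
  (forall t, 0 <= t <= 1 -> q t = p (phi t)) ->
  (forall t, 0 <= t <= 1 -> r t = p (psi t)) ->
  homotopic q r.
Proof.
move=> cp cq cr cphi cpsi phi01 psi01 e0 e1 qE rE.
apply: (homotopic_trans bdI clI (g := p \o phi)).
  by apply: homotopic_eq cq _ => t; rewrite /= in_itv; exact: qE.
apply: (homotopic_trans bdI clI (homotopic_reparam cp cphi cpsi phi01 psi01 e0 e1)).
apply: (homotopic_sym bdI); apply: homotopic_eq cr _ => t.
by rewrite /= in_itv; exact: rE.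
Qed.

Let c_aff (a c : R) : continuous (fun t : R => a * t + c).
Proof.
move=> t; apply: cvgD; last exact: cvg_cst.
by apply: cvgM; [exact: cvg_cst|exact: cvg_id].
Qed.

Lemma pth_mulA y z u v (p : pth y z) (q : pth z u) (r : pth u v) :
  pth_eq (pth_mul p (pth_mul q r)) (pth_mul (pth_mul p q) r).
Proof.
symmetry.
(* The minimum of the three affine maps sends the break points 1/4 and 1/2 of [(p q) r] to the break
   points 1/2 and 3/4 of [p (q r)]. *)
apply: (@homotopic_reparam2 (pth_mul p (pth_mul q r)) _ _
  ((fun t => 2 * t + 0) \min
  ((fun t => 1 * t + 4^-1) \min (fun t => 2^-1 * t + 2^-1))) (fun t => 1 * t + 0));
  try exact: pth_path.
- by apply: min_fun_continuous; [|apply: min_fun_continuous]; exact: c_aff.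
- exact: c_aff.
- by move=> t t01 /=; rewrite !minEle; repeat case: ifP; lra.
- by move=> t t01 /=; lra.
- by rewrite /= !minEle; repeat case: ifP; lra.
- by rewrite /= !minEle; repeat case: ifP; lra.
- move=> t t01 /=; rewrite /concat /= !minEle.
  (do ! case: ifP); move=> *; first [by exfalso; lra|f_equal; lra].
- by move=> t _; rewrite mul1r addr0.
Qed.

Lemma pth_mul1p y z (p : pth y z) : pth_eq (pth_mul (pth_one y) p) p.
Proof.
apply: (@homotopic_reparam2 p _ _
  ((fun t => 0 * t + 0) \max (fun t => 2 * t + (- 1))) (fun t => 1 * t + 0));
  try exact: pth_path.
- by apply: max_fun_continuous; exact: c_aff.
- exact: c_aff.
- by move=> t t01 /=; rewrite !maxEle; repeat case: ifP; lra.
- by move=> t t01 /=; lra.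
- by rewrite /= !maxEle; repeat case: ifP; lra.
- by rewrite /= !maxEle; repeat case: ifP; lra.
- move=> t t01 /=; rewrite /concat /= !maxEle.
  (do ! case: ifP); move=> *; first [by exfalso; lra
    |by apply: (etrans (esym (pth0 p))); f_equal; lra|by f_equal; lra].
- by move=> t _; rewrite mul1r addr0.
Qed.

Lemma pth_mulp1 y z (p : pth y z) : pth_eq (pth_mul p (pth_one z)) p.
Proof.
apply: (@homotopic_reparam2 p _ _
  ((fun t => 2 * t + 0) \min (fun t => 0 * t + 1)) (fun t => 1 * t + 0));
  try exact: pth_path.
- by apply: min_fun_continuous; exact: c_aff.
- exact: c_aff.
- by move=> t t01 /=; rewrite !minEle; repeat case: ifP; lra.
- by move=> t t01 /=; lra.
- by rewrite /= !minEle; repeat case: ifP; lra.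
- by rewrite /= !minEle; repeat case: ifP; lra.
- move=> t t01 /=; rewrite /concat /= !minEle.
  (do ! case: ifP); move=> *; first [by exfalso; lra
    |by apply: (etrans (esym (pth1 p))); f_equal; lra|by f_equal; lra].
- by move=> t _; rewrite mul1r addr0.
Qed.

Lemma pth_mulVp y z (p : pth y z) : pth_eq (pth_mul (pth_inv p) p) (pth_one z).
Proof.
apply: (@homotopic_reparam2 p _ _
  ((fun t => (- 2) * t + 1) \max (fun t => 2 * t + (- 1))) (fun t => 0 * t + 1));
  try exact: pth_path.
- by apply: max_fun_continuous; exact: c_aff.
- exact: c_aff.
- by move=> t t01 /=; rewrite !maxEle; repeat case: ifP; lra.
- by move=> t t01 /=; lra.
- by rewrite /= !maxEle; repeat case: ifP; lra.
- by rewrite /= !maxEle; repeat case: ifP; lra.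
- move=> t t01 /=; rewrite /concat /reverse /= !maxEle.
  (do ! case: ifP); move=> *; first [by exfalso; lra|f_equal; lra].
- by move=> t _; rewrite mul0r add0r pth1.
Qed.

Lemma pth_mulpV y z (p : pth y z) : pth_eq (pth_mul p (pth_inv p)) (pth_one y).
Proof.
apply: (@homotopic_reparam2 p _ _
  ((fun t => 2 * t + 0) \min (fun t => (- 2) * t + 2)) (fun t => 0 * t + 0));
  try exact: pth_path.
- by apply: min_fun_continuous; exact: c_aff.
- exact: c_aff.
- by move=> t t01 /=; rewrite !minEle; repeat case: ifP; lra.
- by move=> t t01 /=; lra.
- by rewrite /= !minEle; repeat case: ifP; lra.
- by rewrite /= !minEle; repeat case: ifP; lra.
- move=> t t01 /=; rewrite /concat /reverse /= !minEle.
  (do ! case: ifP); move=> *; first [by exfalso; lra|f_equal; lra].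
- by move=> t _; rewrite mul0r add0r pth0.
Qed.

Lemma pth_mulKp y z u (p : pth z y) (q : pth z u) :
  pth_eq (pth_mul p (pth_mul (pth_inv p) q)) q.
Proof. rewrite pth_mulA pth_mulpV pth_mul1p; reflexivity. Qed.

Lemma pth_mulVKp y z u (p : pth y z) (q : pth z u) :
  pth_eq (pth_mul (pth_inv p) (pth_mul p q)) q.
Proof. rewrite pth_mulA pth_mulVp pth_mul1p; reflexivity. Qed.

End PathGroupoid.

(** * Free groups of rank one and the integers *)

Definition zgroup : Type := int.
HB.instance Definition _ := Choice.on zgroup.
HB.instance Definition _ := isGroup.Build zgroup
  (@addrA int) (@add0r int) (@addr0 int) (@addNr int) (@addrN int).

(** The powers of the generator define [psi] from the integers to [G]. Both [psi \o phi] and the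
    identity are endomorphisms fixing the generator, so they agree by the uniqueness in the
    universal property. *)
Lemma free_rank1_int (G : groupType) : free_of_rank G 1 ->
  exists phi : G -> int, [/\ forall u v, phi (u * v)%g = phi u + phi v,
    injective phi & forall n, exists u, phi u = n].
Proof.
move=> [a fr].
have [phi [[phiM phia] _]] := fr zgroup (fun _ => (1 : int)).
have {}phiM u v : phi (u * v)%g = phi u + phi v :> int by rewrite phiM.
pose x := a ord0.
pose psi (n : int) : G :=
  match n with Posz m => (x ^+ m)%g | Negz m => ((x^-1) ^+ m.+1)%g end.
have psiS n : psi (n + 1) = (psi n * x)%g.
  case: n => m.
    have -> : (m : int) + 1 = m.+1 by lia.
    by rewrite /= expgSr.
  case: m => [|m].
    have -> : Negz 0 + 1 = 0%N by [].
    by rewrite /= expg0 expg1 mulVg.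
  have -> : Negz m.+1 + 1 = Negz m by rewrite !NegzE; lia.
  by rewrite /= [in RHS]expgSr -mulgA mulVg mulg1.
have psiP n : psi (n - 1) = (psi n * x^-1)%g.
  by have := psiS (n - 1); rewrite subrK => ->; rewrite -mulgA mulgV mulg1.
have psiD m n : psi (m + n) = (psi m * psi n)%g.
  elim/int_rec: n => [|n IH|n IH].
  - by rewrite addr0 /= expg0 mulg1.
  - have -> : (n.+1 : int) = (n : int) + 1 by lia.
    by rewrite addrA !psiS IH mulgA.
  - have -> : - (n.+1 : int) = - (n : int) - 1 by lia.
    by rewrite addrA !psiP IH mulgA.
have psi1 : psi 1 = x by rewrite /= expg1.
have psiK u : psi (phi u) = u.
  have [f [_ uf]] := fr G a.
  transitivity (f u).
    rewrite (uf (psi \o phi))//; split => [v v'|i] /=; first by rewrite phiM psiD.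
    by rewrite phia psi1 [i]ord1.
  by rewrite (uf idfun).
exists phi; split => //; first exact: can_inj psiK.
have phi1 : phi 1%g = 0 :> int.
  by have := phiM 1%g 1%g; rewrite mulg1 => h; lia.
have phiV u : phi (u^-1)%g = - phi u :> int.
  by have := phiM u (u^-1)%g; rewrite mulgV phi1 => h; lia.
have phiX u n : phi (u ^+ n)%g = (phi u : int) *+ n :> int.
  elim: n => [|n IH]; first by rewrite expg0.
  by rewrite expgS phiM IH mulrS.
move=> n; exists (psi n); case: n => m /=; rewrite phiX.
  by rewrite phia natz.
by rewrite phiV phia NegzE mulNrn natz.
Qed.

(** * Path connectedness of a connected graph *)

Section Connected.
Context (R : realType) (X : topologicalType).
Context (E : finType) (edge : E -> R -> X) (V : set X).
Hypotheses (hX : hausdorff_space X) (gr : graph_cells edge V).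
Hypothesis Xconn : connected [set: X].

(** The cells on which [P] holds have a closed union, and so have those on which it fails. The two
    unions are complementary because [P] agrees at both ends of each edge, so connectedness makes
    one of them empty. *)
Lemma vertex_connected (P : X -> Prop) :
  (forall e, P (edge e 0) <-> P (edge e 1)) ->
  forall v v', V v -> V v' -> P v -> P v'.
Proof.
have [finV bd intV inj cov] := gr; move=> Pe v v' Vv Vv' Pv.
pose U (Q : X -> Prop) : set X :=
  (\bigcup_(e in [set e | Q (edge e 0)]) edge e @` `[0, 1]) `|` (V `&` Q).
have clU Q : closed (U Q).
  apply: closedU.
    apply: closed_bigcup; first exact: finite_finset.
    move=> e _; apply: compact_closed => //; apply: continuous_compact.
      by have [] := bd e.
    exact: segment_compact.
  apply: (accessible_finite_set_closed.1 (hausdorff_accessible hX)).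
  exact: finite_setIl.
have onV Q p : (forall e, Q (edge e 0) <-> Q (edge e 1)) -> V p -> U Q p -> Q p.
  move=> Qe Vp [[e Qe0 [t /= +]]|[]//]; rewrite in_itv /= => t01 et.
  have [t0|t0|t0] := ltgtP t 0; [by exfalso; lra| |by rewrite -et t0].
  have [t1|t1|t1] := ltgtP t 1; [|by exfalso; lra|by rewrite -et t1; apply/Qe].
  by exfalso; apply: (intV e t); rewrite ?t0 ?t1// et.
have nPe e : ~ P (edge e 0) <-> ~ P (edge e 1) by rewrite Pe.
have UC : U P = ~` U (fun p => ~ P p).
  apply/seteqP; split => p.
    move=> UP UN.
    case: (cov p) => [Vp|[e [t [t01 pE]]]].
      by have := onV _ _ nPe Vp UN; apply; exact: onV UP.
    have aux Q : U Q p -> Q (edge e 0).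
      move=> [[e' Qe' [t' /= +]]|[Vp]]; last by exfalso; apply: (intV e t); rewrite -?pE.
      rewrite in_itv /= => t'01 et'.
      have [_ V0 V1] := bd e'.
      have t0 : t' != 0.
        by apply/eqP => t0; apply: (intV e t) => //; rewrite -pE -et' t0.
      have t1 : t' != 1.
        by apply/eqP => t1; apply: (intV e t) => //; rewrite -pE -et' t1.
      have t'01' : 0 < t' < 1 by lra.
      by have [<- _] := inj e' e t' t t'01' t01 (etrans et' pE).
    by apply: (aux _ UN); exact: aux.
  move=> nU; have [/= |nP] := pselect (U P p) => //; exfalso; apply: nU.
  case: (cov p) => [Vp|[e [t [t01 pE]]]].
    by right; split => // Pp; apply: nP; right.
  left; exists e => /=; last by exists t => //=; rewrite in_itv /=; lra.
  by move=> Pe0; apply: nP; left; exists e => //; exists t => //=; rewrite in_itv /=; lra.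
have UT : U P = setT.
  apply: Xconn; first by exists v; right.
    exists (U P); last by rewrite setTI.
    by rewrite UC; apply: closed_openC.
  by exists (U P); rewrite ?setTI.
by apply: onV => //; rewrite UT.
Qed.

Lemma graph_path_connected (y z : X) : inhabited (pth R y z).
Proof.
have [finV bd intV inj cov] := gr.
have toV p : exists2 v, V v & inhabited (pth R v p).
  case: (cov p) => [Vp|[e [t [t01 ->]]]].
    by exists p => //; constructor; exact: pth_one.
  have [ce V0 _] := bd e.
  exists (edge e 0) => //; constructor.
  have h : is_path (fun u => edge e (0 + t * u)) by apply: path_affine => //; lra.
  by exists (fun u => edge e (0 + t * u)) => //; rewrite ?mulr0 ?mulr1 ?addr0 ?add0r.
have [v Vv [p]] := toV y; have [v' Vv' [q]] := toV z.
have [r] : inhabited (pth R v v').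
  apply: (@vertex_connected (fun u => inhabited (pth R v u)) _ v v') => //.
    move=> e; have [ce _ _] := bd e.
    pose r : pth R (edge e 0) (edge e 1) := Pth ce erefl erefl.
    split => -[r']; constructor; first exact: pth_mul r' r.
    exact: pth_mul r' (pth_inv r).
  by constructor; exact: pth_one.
by constructor; exact: pth_mul (pth_inv p) (pth_mul r q).
Qed.

End Connected.

(** * Winding of paths and its behaviour under maps *)

Section Winding.
Context (R : realType) (X : topologicalType).

(* The winding of a path measured against a generator of pi_1(X) = Z. *)
Definition is_winding (w : (R -> X) -> int) : Prop :=
  [/\ forall y z u (p : pth R y z) (q : pth R z u), w (pth_mul p q) = w p + w q,
      forall y z (p q : pth R y z), pth_eq p q <-> w p = w q &
      forall y z n, exists p : pth R y z, w p = n].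

Lemma exists_winding : (forall y z : X, inhabited (pth R y z)) -> has_rank R X 1 ->
  exists w, is_winding w.
Proof.
move=> pc [b /free_rank1_int[phi [phiM phiI phiS]]].
have [tau _] : exists tau : forall y, pth R b y, True.
  by exists (fun y => projT1 (cid (let: inhabits p := pc b y in ex_intro _ p I))).
have lp (l : pth R b b) : `[< @is_loop R X b l >].
  by apply/asboolP; split; [exact: pth_path|exact: pth0|exact: pth1].
pose cl (l : pth R b b) : fundamental_group R b :=
  \pi_(fundamental_group R b)%qT (exist _ (pth_val l) (lp l)).
have clE l l' : cl l = cl l' <-> pth_eq l l'.
  by split => [/pi1_eqP //|h]; exact/pi1_eqP.
have clM l l' : cl (pth_mul l l') = (cl l * cl l')%g.
  rewrite [(_ * _)%g]pi1_mulE; apply/pi1_eqP => /=.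
  by apply: homotopic_refl; exact: pth_path (pth_mul l l').
have clS u : exists l, cl l = u.
  elim/quotW: u => -[f lf]; have [cf f0 f1] := asboolP _ lf.
  exists (Pth cf f0 f1); apply/pi1_eqP => /=.
  exact: homotopic_refl.
pose L y z (p : pth R y z) := pth_mul (pth_mul (tau y) p) (pth_inv (tau z)).
(* The winding is defined on bare functions, with value 0 off paths, so that it applies to [f \o p]
   without carrying a proof of continuity. *)
pose w (f : R -> X) : int :=
  if pselect (is_path f) is left h
  then phi (cl (L _ _ (@Pth R X (f 0) (f 1) f h erefl erefl))) else 0.
have wE y z (p : pth R y z) : w p = phi (cl (L _ _ p)).
  case: p => f cf f0 f1; subst y z; rewrite /w /=; case: pselect => // h.
  by congr (phi (cl (L _ _ _))); congr Pth; exact: Prop_irrelevance.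
have LM y z u (p : pth R y z) (q : pth R z u) :
    pth_eq (L _ _ (pth_mul p q)) (pth_mul (L _ _ p) (L _ _ q)).
  by rewrite /L -!pth_mulA pth_mulVKp; reflexivity.
have LK y z (p : pth R y z) :
    pth_eq p (pth_mul (pth_inv (tau y)) (pth_mul (L _ _ p) (tau z))).
  by rewrite /L -!pth_mulA pth_mulVp pth_mulp1 pth_mulVKp; reflexivity.
exists w; split.
- by move=> y z u p q; rewrite !wE -phiM -clM; congr phi; apply/clE.
- move=> y z p q; rewrite !wE; split => [pq|/phiI/clE Lpq].
    by congr phi; apply/clE; rewrite /L pq; reflexivity.
  by rewrite (LK _ _ p) (LK _ _ q) Lpq; reflexivity.
- move=> y z n; have [u <-] := phiS n; have [l <-] := clS u.
  exists (pth_mul (pth_inv (tau y)) (pth_mul l (tau z))).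
  rewrite wE; congr phi; apply/clE.
  rewrite /L -!pth_mulA pth_mulpV pth_mulp1 pth_mulKp; reflexivity.
Qed.

End Winding.

Section WindingOfMaps.
Context (R : realType) (X : topologicalType) (w : (R -> X) -> int).
Hypothesis wP : is_winding w.

Lemma windM y z u (p : pth R y z) (q : pth R z u) : w (pth_mul p q) = w p + w q.
Proof. by case: wP => + _ _; apply. Qed.

Lemma wind_eq y z (p q : pth R y z) : pth_eq p q <-> w p = w q.
Proof. by case: wP => _ + _; apply. Qed.

Lemma wind_surj y z n : exists p : pth R y z, w p = n.
Proof. by case: wP => _ _; apply. Qed.

Lemma wind1 y : w (pth_one R y) = 0.
Proof.
have /wind_eq := pth_mul1p (pth_one R y); rewrite windM.
by set a := w _ => h; lia.
Qed.

Lemma windV y z (p : pth R y z) : w (pth_inv p) = - w p.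
Proof.
have /wind_eq := pth_mulVp p; rewrite windM wind1.
by move=> h; lia.
Qed.

Lemma wind_eq_in y z (p q : pth R y z) :
  (forall t, 0 <= t <= 1 -> p t = q t) -> w p = w q.
Proof.
move=> pq; apply/wind_eq; apply: homotopic_eq; first exact: pth_path.
by move=> t; rewrite /= in_itv /=; exact: pq.
Qed.

Lemma pth_map_path (f : X -> X) y z (p : pth R y z) :
  continuous f -> is_path (f \o p).
Proof.
move=> cf; apply: (within_comp (B := setT)) (@pth_path _ _ _ _ p) _ => //.
exact: continuous_subspaceT.
Qed.

Definition pth_map (f : X -> X) (cf : continuous f) y z (p : pth R y z) :
    pth R (f y) (f z) :=
  Pth (@pth_map_path f y z p cf) (congr1 f (pth0 p)) (congr1 f (pth1 p)).

Lemma wind_mapM (f : X -> X) y z u (p : pth R y z) (q : pth R z u) :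
  continuous f -> w (f \o pth_mul p q) = w (f \o p) + w (f \o q).
Proof.
move=> cf; rewrite -(windM (pth_map cf p) (pth_map cf q)); congr w.
by apply/funext => t; rewrite /= /concat; case: ifP.
Qed.

Lemma wind_mapV (f : X -> X) y z (p : pth R y z) :
  continuous f -> w (f \o pth_inv p) = - w (f \o p).
Proof. by move=> cf; rewrite -(windV (pth_map cf p)). Qed.

Lemma wind_map_eq (f : X -> X) y z (p q : pth R y z) :
  continuous f -> w p = w q -> w (f \o p) = w (f \o q).
Proof.
move=> cf /wind_eq[H [cH H0 H1 HA]].
apply: (wind_eq (pth_map cf p) (pth_map cf q)).1; exists (f \o H); split => /=.
- by apply: (within_comp (B := setT)) cH _ => //; exact: continuous_subspaceT.
- by move=> t t01; rewrite H0.
- by move=> t t01; rewrite H1.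
- by move=> a u Aa u01; rewrite HA.
Qed.

(** Here [e] is the winding of the image of a loop of winding one at [b], and [c y] that of the
    image of a path of winding zero from [b] to [y]. Closing [p] up along such paths reduces the
    formula to loops at [b]. *)
Lemma wind_map (b : X) (f : X -> X) : continuous f ->
  exists (e : int) (c : X -> int), forall y z (p : pth R y z),
    w (f \o p) = e * w p + (c z - c y).
Proof.
move=> cf; have [l l1] := wind_surj b b 1.
have [tau tauP] : exists tau : forall y, pth R b y, forall y, w (tau y) = 0.
  by exists (fun y => projT1 (cid (wind_surj b y 0))) => y; case: cid.
pose e := w (f \o l).
have f1 : w (f \o pth_one R b) = 0.
  have := wind_mapM (pth_one R b) (pth_one R b) cf.
  rewrite (wind_map_eq (q := pth_one R b) cf); last by rewrite windM wind1.
  by set a := w _ => h; lia.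
have loopE n (p : pth R b b) : w p = n -> w (f \o p) = e * n.
  elim/int_rec: n p => [|n IH|n IH] p pn.
  - by rewrite mulr0 -f1; apply: wind_map_eq; rewrite ?wind1.
  - have [q qn] := wind_surj b b n.
    rewrite (wind_map_eq (q := pth_mul q l) cf); last first.
      by rewrite windM qn l1 pn; lia.
    by rewrite wind_mapM// IH// -/e; lia.
  - have [q qn] := wind_surj b b (- n%:Z).
    rewrite (wind_map_eq (q := pth_mul q (pth_inv l)) cf); last first.
      by rewrite windM windV qn l1 pn; lia.
    by rewrite wind_mapM// wind_mapV// IH// -/e; lia.
exists e, (fun y => w (f \o tau y)) => y z p.
have /loopE : w (pth_mul (pth_mul (tau y) p) (pth_inv (tau z))) = w p.
  by rewrite !windM windV !tauP; lia.
by rewrite !wind_mapM// wind_mapV//; lia.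
Qed.

(** Take for [d y] the winding of the track of [y]. The homotopy maps the square over [p] to the
    graph, and the two routes along its boundary between opposite corners are homotopic. *)
Lemma homotopic_wind (A : set X) (f g : X -> X) :
  continuous f -> continuous g ->
  homotopic_rel R [set: X] A f g ->
  exists d : X -> int, (forall a, A a -> d a = 0) /\
    forall y z (p : pth R y z), w (f \o p) + d z = d y + w (g \o p).
Proof.
move=> cf cg [H [cH H0 H1 HA]].
have ch y : is_path (fun u => H (y, u)).
  apply: (within_comp (f := fun u : R => (y, u)) _ _ cH); first by [].
  by apply: within_pair; apply: continuous_subspaceT => z; [exact: cvg_cst|exact: cvg_id].
pose h y : pth R (f y) (g y) := Pth (ch y) (H0 y I) (H1 y I).
exists (fun y => w (h y)); split => [a Aa|y z p].
  have hE t : 0 <= t <= 1 -> H (a, t) = f a by exact: HA.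
  have fg : g a = f a by rewrite -H1// hE// ler01 lexx.
  pose h' : pth R (f a) (f a) := Pth (ch a) (H0 a I) (etrans (H1 a I) fg).
  by rewrite -(wind1 (f a)) -[RHS](wind_eq_in (p := h')).
rewrite -(windM (pth_map cf p) (h z)) -(windM (h y) (pth_map cg p)).
apply/wind_eq.
(* [a1] moves during the first half and then waits, [a2] waits and then moves. The pairs [(a1, a2)]
   and [(a2, a1)] are the two boundary routes of the square, and [(b1, b2)] joins them by straight
   lines. *)
pose a1 (t : R) := Num.min (2 * t + 0) (0 * t + 1).
pose a2 (t : R) := Num.max (2 * t + - 1) (0 * t + 0).
have caff (a c : R) : continuous (fun t : R => a * t + c).
  move=> t; apply: cvgD; last exact: cvg_cst.
  by apply: cvgM; [exact: cvg_cst|exact: cvg_id].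
have ca1 : continuous a1 by apply: min_fun_continuous; exact: caff.
have ca2 : continuous a2 by apply: max_fun_continuous; exact: caff.
have a101 t : 0 <= t <= 1 -> 0 <= a1 t <= 1.
  by move=> t01; rewrite /a1 minEle; case: ifP; lra.
have a201 t : 0 <= t <= 1 -> 0 <= a2 t <= 1.
  by move=> t01; rewrite /a2 maxEle; case: ifP; lra.
pose b1 (z : R * R) := (1 - z.2) * a1 z.1 + z.2 * a2 z.1.
pose b2 (z : R * R) := (1 - z.2) * a2 z.1 + z.2 * a1 z.1.
have cmix (r s : R -> R) : continuous r -> continuous s ->
    continuous (fun z : R * R => (1 - z.2) * r z.1 + z.2 * s z.1).
  move=> cr cs v; apply: cvgD; apply: cvgM.
  - by apply: cvgB; [exact: cvg_cst|exact: cvg_snd].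
  - by apply: (continuous_comp (f := fst)); [exact: cvg_fst|exact: cr].
  - exact: cvg_snd.
  - by apply: (continuous_comp (f := fst)); [exact: cvg_fst|exact: cs].
exists (fun v => H (p (b1 v), b2 v)); split => /=.
- apply: (within_comp (f := fun v => (p (b1 v), b2 v)) _ _ cH).
    move=> [t u] [/=]; rewrite !in_itv /= /b2 /= => t01 u01; split => //.
    by have := a101 _ t01; have := a201 _ t01; nra.
  apply: within_pair; last by apply: continuous_subspaceT; exact: cmix.
  have b1I v : (`[0, 1] `*` `[0, 1]) v -> `[0, 1]%classic (b1 v).
    case: v => [t u] [/=]; rewrite !in_itv /= /b1 /= => t01 u01.
    by have := a101 _ t01; have := a201 _ t01; nra.
  have cb1 : {within `[0, 1] `*` `[0, 1], continuous b1}.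
    by apply: continuous_subspaceT; exact: cmix.
  have cp := @pth_path _ _ _ _ p.
  exact: within_comp b1I cb1 cp.
- move=> t; rewrite in_itv /= /concat /b1 /b2 /a1 /a2 /= => t01.
  rewrite minEle maxEle /= !subr0 !mul1r !mul0r !addr0 !add0r.
  rewrite (_ : (2 * t <= 1) = (t <= 2^-1)); last by apply/idP/idP; lra.
  rewrite (_ : (2 * t + - 1 <= 0) = (t <= 2^-1)); last by apply/idP/idP; lra.
  by case: ifP => tt; rewrite ?H0 ?pth1.
- move=> t; rewrite in_itv /= /concat /b1 /b2 /a1 /a2 /= => t01.
  rewrite minEle maxEle /= !subrr !mul1r !mul0r !addr0 !add0r.
  rewrite (_ : (2 * t <= 1) = (t <= 2^-1)); last by apply/idP/idP; lra.
  rewrite (_ : (2 * t + - 1 <= 0) = (t <= 2^-1)); last by apply/idP/idP; lra.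
  by case: ifP => tt; rewrite ?H1 ?pth0.
- move=> a u; rewrite /b1 /b2 /a1 /a2 minEle maxEle /= => -[] -> u01.
    rewrite !mulr0 !addr0 !add0r ifT; last by lra.
    rewrite ifT; last by lra.
    by rewrite !mulr0 !addr0 concat0 /= pth0 H0.
  rewrite ifF; last by apply/negbTE; rewrite -ltNge; lra.
  rewrite ifF; last by apply/negbTE; rewrite -ltNge; lra.
  rewrite concat1 H1//= (_ : _ + _ * _ = 1 :> R); last by lra.
  by rewrite (_ : _ + _ * _ = 1 :> R) ?pth1 ?H1//; lra.
Qed.

End WindingOfMaps.

(** * Homotopies and maps with prescribed winding *)

Section HomotopyFromWinding.
Context (R : realType) (X : topologicalType) (w : (R -> X) -> int).
Hypothesis wP : is_winding w.

(* First stretch p to P = h^-1 p h' along its middle part, then apply the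
   homotopy from P to q relative to the end points. *)
Lemma square_filling y z y' z' (p : pth R y z) (q : pth R y' z')
    (h : pth R y y') (h' : pth R z z') :
  w p + w h' = w h + w q ->
  exists S : R * R -> X,
    [/\ {within `[0, 1] `*` `[0, 1], continuous S},
        forall t, 0 <= t <= 1 -> S (t, 0) = p t,
        forall t, 0 <= t <= 1 -> S (t, 1) = q t,
        forall u, 0 <= u <= 1 -> S (0, u) = concat h (cst y') u &
        forall u, 0 <= u <= 1 -> S (1, u) = concat h' (cst z') u].
Proof.
move=> hw; pose P := pth_mul (pth_inv h) (pth_mul p h').
have /(wind_eq wP)[K [cK K0 K1 KA]] : w P = w q.
  by rewrite !(windM wP) (windV wP); lia.
(* The first coordinate is time, the second the parameter of the path. At time 0 this is
   [1/2 + t/4], the stretch on which [P] runs through [p]; at time 1 it is [t]. The sides [t = 0]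
   and [t = 1] then run along [h] and [h']. *)
pose s (v : R * R) := (1 - v.1) / 2 + v.2 * (1 / 4 + 3 / 4 * v.1).
have cs : {within `[0, 1] `*` `[0, 1], continuous s}.
  apply: continuous_subspaceT => v; apply: cvgD; apply: cvgM.
  - by apply: cvgB; [exact: cvg_cst|exact: cvg_fst].
  - exact: cvg_cst.
  - exact: cvg_snd.
  - by apply: cvgD; [exact: cvg_cst|apply: cvgM; [exact: cvg_cst|exact: cvg_fst]].
have sI v : (`[0, 1] `*` `[0, 1]) v -> `[0, 1]%classic (s v).
  by case: v => [u t] [/=]; rewrite !in_itv /= /s /= => u01 t01; nra.
have cF : {within `[0, 1] `*` `[0, 1], continuous (P \o s)}.
  have cp := @pth_path _ _ _ _ P; exact: within_comp sI cs cp.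
have cswap : {within `[0, 1] `*` `[0, 1], continuous (fun v : R * R => (v.2, v.1))}.
  by apply: within_pair; apply: continuous_subspaceT => v; [exact: cvg_snd|exact: cvg_fst].
have swI (v : R * R) : (`[0, 1] `*` `[0, 1]) v -> (`[0, 1] `*` `[0, 1])%classic (v.2, v.1).
  by case: v => u t [].
have cG : {within `[0, 1] `*` `[0, 1], continuous (K \o (fun v : R * R => (v.2, v.1)))}.
  exact: within_comp swI cswap cK.
have s1 t : s (1, t) = t by rewrite /s /=; field.
have clI : closed (`[0, 1]%classic : set R) by exact: interval_closed.
have FG d : `[0, 1]%classic d ->
    (P \o s) (1, d) = (K \o (fun v : R * R => (v.2, v.1))) (0, d).
  by move=> d01; apply: (etrans (congr1 P (s1 d))); rewrite -K0.
have cS := within_paste clI cF cG FG.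
exists (fun v => if v.2 <= 2^-1 then P (s (2 * v.2, v.1)) else K (v.1, 2 * v.2 - 1)).
split.
- exact: within_comp swI cswap cS.
- move=> t t01 /=; rewrite invr_ge0 ler0n mulr0 /s /=.
  have -> : (1 - 0) / 2 + t * (1 / 4 + 3 / 4 * 0) = 1 / 2 + t / 4 :> R by field.
  rewrite /P /= /concat.
  have [t0|t0] := eqVneq t 0.
    subst t; rewrite mul0r addr0 mul1r lexx /reverse mulfV// subrr.
    by rewrite !pth0.
  rewrite ifF; last by apply/negbTE; rewrite -ltNge; lra.
  rewrite ifT; last by lra.
  by congr (pth_val p _); field.
- move=> t t01 /=; rewrite ifF; last by apply/negbTE; rewrite -ltNge; lra.
  have tI : `[0, 1]%classic t by rewrite /= in_itv.
  by rewrite (_ : 2 * 1 - 1 = 1) ?K1//; lra.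
- move=> u u01 /=; rewrite /concat; case: ifP => u2.
    rewrite /s /= mul0r addr0 /P /= /concat ifT; last by lra.
    by rewrite /reverse; congr (pth_val h _); field.
  have K00 : K (0, 2 * u - 1) = P 0.
    by apply: KA; [left|move/negbT: u2; rewrite -ltNge; lra].
  by rewrite K00 pth0.
- move=> u u01 /=; rewrite /concat; case: ifP => u2.
    rewrite /s /= mul1r /P /= /concat.
    rewrite (_ : _ + _ = 3 / 4 + u / 2); last by field.
    rewrite ifF; last by apply/negbTE; rewrite -ltNge; lra.
    have [u0|u0] := eqVneq u 0.
      subst u; rewrite ifT; last by lra.
      rewrite (_ : 2 * _ = 1); last by field.
      by rewrite mulr0 pth0 pth1.
    rewrite ifF; last by apply/negbTE; rewrite -ltNge; lra.
    by congr (pth_val h' _); field.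
  have K01 : K (1, 2 * u - 1) = P 1.
    by apply: KA; [right|move/negbT: u2; rewrite -ltNge; lra].
  by rewrite K01 pth1.
Qed.

Context (E : finType) (edge : E -> R -> X) (V : set X).
Hypotheses (hX : hausdorff_space X) (gr : graph_cells edge V).

Let epath e : is_path (edge e). Proof. by have [_ + _ _ _] := gr => /(_ e)[]. Qed.
Definition edge_pth e : pth R (edge e 0) (edge e 1) := Pth (@epath e) erefl erefl.

(** A converse to [homotopic_wind] that tests edges only: vertices move along tracks of winding [d],
    constant on [A], and the hypothesis is exactly what is needed to fill the square over each
    edge. *)
Lemma wind_homotopic (A : set X) (f g : X -> X) (d : X -> int) :
  A `<=` V -> continuous f -> continuous g ->
  (forall a, A a -> f a = g a /\ d a = 0) ->
  (forall e, w (f \o edge e) + d (edge e 1) = d (edge e 0) + w (g \o edge e)) ->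
  homotopic_rel R [set: X] A f g.
Proof.
move=> AV cf cg fgA fgE.
have track v : exists h : pth R (f v) (g v), w h = d v /\
    (A v -> forall u, h u = f v).
  have [Av|nA] := pselect (A v); last first.
    by have [h hE] := wind_surj wP (f v) (g v) (d v); exists h.
  have [fg dv] := fgA _ Av.
  pose h : pth R (f v) (g v) := Pth (@pth_path _ _ _ _ (pth_one R (f v))) erefl fg.
  by exists h; split => //; rewrite dv -(wind1 wP (f v)).
have [h hP] : exists h : forall v, pth R (f v) (g v), forall v, w (h v) = d v /\
    (A v -> forall u, h v u = f v).
  by exists (fun v => projT1 (cid (track v))) => v; case: cid.
(* The pause at [g v] matches the second stage of [square_filling], during which the ends do not
   move. *)
pose k v := concat (h v) (cst (g v)).
have sq e : exists S : R * R -> X,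
    [/\ {within `[0, 1] `*` `[0, 1], continuous S},
        forall t, 0 <= t <= 1 -> S (t, 0) = f (edge e t),
        forall t, 0 <= t <= 1 -> S (t, 1) = g (edge e t),
        forall u, 0 <= u <= 1 -> S (0, u) = k (edge e 0) u &
        forall u, 0 <= u <= 1 -> S (1, u) = k (edge e 1) u].
  apply: (@square_filling _ _ _ _ (pth_map cf (edge_pth e)) (pth_map cg (edge_pth e))).
  have [-> _] := hP (edge e 0); have [-> _] := hP (edge e 1).
  exact: fgE.
have [S SP] := choice sq.
(* Fillings and tracks are controlled only at times in the unit interval. Cutting them off outside
   makes them equal as functions, which is what [glue_cells] demands at the ends of an edge. *)
pose I01 (F : R -> X) (dflt : X) u := if (0 <= u <= 1) then F u else dflt.
have [q0 q1] : (forall e b, I01 (fun u => S e (0, u)) b = I01 (k (edge e 0)) b) /\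
    (forall e b, I01 (fun u => S e (1, u)) b = I01 (k (edge e 1)) b).
  by split => e b; apply/funext => u; rewrite /I01; case: ifP => // u01;
    have [_ _ _ S0 S1] := SP e; [exact: S0|exact: S1].
have [exb|noX] := pselect (exists b : X, True); last first.
  exists (f \o fst); split => //; try by move=> t; exfalso; apply: noX; exists t.
  by move=> [t u]; exfalso; apply: noX; exists t.
have {exb} b : X by have [b _] := cid exb.
have [H [HV HE]] := glue_cells gr
  (phi := fun v => I01 (k v) b) (q := fun e t => I01 (fun u => S e (t, u)) b)
  (fun e => q0 e b) (fun e => q1 e b).
have [_ _ _ _ cov] := gr.
have onX (P : X -> Prop) : (forall v, V v -> P v) ->
    (forall e t, 0 <= t <= 1 -> P (edge e t)) -> forall p, P p.
  move=> PV PE p; case: (cov p) => [/PV//|[e [t [t01 ->]]]].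
  by apply: PE; lra.
have I01E F u : 0 <= u <= 1 -> I01 F b u = F u by rewrite /I01 => ->.
exists (fun v => H v.1 v.2); split => /=.
- apply: (homotopy_on_cells hX gr) => [e|v Vv].
    have [cS _ _ _ _] := SP e.
    apply: within_eq cS => -[t u] [/=]; rewrite !in_itv /= => t01 u01.
    by rewrite HE// I01E.
  apply: (within_eq (f := k v)).
    by move=> u; rewrite /= in_itv /= => u01; rewrite HV// I01E.
  apply: path_concat; [exact: pth_path|exact: cst_path|by rewrite pth1].
- move=> p _; move: p; apply: onX => [v Vv|e t t01].
    by rewrite HV// I01E ?lexx ?ler01// /k concat0 pth0.
  by rewrite HE// I01E ?lexx ?ler01//; have [_ -> ] := SP e.
- move=> p _; move: p; apply: onX => [v Vv|e t t01].
    by rewrite HV// I01E ?lexx ?ler01// /k concat1.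
  by rewrite HE// I01E ?lexx ?ler01//; have [_ _ ->] := SP e.
- move=> a u Aa u01; rewrite HV ?I01E//; last exact: AV.
  have [_ /(_ Aa) ha] := hP a; rewrite /k /concat; case: ifP => _; rewrite ?ha//.
  by have [->] := fgA _ Aa.
Qed.

Lemma realize_wind (phi : X -> X) (alpha : E -> int) :
  exists f : X -> X, [/\ continuous f, forall v, V v -> f v = phi v &
    forall e, w (f \o edge e) = alpha e].
Proof.
have [q qP] : exists q : forall e, pth R (phi (edge e 0)) (phi (edge e 1)),
    forall e, w (q e) = alpha e.
  by exists (fun e => projT1 (cid (wind_surj wP _ _ (alpha e)))) => e; case: cid.
have [f [fV fE]] := glue_cells gr (phi := phi) (q := fun e => pth_val (q e))
  (fun e => pth0 (q e)) (fun e => pth1 (q e)).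
have cfe e : is_path (f \o edge e).
  apply: (within_eq (f := q e)); last exact: pth_path.
  by move=> t; rewrite /= in_itv /= => t01; rewrite fE.
exists f; split => //; first exact: (continuous_on_cells hX gr).
have [_ bd _ _ _] := gr.
move=> e; have [_ V0 V1] := bd e; rewrite -qP.
apply: (wind_eq_in wP (p := Pth (cfe e) (fV _ V0) (fV _ V1)) (q := q e)).
by move=> t t01 /=; rewrite fE.
Qed.

Hypothesis Xconn : connected [set: X].

(** The case [N = 0] says that [d] is constant on vertices; non-zero [N] allows the division in
    [wind_not_coboundary]. *)
Lemma vertex_cst (N : int) (d : X -> int) :
  (forall e, (N %| d (edge e 1) - d (edge e 0))%Z) ->
  forall v v', V v -> V v' -> (N %| d v' - d v)%Z.
Proof.
move=> de v v' Vv Vv'.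
apply: (@vertex_connected _ _ _ _ _ hX gr Xconn (fun p => N %| d p - d v)%Z _ v) => //.
  move=> e; rewrite (_ : d (edge e 1) - d v =
    (d (edge e 1) - d (edge e 0)) + (d (edge e 0) - d v)); last by lia.
  have -> : (N %| (d (edge e 1) - d (edge e 0)) + (d (edge e 0) - d v))%Z =
    (N %| d (edge e 0) - d v)%Z by apply: rpredDl; exact: de.
  by [].
by rewrite subrr dvdz0.
Qed.

(* Otherwise the winding would be a coboundary on edges, so that the identity
   and a constant map would be homotopic. *)
Lemma wind_not_coboundary (b : X) (N : int) (d : X -> int) :
  (forall e, N * w (edge e) = d (edge e 1) - d (edge e 0)) -> N = 0.
Proof.
move=> de; apply/eqP; apply: contrapT => /negP N0.
have [_ bd _ _ cov] := gr.
have [v Vv] : exists v, V v.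
  case: (cov b) => [Vb|[e _]]; first by exists b.
  by exists (edge e 0); have [] := bd e.
have dv v' : V v' -> (N %| d v' - d v)%Z.
  by apply: vertex_cst => // e; rewrite -de dvdz_mulr.
(* Division by [N] is exact at vertices, because [d] is constant modulo [N] there. *)
pose d' u := ((d u - d v) %/ N)%Z.
have wE e : w (edge e) = d' (edge e 1) - d' (edge e 0).
  have [_ /dv h0 /dv h1] := bd e.
  apply: (mulfI N0); rewrite de mulrBr [N * d' (edge e 1)]mulrC [N * d' _]mulrC.
  by rewrite !divzK//; lia.
have cid : continuous (@idfun X) by move=> t; exact: cvg_id.
have cb : continuous (cst b : X -> X) by move=> t; exact: cvg_cst.
have w0 (y z : X) (p : pth R y z) : w (cst b \o p) = 0 by rewrite -(wind1 wP b).
have /(homotopic_wind wP cid cb)[D [_ DE]] : homotopic_rel R [set: X] set0 idfun (cst b).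
  apply: (wind_homotopic (d := fun u => - d' u)) => // e.
  by rewrite (w0 _ _ (edge_pth e)) -[idfun \o _]/(edge e) wE; lia.
have [l l1] := wind_surj wP b b 1.
by have := DE _ _ l; rewrite w0 -[idfun \o _]/(pth_val l) l1; lia.
Qed.

(** The law on edges and the law of [wind_map] differ by a coboundary, so the degrees agree by
    [wind_not_coboundary]; the two shifts then differ by a constant on vertices. Off the vertices
    [c] is arbitrary. *)
Lemma wind_on_vertices (f : X -> X) (eps : int) (c : X -> int) :
  continuous f ->
  (forall e, w (f \o edge e) = eps * w (edge e) + (c (edge e 1) - c (edge e 0))) ->
  forall y z (p : pth R y z), V y -> V z ->
    w (f \o p) = eps * w p + (c z - c y).
Proof.
move=> cf fe y z p Vy Vz.
have [e' [c' fE]] := wind_map wP y cf.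
have ee e := fE _ _ (edge_pth e).
have e'E : eps - e' = 0.
  apply: (@wind_not_coboundary y _ (fun u => c' u - c u)) => e.
  by have := ee e; have := fe e; rewrite /=; lia.
have h : (0 %| (c' z - c z) - (c' y - c y))%Z.
  apply: (@vertex_cst 0 (fun u => c' u - c u)) => // e.
  by rewrite dvd0z; have := ee e; have := fe e; rewrite /= (_ : eps = e'); lia.
rewrite fE; move: h; rewrite dvd0z => /eqP h.
by rewrite (_ : eps = e'); lia.
Qed.

End HomotopyFromWinding.

(** * The group of marked homotopy equivalences *)

Section GammaStructure.
Context (R : realType) (X : topologicalType) (s : nat) (x : 'I_s -> X).
Hypothesis xinj : injective x.
Context (w : (R -> X) -> int) (wP : is_winding w).
Context (E : finType) (edge : E -> R -> X) (V : set X).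
Hypotheses (hX : hausdorff_space X) (gr : graph_cells edge V).
Hypothesis Xconn : connected [set: X].
Hypothesis xV : forall i, V (x i).
Context (b : X).

Local Notation mmg := (marked_mapping_group R x).
Local Notation repr := generic_quotient.repr.
Local Notation rmap u := (val (repr u)).

Lemma rmap_continuous (u : mmg) : continuous (rmap u).
Proof. by have [] := marked_equivP (repr u). Qed.

Let dc (u : mmg) := cid (wind_map wP b (@rmap_continuous u)).
Definition degree (u : mmg) : int := projT1 (dc u).
Definition shift (u : mmg) : X -> int := projT1 (cid (projT2 (dc u))).

Lemma wind_rmap (u : mmg) y z (p : pth R y z) :
  w (rmap u \o p) = degree u * w p + (shift u z - shift u y).
Proof. by rewrite /shift; case: cid => c /= ->. Qed.

(** [degree] and [shift] rest on choices. A homotopy relative to the marked points has tracks of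
    winding zero there, so the degree and the differences of shifts at marked points depend only on
    the class. *)
Lemma invariants_of_map (u : mmg) (f : X -> X) (eps : int) (c : X -> int) :
  continuous f -> homotopic_rel R [set: X] (range x) (rmap u) f ->
  (forall y z (p : pth R y z), V y -> V z ->
     w (f \o p) = eps * w p + (c z - c y)) ->
  degree u = eps /\ forall i j, shift u (x i) - shift u (x j) = c (x i) - c (x j).
Proof.
move=> cf /(homotopic_wind wP (@rmap_continuous u) cf)[d [d0 dE]] fE.
have [_ bd _ _ cov] := gr.
have [v Vv] : exists v, V v.
  case: (cov b) => [Vb|[e _]]; first by exists b.
  by exists (edge e 0); have [] := bd e.
have degE : degree u = eps.
  have [l l1] := wind_surj wP v v 1.
  by have := dE _ _ l; rewrite wind_rmap fE// l1; lia.
split => // i j; have [p _] := wind_surj wP (x j) (x i) 0.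
have := dE _ _ p; rewrite wind_rmap fE// degE !d0; [lia| |]; by exists i + exists j.
Qed.

Lemma invariants_mul (u v : mmg) :
  degree (u * v)%g = degree u * degree v /\
  forall i j, shift (u * v)%g (x i) - shift (u * v)%g (x j) =
    degree u * (shift v (x i) - shift v (x j)) +
    (shift u (rmap v (x i)) - shift u (rmap v (x j))).
Proof.
have cf : continuous (rmap u \o rmap v).
  by move=> t; apply: continuous_comp; exact: rmap_continuous.
have h : homotopic_rel R [set: X] (range x) (rmap (u * v)%g) (rmap u \o rmap v).
  have := (@mapping_eqP _ _ _ _ (repr (u * v)%g) (marked_comp (repr u) (repr v))).2.
  by apply; rewrite reprK.
have [|-> E2] := @invariants_of_map _ _ (degree u * degree v)
    (fun p => degree u * shift v p + shift u (rmap v p)) cf h.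
  move=> y z p _ _.
  have := wind_rmap u (pth_map (@rmap_continuous v) p).
  rewrite -[rmap u \o pth_val _]/((rmap u \o rmap v) \o p) => ->.
  by rewrite wind_rmap; lia.
by split => // i j; rewrite E2; lia.
Qed.

Lemma degree1 : degree 1%g = 1.
Proof.
have cid : continuous (@idfun X) by move=> t; exact: cvg_id.
have h : homotopic_rel R [set: X] (range x) (rmap (1%g : mmg)) idfun.
  have := (@mapping_eqP _ _ _ _ (repr (1%g : mmg)) (marked_one R x)).2.
  by apply; rewrite reprK.
by have [|-> _] := @invariants_of_map _ _ 1 (fun _ => 0) cid h => // y z p _ _;
  rewrite -[idfun \o _]/(pth_val p); lia.
Qed.

Lemma degree_pm1 u : degree u = 1 \/ degree u = -1.
Proof.
have [+ _] := invariants_mul u u^-1%g; rewrite mulgV degree1 => h.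
have /eqP : `|degree u|%N = 1%N.
  by apply/eqP; have /eqP := congr1 absz h; rewrite abszM eq_sym muln_eq1 => /andP[].
by lia.
Qed.

(** It need not be continuous: it only prescribes images of vertices for [realize_wind]. *)
Definition move_marked (sigma : 'S_s) (p : X) : X :=
  if pselect (exists i, x i = p) is left h then x (sigma (projT1 (cid h))) else p.

Lemma move_marked_x sigma i : move_marked sigma (x i) = x (sigma i).
Proof.
rewrite /move_marked; case: pselect => [h|[]]; last by exists i.
by case: cid => j /= /xinj ->.
Qed.

Lemma move_marked_out sigma p : (forall i, x i <> p) -> move_marked sigma p = p.
Proof. by move=> nx; rewrite /move_marked; case: pselect => // h; have [i /nx] := h. Qed.

Lemma marked_or p : (exists i, p = x i) \/ forall i, x i <> p.
Proof.
have [[i <-]|nx] := pselect (exists i, x i = p); first by left; exists i.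
by right => i xi; apply: nx; exists i.
Qed.

Lemma move_markedK sigma : cancel (move_marked sigma) (move_marked sigma^-1%g).
Proof.
move=> p; case: (marked_or p) => [[i ->]|nx]; first by rewrite !move_marked_x permK.
by rewrite !move_marked_out// move_marked_out.
Qed.

Lemma move_marked_V sigma p : V p -> V (move_marked sigma p).
Proof.
case: (marked_or p) => [[i ->] _|nx]; last by rewrite move_marked_out.
by rewrite move_marked_x; exact: xV.
Qed.

Lemma realize_class (sigma : 'S_s) (eps : int) (a : 'I_s -> int) :
  eps * eps = 1 ->
  exists u : mmg, [/\ forall i, rmap u (x i) = x (sigma i), degree u = eps &
    forall i j, shift u (x i) - shift u (x j) = a i - a j].
Proof.
move=> eps2.
pose A p := if pselect (exists i, x i = p) is left h then a (projT1 (cid h)) else 0.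
have Ax i : A (x i) = a i.
  rewrite /A; case: pselect => [h|[]]; last by exists i.
  by case: cid => j /= /xinj ->.
(* The shift of the inverse, chosen so that in both composites the degrees multiply to 1 and the
   shifts cancel. *)
pose A' p := - eps * A (move_marked sigma^-1%g p).
have law (tau : 'S_s) (c : X -> int) : exists f : X -> X,
    [/\ continuous f, forall v, V v -> f v = move_marked tau v,
     forall i, f (x i) = x (tau i) &
     forall y z (p : pth R y z), V y -> V z ->
       w (f \o p) = eps * w p + (c z - c y)].
  have [f [cf fV fE]] := realize_wind wP hX gr (move_marked tau)
     (fun e => eps * w (edge e) + (c (edge e 1) - c (edge e 0))).
  exists f; split => //; first by move=> i; rewrite fV// move_marked_x.
  exact: (wind_on_vertices wP hX gr Xconn cf fE).
have [f [cf fV fx fE]] := law sigma A.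
have [g [cg gV gx gE]] := law sigma^-1%g A'.
have [_ bd _ _ _] := gr.
have xsV : range x `<=` V by move=> _ [i _ <-].
have idc : continuous (@idfun X) by move=> t; exact: cvg_id.
have comp0 (f1 f2 : X -> X) c1 c2 : continuous f1 -> continuous f2 ->
    (forall v, V v -> V (f2 v)) ->
    (forall y z (p : pth R y z), V y -> V z ->
       w (f1 \o p) = eps * w p + (c1 z - c1 y)) ->
    (forall y z (p : pth R y z), V y -> V z ->
       w (f2 \o p) = eps * w p + (c2 z - c2 y)) ->
    (forall v, V v -> c1 (f2 v) = - eps * c2 v) ->
    (forall i, f1 (f2 (x i)) = x i) ->
    homotopic_rel R [set: X] (range x) (f1 \o f2) idfun.
  move=> cf1 cf2 f2V f1E f2E c12 f12x.
  apply: (wind_homotopic wP hX gr (d := fun=> 0)) => //.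
  - by move=> t; apply: continuous_comp; [exact: cf2|exact: cf1].
  - by move=> _ [i _ <-]; split => //; exact: f12x.
  - move=> e; have [_ V0 V1] := bd e.
    have := f1E _ _ (pth_map cf2 (edge_pth gr e)) (f2V _ V0) (f2V _ V1).
    have := f2E _ _ (edge_pth gr e) V0 V1.
    rewrite /= -[f1 \o (f2 \o edge e)]/((f1 \o f2) \o edge e) => -> ->.
    rewrite !c12// -[idfun \o _]/(edge e) mulrDr mulrA eps2; lia.
have mg : is_marked_equiv R x f.
  split => //; first by move=> i; rewrite fx; exists (sigma i).
  exists g; split => //; first by move=> i; rewrite gx; exists (sigma^-1%g i).
  - apply: (comp0 _ _ A' A) => // [v Vv|v Vv|i].
    + by rewrite fV//; exact: move_marked_V.
    + by rewrite /A' fV// move_markedK.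
    + by rewrite fx gx permK.
  - apply: (comp0 _ _ A A') => // [v Vv|v Vv|i].
    + by rewrite gV//; exact: move_marked_V.
    + by rewrite /A' gV// mulrA mulrNN eps2 mul1r.
    + by rewrite gx fx permKV.
pose m : marked_equiv R x := exist _ f (introT (asboolP _) mg).
pose u : mmg := \pi_(marked_mapping_group R x)%qT m.
have hu : homotopic_rel R [set: X] (range x) (rmap u) f.
  by have := (@mapping_eqP _ _ _ _ (repr u) m).2; apply; rewrite reprK.
have [degE sE] := invariants_of_map cf hu fE.
exists u; split => // [i|i j]; last by rewrite sE !Ax.
by rewrite mapping_markedE /= fx.
Qed.

Lemma permuting_classE (sigma : 'S_s) i :
  rmap (permuting_class R x sigma) (x i) = x (sigma i).
Proof.
rewrite /permuting_class; case: xgetP => [u _ ->//|] /=.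
by have [u [uE _ _]] := @realize_class sigma 1 (fun=> 0) (mulr1 _) => /(_ u)[].
Qed.

Local Notation G := (Gamma R x).

Lemma Gamma_fix (g : G) i : rmap (val g) (x i) = x i.
Proof. by have /asboolP := valP g. Qed.

Lemma Gamma_eq (g h : G) : degree (val g) = degree (val h) ->
  (forall i j, shift (val g) (x i) - shift (val g) (x j) =
               shift (val h) (x i) - shift (val h) (x j)) -> g = h.
Proof.
move=> de sh; apply: val_inj; rewrite -[val g]reprK -[val h]reprK.
apply/mapping_eqP.
(* Shifts matter only up to a common constant. Subtracting [K] makes the track windings vanish at
   the marked points; without marked points any [K] will do. *)
have [K KE] : exists K, forall i, shift (val h) (x i) - shift (val g) (x i) = K.
  have [[i _]|no] := pselect (exists i : 'I_s, True).
    by exists (shift (val h) (x i) - shift (val g) (x i)) => j; have := sh i j; lia.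
  by exists 0 => i; exfalso; apply: no; exists i.
apply: (wind_homotopic wP hX gr
  (d := fun p => shift (val h) p - shift (val g) p - K)).
- by move=> _ [i _ <-].
- exact: rmap_continuous.
- exact: rmap_continuous.
- by move=> _ [i _ <-]; rewrite !Gamma_fix; split => //; have := KE i; lia.
- by move=> e; rewrite !(wind_rmap _ (edge_pth gr e)) de; lia.
Qed.

Definition reverses (g : G) : bool := degree (val g) == -1.

(** The index 0 is built from [i], since ['I_s] may be empty. *)
Definition first_index (i : 'I_s) : 'I_s :=
  Ordinal (leq_ltn_trans (leq0n i) (ltn_ord i)).

Definition displacement (i : 'I_s) (g : G) : int :=
  shift (val g) (x i) - shift (val g) (x (first_index i)).

Lemma degreeE g : degree (val g) = (-1) ^+ reverses g.
Proof. by rewrite /reverses; case: (degree_pm1 (val g)) => ->. Qed.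

Lemma reversesM g h : reverses (g * h)%g = reverses g (+) reverses h.
Proof.
have [+ _] := invariants_mul (val g) (val h).
rewrite /reverses => ->.
by case: (degree_pm1 (val g)) => ->; case: (degree_pm1 (val h)) => ->.
Qed.

Lemma displacementM i g h : displacement i (g * h)%g =
  displacement i g + (-1) ^+ reverses g * displacement i h.
Proof.
have [_ E2] := invariants_mul (val g) (val h).
by rewrite /displacement E2 !Gamma_fix -degreeE; ring.
Qed.

Lemma displacement0 (i : 'I_s) g : i = 0%N :> nat -> displacement i g = 0.
Proof.
move=> i0; rewrite /displacement (_ : first_index i = i) ?subrr//.
by apply: val_inj; rewrite /= i0.
Qed.

Lemma displacement_inj g h : reverses g = reverses h ->
  (forall i, displacement i g = displacement i h) -> g = h.
Proof.
move=> rgh dgh; apply: Gamma_eq; first by rewrite !degreeE rgh.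
move=> i j; have := dgh i; have := dgh j; rewrite /displacement.
have -> : first_index j = first_index i by exact: val_inj.
by lia.
Qed.

Lemma displacement_surj (e : bool) (a : 'I_s -> int) :
  (forall i : 'I_s, i = 0%N :> nat -> a i = 0) ->
  exists g, reverses g = e /\ forall i, displacement i g = a i.
Proof.
move=> a0; have [|u [ux ud us]] := @realize_class 1%g ((-1) ^+ e) a.
  by case: e.
have ufix : u \in @fixes_marked R X s x.
  by apply/asboolP => i; rewrite ux perm1.
exists (exist _ u ufix); split; first by rewrite /reverses /= ud; case: e {ud}.
by move=> i; rewrite /displacement /= us [a (first_index i)]a0// subr0.
Qed.

(** Compare the shifts of both sides of [u * h = g * u], where [h] is the conjugate of [g]: the
    shifts of [u] cancel. The sign [eta] is the degree of the chosen class, about which only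
    [eta * eta = 1] is known. *)
Lemma displacement_conj (sigma : 'S_s) : exists eta : int, eta * eta = 1 /\
  forall g : G, reverses g = false ->
    reverses (Gamma_conj (permuting_class R x sigma) g) = false /\
    forall i, displacement i (Gamma_conj (permuting_class R x sigma) g) =
      eta * (displacement (sigma i) g - displacement (sigma (first_index i)) g).
Proof.
set u := permuting_class R x sigma.
have uE := permuting_classE sigma; rewrite -/u in uE.
exists (degree u); split; first by case: (degree_pm1 u) => ->.
move=> g rg; have dg : degree (val g) = 1 by rewrite degreeE rg.
set h := Gamma_conj u g.
have uh : (u * val h = val g * u)%g by rewrite -conjgC.
have [d1 s1] := invariants_mul u (val h).
have [d2 s2] := invariants_mul (val g) u.
have dh : degree (val h) = 1.
  by move: d1; rewrite uh d2 dg; case: (degree_pm1 u) => ->; lia.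
split; first by rewrite /reverses dh.
move=> i; have := s1 i (first_index i); rewrite uh s2 dg !Gamma_fix !uE.
rewrite /displacement.
have -> : first_index (sigma (first_index i)) = first_index (sigma i) by exact: val_inj.
by case: (degree_pm1 u) => ->; lia.
Qed.

End GammaStructure.

(** The interface between topology and algebra: the cohomology is computed from these properties
    alone, for an abstract group. *)
Lemma exists_displacement (R : realType) (X : topologicalType) (s : nat)
    (x : 'I_s -> X) :
  finite_graph R X -> connected [set: X] -> has_rank R X 1 -> injective x ->
  exists (eps : Gamma R x -> bool) (c : 'I_s -> Gamma R x -> int),
  [/\ forall g h, eps (g * h)%g = eps g (+) eps h,
      forall i g h, c i (g * h)%g = c i g + (-1) ^+ eps g * c i h,
      forall (i : 'I_s) g, i = 0%N :> nat -> c i g = 0,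
      forall g h, eps g = eps h -> (forall i, c i g = c i h) -> g = h &
      forall (e : bool) (a : 'I_s -> int), (forall i : 'I_s, i = 0%N :> nat -> a i = 0) ->
        exists g, eps g = e /\ forall i, c i g = a i] /\
  forall sigma : 'S_s, exists eta : int, eta * eta = 1 /\
    forall g, eps g = false ->
      eps (Gamma_conj (permuting_class R x sigma) g) = false /\
      forall i, c i (Gamma_conj (permuting_class R x sigma) g) =
        eta * (c (sigma i) g - c (sigma (first_index i)) g).
Proof.
move=> fg conn rk xinj.
have [hX _] := fg; have [b _] := rk.
have [E [edge [V [gr sV]]]] := cells_with_points [seq x i | i <- enum 'I_s] fg.
have xV i : V (x i) by apply: sV; apply: map_f; rewrite mem_enum.
have [w wP] := exists_winding (graph_path_connected hX gr conn) rk.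
exists (@reverses _ _ _ x w wP b), (@displacement _ _ _ x w wP b); split; first split.
- by eapply reversesM; eassumption.
- by eapply displacementM; eassumption.
- exact: displacement0.
- by eapply displacement_inj; eassumption.
- by eapply displacement_surj; eassumption.
- by eapply displacement_conj; eassumption.
Qed.

(** * Bounding the cohomology *)

Section HomogeneousCochains.
Context (k : fieldType) (T : Type).
Implicit Types (F : seq T -> k) (s : seq T).

(** The alternating sum over omissions of one entry, as [hdiffE] makes explicit. The recursive form
    suits induction on lists, and lists spare dependent types for degrees. *)
Fixpoint hdiff F s : k :=
  if s is x :: s' then F s' - hdiff (fun y => F (x :: y)) s' else 0.

Lemma eq_hdiff n F F' s : (forall y, size y = n -> F y = F' y) ->
  size s = n.+1 -> hdiff F s = hdiff F' s.
Proof.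
elim: s n F F' => //= x s IH [|n] F F' FF' [sn].
  by rewrite FF'//; case: s sn {IH}.
by rewrite FF'// (IH n _ (fun y => F' (x :: y)))// => y yn; rewrite FF'//= yn.
Qed.

Lemma hdiffZ a F s : hdiff (fun y => a * F y) s = a * hdiff F s.
Proof.
elim: s F => [|x s IH] F /=; first by rewrite mulr0.
by rewrite (IH (fun y => F (x :: y))); ring.
Qed.

Lemma hdiff0 s : hdiff (fun=> 0) s = 0.
Proof. by elim: s => //= x s ->; rewrite subrr. Qed.

Lemma hdiffD F F' s : hdiff (fun y => F y + F' y) s = hdiff F s + hdiff F' s.
Proof.
elim: s F F' => [|x s IH] F F' /=; first by rewrite addr0.
by rewrite (IH (fun y => F (x :: y)) (fun y => F' (x :: y))); ring.
Qed.

Lemma hdiffB F F' s : hdiff (fun y => F y - F' y) s = hdiff F s - hdiff F' s.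
Proof.
elim: s F F' => [|x s IH] F F' /=; first by rewrite subr0.
by rewrite (IH (fun y => F (x :: y)) (fun y => F' (x :: y))); ring.
Qed.

Lemma hdiff_sum (I : finType) (u : I -> k) (F : I -> seq T -> k) s :
  hdiff (fun y => \sum_i u i * F i y) s = \sum_i u i * hdiff (F i) s.
Proof.
elim: s F => [|x s IH] F /=; first by rewrite big1// => i _; rewrite mulr0.
rewrite (IH (fun i y => F i (x :: y))) -sumrB.
by apply: eq_bigr => i _; rewrite mulrBr.
Qed.

Lemma hdiffK F s : hdiff (hdiff F) s = 0.
Proof.
elim: s F => //= x s IH F.
rewrite (hdiffB F (hdiff (fun y => F (x :: y)))) IH; ring.
Qed.

End HomogeneousCochains.

Lemma hdiff_map (k : fieldType) (T U : Type) (phi : T -> U) (F : seq U -> k) s :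
  hdiff F (map phi s) = hdiff (F \o map phi) s.
Proof.
elim: s F => //= x s IH F; rewrite IH; congr (_ - _).
Qed.

Section SignedSum.
Context (k : fieldType).

(** A discrete integral of [F] from [a] to [b], with the usual change of sign when [b < a]. *)
Definition isum (F : int -> k) (a b : int) : k :=
  if (b - a) is Posz n then \sum_(i < n) F (a + i%:Z)
  else - \sum_(i < `|b - a|%N) F (b + i%:Z).

Lemma isum0 F a : isum F a a = 0.
Proof. by rewrite /isum (_ : a - a = Posz 0) ?big_ord0 ?subrr. Qed.

Lemma isumS F a b : isum F a (b + 1) = isum F a b + F b.
Proof.
rewrite /isum addrAC.
case e : (b - a) => [n|n].
  have -> : (n%:Z + 1) = n.+1 by lia.
  rewrite big_ord_recr /=; congr (_ + F _); lia.
case: n e => [|n] e.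
  have -> : Negz 0 + 1 = 0%N by [].
  by rewrite big_ord0 /= big_ord1 addr0 addNr.
have -> : Negz n.+1 + 1 = Negz n by rewrite !NegzE; lia.
rewrite /= [in RHS]big_ord_recl /= addr0 opprD addrAC addNr add0r; congr (- _).
by apply: eq_bigr => i _; congr F; rewrite /= /bump /=; lia.
Qed.

(** A first-order difference equation on the integers has one solution with a given initial value;
    identities between signed sums thus become one-step checks. *)
Lemma isum_unique (F : int -> k) (P : int -> k) a :
  P a = 0 -> (forall b, P (b + 1) = P b + F b) -> forall b, P b = isum F a b.
Proof.
move=> P0 PS b; rewrite -[b](subrK a) addrC; elim/int_rec: (b - a) => [|n IH|n IH].
- by rewrite addr0 P0 isum0.
- have -> : a + n.+1%:Z = (a + n%:Z) + 1 by lia.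
  by rewrite PS isumS IH.
- have := PS (a - n.+1%:Z); have := isumS F a (a - n.+1%:Z).
  have -> : a - n.+1%:Z + 1 = a - n%:Z by lia.
  by rewrite IH => -> /addIr.
Qed.

End SignedSum.

(** * A group acting on a line and its stabilisers *)

Section EquivariantCochains.
Context (k : fieldType) (G : groupType).
Implicit Types (H : G -> Prop) (mu : G -> k) (F : seq G -> k).

(** Cochains of the subgroup [H] with coefficients in the character [mu], taken on lists over all of
    [G]. As [G] is a free [H]-set they compute the cohomology of [H], and restriction to a smaller
    subgroup leaves the function itself unchanged. *)
Definition equivariant H mu n F : Prop :=
  forall h x, H h -> size x = n -> F [seq (h * y)%g | y <- x] = mu h * F x.

Definition hcocycle H mu n F : Prop :=
  equivariant H mu n.+1 F /\ forall x, size x = n.+2 -> hdiff F x = 0.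

(* The value on the empty list plays the role of the augmentation; it has to
   vanish for degree 0 cocycles not to be killed. *)
Definition hcoboundary H mu n F : Prop :=
  exists b, [/\ equivariant H mu n b, n = 0%N -> b [::] = 0 &
    forall x, size x = n.+1 -> F x = hdiff b x].

(* Says dim (cocycles / coboundaries) <= N without forming the quotient. *)
Definition bounded H mu n N : Prop :=
  forall M (f : 'I_M -> seq G -> k), (forall i, hcocycle H mu n (f i)) ->
  exists A : 'M[k]_(M, N), forall u : 'rV_M, u *m A = 0 ->
    hcoboundary H mu n (fun x => \sum_i u 0 i * f i x).

Lemma hcocycle_lin (I : finType) H mu n (u : I -> k) (f : I -> seq G -> k) :
  (forall i, hcocycle H mu n (f i)) ->
  hcocycle H mu n (fun x => \sum_i u i * f i x).
Proof.
move=> fc; split => [h x Hh xn|x xn].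
  rewrite mulr_sumr; apply: eq_bigr => i _.
  by have [fe _] := fc i; rewrite fe// mulrCA.
by rewrite hdiff_sum big1// => i _; have [_ fd] := fc i; rewrite fd ?mulr0.
Qed.

Lemma map_mulgA (g h : G) (x : seq G) :
  [seq (g * y)%g | y <- [seq (h * y)%g | y <- x]] = [seq (g * h * y)%g | y <- x].
Proof. by rewrite -map_comp; apply: eq_map => y /=; rewrite mulgA. Qed.

Section Step.
Context (H : G -> Prop) (mu : G -> k).
Hypothesis HM : forall g h, H g -> H h -> H (g * h)%g.
Hypothesis HV : forall g, H g -> H g^-1%g.
Hypothesis muM : forall g h, mu (g * h)%g = mu g * mu h.
Context (eps : G -> bool) (c : G -> int) (t : int -> G).
Hypothesis epsM : forall g h, eps (g * h)%g = eps g (+) eps h.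
Hypothesis cM : forall g h, c (g * h)%g = c g + (-1) ^+ eps g * c h.
Hypothesis Ht : forall m, H (t m).
Hypothesis teps : forall m, eps (t m) = false.
Hypothesis tc : forall m, c (t m) = m.
Hypothesis mut : forall g, eps g = false -> mu g = 1.

(* H acts on the vertices of the line Z by g.m = c g + m or c g - m; the
   stabilisers are those of the vertex 0 and of the edge [0, 1], and [mu']
   accounts for the orientation of the edge. *)
Definition vertex_stab g := H g /\ c g = 0.
Definition edge_stab g := H g /\ c g = (eps g : nat).
Definition mu' g := (-1) ^+ eps g * mu g.

Let eps1 : eps 1%g = false.
Proof. by have := epsM 1%g 1%g; rewrite mulg1; case: (eps 1%g). Qed.
Let epsV g : eps g^-1%g = eps g.
Proof. by have := epsM g g^-1%g; rewrite mulgV eps1; case: (eps g); case: (eps _). Qed.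
Let c1 : c 1%g = 0.
Proof. by have := cM 1%g 1%g; rewrite mulg1 eps1 mul1r; lia. Qed.
Let cV g : c g^-1%g = - (-1) ^+ eps g * c g.
Proof.
have := cM g^-1%g g; rewrite mulVg c1 epsV.
by case: (eps g); rewrite ?expr1 ?expr0; lia.
Qed.

Definition mv (g : G) (m : int) : int := c g + (-1) ^+ eps g * m.
(** An edge is named by its left end. A reflection exchanges the ends, whence the correction by
    one. *)
Definition me (g : G) (m : int) : int := c g + (-1) ^+ eps g * m - (eps g : nat)%:Z.

Lemma vertex_stab_conj h m : H h -> vertex_stab ((t (mv h m))^-1 * h * t m)%g.
Proof.
move=> Hh; split; first by do !apply: HM => //; exact: HV.
by rewrite !cM !epsM cV epsV !teps tc tc /mv; case: (eps h) => /=; lia.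
Qed.

Lemma edge_stab_conj h m : H h -> edge_stab ((t (me h m))^-1 * h * t m)%g.
Proof.
move=> Hh; split; first by do !apply: HM => //; exact: HV.
by rewrite !cM !epsM cV epsV !teps tc tc /me; case: (eps h) => /=; lia.
Qed.

Lemma mu_conj h m m' : mu ((t m')^-1 * h * t m)%g = mu h.
Proof. by rewrite !muM [mu (t m)]mut// [mu _^-1%g]mut ?epsV// mul1r mulr1. Qed.

Lemma mu'_conj h m m' : mu' ((t m')^-1 * h * t m)%g = mu' h.
Proof. by rewrite /mu' mu_conj !epsM epsV !teps addbF. Qed.

(** The Shapiro correspondence: an equivariant cochain of the stabiliser of the base cell extends to
    a family over all cells that is equivariant under [H], and [transport F m] is its member at
    [m]. *)
Definition transport (F : seq G -> k) (m : int) : seq G -> k :=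
  fun x => F [seq ((t m)^-1 * y)%g | y <- x].

Lemma transport_vertex n F h m x : equivariant vertex_stab mu n F -> H h ->
  size x = n -> transport F (mv h m) [seq (h * y)%g | y <- x] = mu h * transport F m x.
Proof.
move=> Fe Hh xn; rewrite /transport map_mulgA.
have -> : [seq ((t (mv h m))^-1 * h * y)%g | y <- x] =
    [seq (((t (mv h m))^-1 * h * t m) * y)%g | y <- [seq ((t m)^-1 * y)%g | y <- x]].
  by rewrite map_mulgA; apply: eq_map => y; rewrite -!mulgA mulVKg.
rewrite Fe ?size_map//; last exact: vertex_stab_conj.
by rewrite mu_conj.
Qed.

Lemma transport_edge n F h m x : equivariant edge_stab mu' n F -> H h ->
  size x = n -> transport F (me h m) [seq (h * y)%g | y <- x] = mu' h * transport F m x.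
Proof.
move=> Fe Hh xn; rewrite /transport map_mulgA.
have -> : [seq ((t (me h m))^-1 * h * y)%g | y <- x] =
    [seq (((t (me h m))^-1 * h * t m) * y)%g | y <- [seq ((t m)^-1 * y)%g | y <- x]].
  by rewrite map_mulgA; apply: eq_map => y; rewrite -!mulgA mulVKg.
rewrite Fe ?size_map//; last exact: edge_stab_conj.
by rewrite mu'_conj.
Qed.

Lemma hdiff_transport F m x : hdiff (transport F m) x = transport (hdiff F) m x.
Proof. by rewrite /transport hdiff_map. Qed.

Section Connecting.
Context (n : nat) (f b : seq G -> k).
Hypothesis fH : equivariant H mu n.+1 f.
Hypothesis bQ : equivariant vertex_stab mu n b.
Hypothesis fb : forall x, size x = n.+1 -> f x = hdiff b x.

(** All members of the family generated by [b] have coboundary [f], as [f] is equivariant under [H].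
    Their difference along the edge from 0 to 1 is therefore a cocycle of the edge stabiliser. *)
Definition connecting (x : seq G) : k := transport b 1 x - transport b 0 x.

Lemma transport_connecting m x : size x = n ->
  transport connecting m x = transport b (m + 1) x - transport b m x.
Proof.
move=> xn; rewrite /transport /connecting /transport.
have e j : b [seq ((t j)^-1 * y)%g | y <- [seq ((t m)^-1 * y)%g | y <- x]] =
    transport b (m + j) x.
  have := transport_vertex (m + j) bQ (HV (Ht m)) xn.
  have -> : mv (t m)^-1%g (m + j) = j by rewrite /mv cV epsV teps tc /= expr0; lia.
  by rewrite mut ?epsV ?teps// mul1r => <-.
by rewrite !e addr0.
Qed.

Lemma connecting_edge : equivariant edge_stab mu' n connecting.
Proof.
move=> h x [Hh ch] xn; rewrite /connecting /mu'.
have := transport_vertex 0 bQ Hh xn; have := transport_vertex 1 bQ Hh xn.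
rewrite /mv ch; case: (eps h) => /=; rewrite ?expr1 ?expr0.
  have -> : 1 + -1 * 1 = 0 :> int by [].
  have -> : 1 + -1 * 0 = 1 :> int by [].
  by move=> -> ->; ring.
have -> : 0 + 1 * 1 = 1 :> int by [].
have -> : 0 + 1 * 0 = 0 :> int by [].
by move=> -> ->; ring.
Qed.

Lemma connecting_cocycle x : size x = n.+1 -> hdiff connecting x = 0.
Proof.
move=> xn; rewrite /connecting hdiffB !hdiff_transport.
have e m : transport (hdiff b) m x = f x.
  rewrite /transport -fb ?size_map// fH//; last exact: HV.
  by rewrite mut ?epsV// mul1r.
by rewrite !e subrr.
Qed.

End Connecting.

Lemma isum_zero (F : int -> k) a m : (forall l, F l = 0) -> isum F a m = 0.
Proof.
move=> F0; rewrite -(@isum_unique k F (fun=> 0) a)// => l.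
by rewrite F0 addr0.
Qed.

(* With B m := transport b m, the failure B (m + 1) - B m of b to descend to H
   is the coboundary of the transports of g; summing the latter along the line
   from the position of the first entry of x to m makes the correction
   equivariant under H. *)
Lemma wang_step p (f b g : seq G -> k) :
  equivariant H mu p.+2 f -> equivariant vertex_stab mu p.+1 b ->
  (forall x, size x = p.+2 -> f x = hdiff b x) ->
  equivariant edge_stab mu' p g -> (p = 0%N -> g [::] = 0) ->
  (forall x, size x = p.+1 -> connecting b x = hdiff g x) ->
  hcoboundary H mu p.+1 f.
Proof.
move=> fH bQ fb ge g0 gE.
pose v (x : seq G) := if x is y :: _ then c y else 0.
pose S m x := isum (fun l => transport g l x) (v x) m.
have SH h m y : H h -> size y = p ->
    S (mv h m) [seq (h * z)%g | z <- y] = mu h * S m y.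
  move=> Hh yp; have [p0|p0] := eqVneq p 0%N.
    (* An empty list provides no base point that moves with [h]; in that case [g] vanishes by the
       augmentation condition. *)
    have y0 : y = [::] by case: y yp; rewrite ?p0.
    by rewrite /S y0 /= !isum_zero ?mulr0// => l; exact: g0.
  have vh : v [seq (h * z)%g | z <- y] = mv h (v y).
    by case: y yp => [|y0 y] /= yp; [rewrite -yp in p0|rewrite cM].
  pose F m := mu h * transport g m y.
  transitivity (isum F (v y) m).
    apply: (isum_unique (P := fun m => S (mv h m) _)) => [|l].
      by rewrite /S vh isum0.
    have := transport_edge l ge Hh yp; rewrite /F /mu' /me /mv.
    (* A reflection reverses the direction of summation, and the sign in [mu'] compensates for
       it. *)
    case: (eps h) => /=; rewrite ?expr1 ?expr0 => e.
      set j := c h + -1 * (l + 1).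
      have -> : c h + -1 * l = j + 1 by rewrite /j; lia.
      rewrite /S isumS; move: e; rewrite (_ : _ - _ = j); last by rewrite /j; lia.
      by move=> ->; ring.
    rewrite !mul1r in e *; rewrite subr0 in e.
    by rewrite addrA /S isumS e.
  apply/esym; apply: (isum_unique (P := fun m => mu h * S m y)) => [|l].
    by rewrite /S isum0 mulr0.
  by rewrite /S isumS mulrDr.
have SS m : S (m + 1) = (fun y => S m y + transport g m y).
  by apply/funext => y; rewrite /S isumS.
(* [W m] does not depend on [m], so equivariance of the family over the vertices becomes
   equivariance of [W 0] under [H]. *)
pose W m x := transport b m x - hdiff (S m) x.
have WS m x : size x = p.+1 -> W (m + 1) x = W m x.
  move=> xp; rewrite /W SS hdiffD hdiff_transport.
  have : transport (hdiff g) m x = transport (connecting b) m x.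
    by rewrite /transport gE// size_map.
  by rewrite (transport_connecting bQ)// => ->; ring.
have W0 m x : size x = p.+1 -> W m x = W 0 x.
  move=> xp; elim/int_rec: m => // m IH.
    by rewrite -IH -(WS m%:Z)//; congr (W _ _); lia.
  by rewrite -IH -(WS (- m.+1%:Z))//; congr (W _ _); lia.
exists (W 0); split => // [h x Hh xp|x xp].
  rewrite -(W0 (mv h 0)) ?size_map// /W (transport_vertex 0 bQ)// mulrBr.
  rewrite hdiff_map -hdiffZ; congr (_ - _); apply: eq_hdiff xp => y yp.
  exact: SH.
rewrite /W hdiffB hdiffK subr0 hdiff_transport /transport -fb ?size_map//.
by rewrite fH//; [rewrite mut ?epsV// mul1r|exact: HV].
Qed.

(** Exactness at [H], written with matrices: the first block makes the restriction to the vertex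
    stabiliser a coboundary, the second kills the resulting connecting class, and [wang_step]
    concludes. *)
Lemma bounded_wang p N1 N2 : bounded vertex_stab mu p.+1 N1 ->
  bounded edge_stab mu' p N2 -> bounded H mu p.+1 (N1 + N2).
Proof.
move=> bQ bE M f fc.
have fQ i : hcocycle vertex_stab mu p.+1 (f i).
  by have [fe fd] := fc i; split => // h x [Hh _]; exact: fe.
have [A1 A1P] := bQ _ _ fQ.
pose K := kermx A1.
have fK i : hcoboundary vertex_stab mu p.+1 (fun x => \sum_j K i j * f j x).
  have /A1P[b [be b0 bd]] : row i K *m A1 = 0 by rewrite -row_mul mulmx_ker row0.
  exists b; split => // x xp; rewrite -bd//; apply: eq_bigr => j _.
  by rewrite [row _ _ _ _]mxE.
have [b bP] := choice fK.
have fKc i : hcocycle H mu p.+1 (fun x => \sum_j K i j * f j x).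
  exact: (hcocycle_lin (fun j => K i j) fc).
have cE i : hcocycle edge_stab mu' p (connecting (b i)).
  have [be _ bd] := bP i; have [fe _] := fKc i.
  split; first exact: connecting_edge be.
  exact: connecting_cocycle fe bd.
have [A2 A2P] := bE _ _ cE.
exists (row_mx A1 (pinvmx K *m A2)) => u.
rewrite mul_mx_row => /eqP; rewrite -row_mx0 => /eqP/eq_row_mx[uA1 uA2].
(* The rows of [K] span the kernel of [A1], which contains [u]; [u'] holds coordinates of [u] in
   these rows. *)
pose u' := u *m pinvmx K.
have uK : u' *m K = u by apply: mulmxKpV; apply/sub_kermxP.
have [g [ge g0 gE]] : hcoboundary edge_stab mu' p
    (fun x => \sum_i u' 0 i * connecting (b i) x).
  by apply: A2P; rewrite /u' -mulmxA.
have fE x : \sum_i u 0 i * f i x = \sum_i u' 0 i * \sum_j K i j * f j x.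
  rewrite -uK; under eq_bigr => j _ do rewrite mxE mulr_suml.
  rewrite exchange_big /=; apply: eq_bigr => i _; rewrite mulr_sumr.
  by apply: eq_bigr => j _; rewrite mulrA.
apply: (@wang_step _ _ (fun x => \sum_i u' 0 i * b i x) g) => //.
- exact: (hcocycle_lin _ fc).1.
- move=> h x Hh xp; rewrite mulr_sumr; apply: eq_bigr => i _.
  by have [be _ _] := bP i; rewrite be// mulrCA.
- move=> x xp; rewrite fE hdiff_sum; apply: eq_bigr => i _.
  by have [_ _ ->] := bP i.
- move=> x xp; rewrite -gE// /connecting /transport -sumrB.
  by apply: eq_bigr => i _; rewrite mulrBr.
Qed.

End Step.
End EquivariantCochains.

(** * Induction over the coordinate lines *)

Section DihedralBound.
Context (k : fieldType) (k2 : (2 : k) != 0) (G : groupType) (s : nat).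
Context (eps : G -> bool) (c : 'I_s -> G -> int).
Hypothesis epsM : forall g h, eps (g * h)%g = eps g (+) eps h.
Hypothesis cM : forall i g h, c i (g * h)%g = c i g + (-1) ^+ eps g * c i h.
Hypothesis c0 : forall (i : 'I_s) g, i = 0%N :> nat -> c i g = 0.
Hypothesis c_inj : forall g h, eps g = eps h -> (forall i, c i g = c i h) -> g = h.
Hypothesis c_surj : forall (e : bool) (a : 'I_s -> int),
  (forall i : 'I_s, i = 0%N :> nat -> a i = 0) ->
  exists g, eps g = e /\ forall i, c i g = a i.

Definition sgn_pow (e : bool) (g : G) : k := (-1) ^+ (e && eps g).

(** The joint stabiliser of one cell on each line in [fs]: the vertex 0 where [a i] is 0, the edge
    from 0 to 1 where [a i] is 1. A reflection preserving the latter has [c i g = 1]. *)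
Definition cell_stab (fs : seq 'I_s) (a : 'I_s -> int) (g : G) : Prop :=
  forall i, i \in fs -> c i g = if eps g then a i else 0.

Let eps1 : eps 1%g = false.
Proof. by have := epsM 1%g 1%g; rewrite mulg1; case: (eps 1%g). Qed.
Let epsV g : eps g^-1%g = eps g.
Proof. by have := epsM g g^-1%g; rewrite mulgV eps1; case: (eps g); case: (eps _). Qed.
Let c1 i : c i 1%g = 0.
Proof. by have := cM i 1%g 1%g; rewrite mulg1 eps1 mul1r; lia. Qed.
Let cV i g : c i g^-1%g = - (-1) ^+ eps g * c i g.
Proof.
have := cM i g^-1%g g; rewrite mulVg c1 epsV.
by case: (eps g); rewrite ?expr1 ?expr0; lia.
Qed.

Lemma sgn_powM e g h : sgn_pow e (g * h)%g = sgn_pow e g * sgn_pow e h.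
Proof.
by rewrite /sgn_pow epsM; case: e; case: (eps g); case: (eps h) => /=;
  rewrite ?expr1 ?expr0 ?mulrNN ?mulr1 ?mul1r.
Qed.

Lemma sgn_powK e g : sgn_pow e g * sgn_pow e g = 1.
Proof. by rewrite /sgn_pow -signr_addb addbb. Qed.

Lemma cell_stabM fs a g h :
  cell_stab fs a g -> cell_stab fs a h -> cell_stab fs a (g * h)%g.
Proof.
move=> Hg Hh i ifs; rewrite cM epsM (Hg _ ifs) (Hh _ ifs).
by case: (eps g); case: (eps h) => /=; rewrite ?expr1 ?expr0; lia.
Qed.

Lemma cell_stabV fs a g : cell_stab fs a g -> cell_stab fs a g^-1%g.
Proof.
move=> Hg i ifs; rewrite cV epsV (Hg _ ifs).
by case: (eps g) => /=; rewrite ?expr1 ?expr0; lia.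
Qed.

Lemma cell_stab_reflection (fs : seq 'I_s) a : (forall i : 'I_s, i \in fs -> (0 < i)%N) ->
  exists2 rho, eps rho & cell_stab fs a rho.
Proof.
move=> fs0; have [|rho [er cr]] := c_surj true (a := fun i => if (0 < i)%N then a i else 0).
  by move=> i ->.
by exists rho => // i ifs; rewrite cr er fs0.
Qed.

(** A cocycle of degree 0 is constant, and under the sign character a reflection makes this constant
    equal to its negative. *)
Lemma bounded_degree0 (H : G -> Prop) e rho : H rho -> eps rho ->
  bounded H (sgn_pow e) 0 (if e then 0 else 1)%N.
Proof.
move=> Hr er M f fc.
have fcst i x y : f i [:: x] = f i [:: y].
  have [_ /(_ [:: x; y] erefl) /=] := fc i.
  by rewrite subr0 => /eqP; rewrite subr_eq0 => /eqP ->.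
have suff0 u : \sum_i u i * f i [:: 1%g] = 0 ->
    hcoboundary H (sgn_pow e) 0 (fun x => \sum_i u i * f i x).
  move=> u0; exists (fun=> 0); split => // [h x _ _|x]; first by rewrite mulr0.
  case: x => [|x []]//= _; rewrite subr0 -[RHS]u0; apply: eq_bigr => i _.
  by rewrite (fcst i x 1%g).
case: e fc suff0 => fc suff0.
  exists 0 => u _; apply: suff0; rewrite big1// => i _.
  have [fe _] := fc i; have := fe rho [:: 1%g] Hr erefl.
  rewrite /= (fcst i _ 1%g) /sgn_pow er /= expr1 mulN1r => h.
  have : 2 * f i [:: 1%g] = 0 by rewrite mulr_natl mulr2n {1}h addNr.
  by move=> /eqP; rewrite mulf_eq0 (negbTE k2) /= => /eqP ->; rewrite mulr0.
exists (\col_i f i [:: 1%g]) => u /matrixP/(_ 0 0); rewrite !mxE => u0.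
by apply: suff0; rewrite -[RHS]u0; apply: eq_bigr => i _; rewrite mxE.
Qed.

(** With a cell fixed on every line only the identity and one reflection remain, a group whose order
    is invertible in [k]. *)
Lemma bounded_finite (fs : seq 'I_s) a e n :
  (forall i, (i \in fs) = (0 < i)%N) ->
  bounded (cell_stab fs a) (sgn_pow e) n.+1 0.
Proof.
move=> fsE M f fc; exists 0 => u _.
have [fe fd] := hcocycle_lin (fun i => u 0 i) fc.
set F := (fun x => _) in fe fd *.
have [rho er Hr] : exists2 rho, eps rho & cell_stab fs a rho.
  by apply: cell_stab_reflection => i; rewrite fsE.
have Hchar h : cell_stab fs a h -> h = 1%g \/ h = rho.
  move=> Hh; case eh : (eps h); [right|left]; apply: c_inj; rewrite ?eps1 ?eh ?er//.
    move=> i; have [i0|] := posnP i; first by rewrite !c0.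
    by rewrite -fsE => ifs; rewrite Hh// Hr// eh er.
  move=> i; have [i0|] := posnP i; first by rewrite !c0.
  by rewrite -fsE => ifs; rewrite Hh// eh c1.
have rr : (rho * rho)%g = 1%g.
  case: (Hchar _ (cell_stabM Hr Hr)) => // /(congr1 eps).
  by rewrite epsM er.
set m := sgn_pow e rho; have mm : m * m = 1 by exact: sgn_powK.
(* The cone over the identity is a primitive of [F] but is not equivariant; averaging it over the
   two group elements repairs this. *)
pose b0 x := F (1%g :: x).
have b0d x : size x = n.+2 -> hdiff b0 x = F x.
  move=> xn; have /= := fd (1%g :: x); rewrite xn => /(_ erefl) /eqP.
  by rewrite subr_eq0 => /eqP ->.
pose b1 x := b0 [seq (rho * y)%g | y <- x].
exists (fun x => 2^-1 * (b0 x + m * b1 x)); split => // [h x|x xn].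
  move=> /Hchar[->|->] _.
    have -> : [seq (1 * y)%g | y <- x] = x.
      by rewrite -[RHS]map_id; apply: eq_map => y; rewrite mul1g.
    by rewrite /sgn_pow eps1 andbF mul1r.
  rewrite -/m /b1 map_mulgA rr.
  have -> : [seq (1 * y)%g | y <- x] = x.
      by rewrite -[RHS]map_id; apply: eq_map => y; rewrite mul1g.
  rewrite mulrCA; congr (_ * _); rewrite mulrDr mulrA mm mul1r addrC.
  by [].
rewrite hdiffZ hdiffD hdiffZ b0d// -[b1]/(b0 \o map (fun y => rho * y)%g) -hdiff_map.
rewrite b0d ?size_map// fe// -/m mulrA mm mul1r.
by field.
Qed.

(** Reflections act by the sign (-1)^n on the n-th exterior power of a space of dimension q. This is
    the dimension of the invariants of that power after twisting by the e-th power of the sign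
    character. *)
Definition hook_dim (q n : nat) (e : bool) : nat :=
  if odd n (+) e then 0%N else 'C(q, n).

Lemma bounded_cell_stab (cs fs : seq 'I_s) a n e :
  uniq (fs ++ cs) -> (forall i, (i \in fs ++ cs) = (0 < i)%N) ->
  bounded (cell_stab fs a) (sgn_pow e) n (hook_dim (size cs) n e).
Proof.
elim: cs fs a n e => [|j cs IH] fs a [|n] e ufc fcE.
- have [rho er Hr] : exists2 rho, eps rho & cell_stab fs a rho.
    by apply: cell_stab_reflection => i ifs; rewrite -fcE cats0.
  by have := bounded_degree0 (e := e) Hr er; rewrite /hook_dim /= bin0; case: e.
- rewrite /hook_dim bin0n if_same.
  by apply: bounded_finite => i; rewrite -fcE cats0.
- have [rho er Hr] : exists2 rho, eps rho & cell_stab fs a rho.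
    by apply: cell_stab_reflection => i ifs; rewrite -fcE mem_cat ifs.
  by have := bounded_degree0 (e := e) Hr er; rewrite /hook_dim /= bin0; case: e.
have pe : perm_eq (fs ++ j :: cs) ((j :: fs) ++ cs).
  by rewrite -cat1s perm_catCA.
have {}ufc : uniq ((j :: fs) ++ cs) by rewrite -(perm_uniq pe).
have {}fcE i : (i \in (j :: fs) ++ cs) = (0 < i)%N by rewrite -(perm_mem pe).
have jfs : j \notin fs by move: ufc; rewrite /= mem_cat negb_or => /andP[/andP[]].
have j0 : (0 < j)%N by rewrite -fcE mem_head.
have tex m : exists g, [/\ eps g = false, c j g = m & forall i, i != j -> c i g = 0].
  have [|g [eg cg]] := c_surj false (a := fun i => if i == j then m else 0).
    by move=> i i0; case: eqP => // ij; rewrite -ij i0 in j0.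
  by exists g; split => // [|i ij]; rewrite cg ?eqxx ?(negbTE ij).
have [t tP] := choice tex.
have stabE (o : bool) g : cell_stab fs a g /\ c j g = (o && eps g : nat) <->
    cell_stab (j :: fs) (fun i => if i == j then (o : nat)%:Z else a i) g.
  split => [[Hg cg] i|Hg].
    rewrite in_cons; case: eqVneq => [->|_] /=; last exact: Hg.
    by rewrite {}cg; case: o; case: (eps g).
  split => [i ifs|].
    rewrite Hg ?in_cons ?ifs ?orbT//; case: (eqVneq i j) => // ij.
    by rewrite ij (negbTE jfs) in ifs.
  by rewrite Hg ?mem_head// eqxx {Hg}; case: o; case: (eps g).
have bQ := IH _ (fun i => if i == j then (false : nat)%:Z else a i) n.+1 e ufc fcE.
have bE := IH _ (fun i => if i == j then (true : nat)%:Z else a i) n (~~ e) ufc fcE.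
have -> : hook_dim (size (j :: cs)) n.+1 e =
    (hook_dim (size cs) n.+1 e + hook_dim (size cs) n (~~ e))%N.
  by rewrite /hook_dim /= binS; case: (odd n); case: e {bQ bE}; rewrite ?addn0.
apply: (@bounded_wang _ _ (cell_stab fs a) (sgn_pow e) _ _ _ eps (c j) t) => //.
- exact: cell_stabM.
- exact: cell_stabV.
- exact: sgn_powM.
- move=> m i ifs; have [-> _ ->//] := tP m.
  by apply: contraNneq jfs => <-.
- by move=> m; have [] := tP m.
- by move=> m; have [] := tP m.
- by move=> g eg; rewrite /sgn_pow eg andbF.
- rewrite (_ : vertex_stab _ _ = cell_stab (j :: fs)
      (fun i => if i == j then (false : nat)%:Z else a i))//.
  by apply/funext => g; apply/propext; exact: (stabE false g).
- rewrite (_ : edge_stab _ _ _ = cell_stab (j :: fs)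
      (fun i => if i == j then (true : nat)%:Z else a i)); last first.
    by apply/funext => g; apply/propext; exact: (stabE true g).
  rewrite (_ : mu' _ _ = sgn_pow (~~ e))//.
  apply/funext => g; rewrite /mu' /sgn_pow; case: (eps g); case: e {bQ bE} => /=;
    by rewrite ?expr1 ?expr0 ?mulrNN ?mulr1 ?mul1r.
Qed.

Lemma bounded_total n : bounded (fun _ : G => True) (fun=> 1 : k) n (hook_dim s.-1 n false).
Proof.
have szE s' : size [seq i : 'I_s' <- enum 'I_s' | (0 < i)%N] = s'.-1.
  case: s' => [|s']; first by
    rewrite size_filter; apply/eqP; rewrite -leqn0 -[X in (_ <= X)%N](size_enum_ord 0) count_size.
  rewrite enum_ordSl /= filter_map size_map.
  rewrite (eq_filter (a2 := predT)) ?filter_predT ?size_enum_ord//.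
pose cs := [seq i : 'I_s <- enum 'I_s | (0 < i)%N].
have sz : size cs = s.-1 by exact: szE.
have := @bounded_cell_stab cs [::] (fun=> 0) n false; rewrite sz /=.
rewrite (_ : cell_stab [::] _ = fun=> True); last first.
  by apply/funext => g; apply/propext; split => // _ i.
rewrite (_ : sgn_pow false = fun=> 1)//.
apply; first by rewrite filter_uniq// enum_uniq.
by move=> i; rewrite mem_filter mem_enum andbT.
Qed.

End DihedralBound.

(** * Cup products and their detection *)

Section Prism.
Context (k : fieldType) (T : Type).
Implicit Types (phi : T -> T) (F : seq T -> k).

(** The prism operator: alternating sum of the values at y_0, ..., y_i, phi y_i, ..., phi y_n. By
    [hdiff_prism] it is a homotopy between [F] and [F \o map phi]. *)
Fixpoint prism phi F (x : seq T) : k :=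
  if x is y :: x' then
    F (y :: phi y :: map phi x') - prism phi (fun z => F (y :: z)) x'
  else 0.

Lemma eq_prism phi n F F' x : (forall y, size y = n.+1 -> F y = F' y) ->
  size x = n -> prism phi F x = prism phi F' x.
Proof.
elim: x n F F' => //= y x IH n F F' FF' xn.
rewrite FF' /= ?size_map ?xn//; congr (_ - _).
by case: n xn FF' => // n [xn] FF'; apply: IH xn => z zn; rewrite FF'//= zn.
Qed.

Lemma prismB phi F F' x :
  prism phi (fun y => F y - F' y) x = prism phi F x - prism phi F' x.
Proof.
elim: x F F' => [|y x IH] F F' /=; first by rewrite subrr.
by rewrite (IH (fun z => F (y :: z)) (fun z => F' (y :: z))); ring.
Qed.

Lemma prismZ phi a F x : prism phi (fun y => a * F y) x = a * prism phi F x.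
Proof.
elim: x F => [|y x IH] F /=; first by rewrite mulr0.
by rewrite (IH (fun z => F (y :: z))); ring.
Qed.

Lemma prism_sum (I : finType) phi (u : I -> k) (F : I -> seq T -> k) x :
  prism phi (fun y => \sum_i u i * F i y) x = \sum_i u i * prism phi (F i) x.
Proof.
elim: x F => [|y x IH] F /=; first by rewrite big1// => i _; rewrite mulr0.
rewrite (IH (fun i z => F i (y :: z))) -sumrB.
by apply: eq_bigr => i _; rewrite mulrBr.
Qed.

Lemma prism_map phi (g : T -> T) F x : (forall y, phi (g y) = g (phi y)) ->
  prism phi F (map g x) = prism phi (F \o map g) x.
Proof.
move=> pg; elim: x F => //= y x IH F; rewrite IH pg; congr (F (_ :: _ :: _) - _).
by rewrite -!map_comp; apply: eq_map => z /=; exact: pg.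
Qed.

Lemma hdiff_prism phi F x :
  hdiff (prism phi F) x + prism phi (hdiff F) x = F (map phi x) - F x.
Proof.
elim: x F => [|y x IH] F /=; first by rewrite addr0 subrr.
rewrite (hdiffB (fun z => F (y :: phi y :: map phi z)) (prism phi (fun z => F (y :: z)))).
rewrite (prismB phi F (hdiff (fun z => F (y :: z)))).
have := IH (fun z => F (y :: z)).
rewrite hdiff_map => /(canRL (addrK _)) ->.
by rewrite -[in X in _ + X = _]/(_ \o _); ring.
Qed.

End Prism.

Section Detection.
Context (k : fieldType) (G : groupType) (L : G -> Prop).
Hypothesis Lcomm : forall g h, L g -> L h -> (g * h)%g = (h * g)%g.

(* On cocycles invariant under commuting translations this is the alternating
   sum of the inhomogeneous cocycle over the orderings of ls. *)
Fixpoint detect (ls : seq G) (F : seq G -> k) : k :=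
  if ls is l :: ls' then detect ls' (prism (fun y => (l * y)%g) F)
  else F [:: 1%g].

Lemma eq_detect ls F F' : (forall x, size x = (size ls).+1 -> F x = F' x) ->
  detect ls F = detect ls F'.
Proof.
elim: ls F F' => [|l ls IH] F F' FF' /=; first exact: FF'.
by apply: IH => x xn; exact: eq_prism xn.
Qed.

Lemma detect_sum (I : finType) ls (u : I -> k) (F : I -> seq G -> k) :
  detect ls (fun x => \sum_i u i * F i x) = \sum_i u i * detect ls (F i).
Proof.
elim: ls F => //= l ls IH F; rewrite -IH; apply: eq_detect => x _.
exact: prism_sum.
Qed.

(** When [b] is invariant under [l], [hdiff_prism] makes the prism of its coboundary the coboundary
    of minus its prism. That prism stays invariant by commutativity, so the argument descends to
    degree 0, where the augmentation vanishes. *)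
Lemma detect_coboundary ls F mu : (forall l, l \in ls -> L l) ->
  (forall l, L l -> mu l = 1) ->
  hcoboundary L mu (size ls) F -> detect ls F = 0.
Proof.
move=> lsL mu1; elim: ls F lsL => [|l ls IH] F lsL [b [bL b0 Fb]] /=.
  by rewrite Fb//= b0// subr0.
have Ll : L l by apply: lsL; rewrite mem_head.
apply: IH => [l' l'ls|]; first by apply: lsL; rewrite in_cons l'ls orbT.
exists (fun x => - prism (fun y => (l * y)%g) b x); split.
- move=> h x Lh xn; rewrite prism_map; last first.
    by move=> y; rewrite !mulgA (Lcomm Ll Lh).
  rewrite mulrN; congr (- _); rewrite -prismZ; apply: eq_prism xn => y yn.
  exact: bL.
- by move=> _ /=; rewrite oppr0.
- move=> x xn; rewrite (@eq_prism _ _ _ (size ls).+1 _ (hdiff b))//.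
  have := hdiff_prism (fun y => (l * y)%g) b x.
  rewrite bL// mu1// mul1r subrr => /eqP; rewrite addrC addr_eq0 => /eqP ->.
  have := hdiffB (fun=> 0) (prism (fun y => (l * y)%g) b) x.
  rewrite hdiff0 sub0r => <-; apply: eq_hdiff xn => y _.
  by rewrite sub0r.
Qed.

End Detection.

Section Cup.
Context (k : fieldType) (G : groupType) (s : nat).
Context (eps : G -> bool) (c : 'I_s -> G -> int).
Hypothesis cM : forall i g h, c i (g * h)%g = c i g + (-1) ^+ eps g * c i h.

(** The homogeneous cup product of the 1-cocycles sending (y, z) to [c j z - c j y], which change
    sign under reflections. *)
Fixpoint cup (js : seq 'I_s) (x : seq G) : k :=
  if js is j :: js' then
    if x is y :: x' then (c j (head y x') - c j y)%:~R * cup js' x' else 0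
  else 1.

Lemma cup_cons j js y z x :
  cup (j :: js) (y :: z :: x) = (c j z - c j y)%:~R * cup js (z :: x).
Proof. by []. Qed.

Lemma hdiff_cup js x : size x = (size js).+2 -> hdiff (cup js) x = 0.
Proof.
elim: js x => [|j js IH] [|a [|b x]]//=.
  by case: x => //= _; rewrite subr0 subrr.
move=> [xn]; have /= := IH (b :: x); rewrite xn => /(_ erefl)/eqP.
rewrite subr_eq0 => /eqP Ex.
rewrite hdiffZ -Ex; case: x xn {Ex} => //= h x _.
rewrite -!mulrBl -!rmorphB /= (_ : _ - _ = 0) ?mul0r//; ring.
Qed.

Lemma cup_equivariant js g x : size x = (size js).+1 ->
  cup js [seq (g * y)%g | y <- x] = (-1) ^+ (eps g * size js) * cup js x.
Proof.
elim: js x => [|j js IH] [|a x]//=; first by rewrite muln0 expr0 mulr1.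
case: x => // b x [xn]; have /= -> := IH (b :: x) (congr1 succn xn).
rewrite !cM mulnS exprD [in RHS]mulrACA; congr (_ * _).
rewrite -[in RHS](rmorph_sign (intr : int -> k)) -rmorphM /=; congr (_ %:~R).
by case: (eps g) => /=; rewrite ?expr1 ?expr0; ring.
Qed.

(** A translation [l] adds the constant [c j l] to the coordinate [j], so the term of the prism that
    inserts it at place [p] replaces the p-th factor by a constant. This is a Laplace expansion,
    whence the determinant in [detect_cup]. *)
Lemma prism_cup n (js : 'I_n.+1 -> 'I_s) l x : eps l = false -> size x = n.+1 ->
  prism (fun y => (l * y)%g) (cup [seq js i | i <- enum 'I_n.+1]) x =
  \sum_(p < n.+1) (-1) ^+ p * (c (js p) l)%:~R *
    cup [seq js (lift p i) | i <- enum 'I_n] x.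
Proof.
move=> el; elim: n js x => [|n IH] js [|y x]//= [xn].
  case: x xn => // _; rewrite enum_ordSl (size0nil (size_enum_ord 0)) /= big_ord1.
  by rewrite expr0 !mulr1 subr0 mul1r cM el /= expr0 mul1r addrK.
case: x xn => // h x xn.
rewrite enum_ordSl map_cons big_ord_recl expr0 mul1r.
have cl : c (js ord0) (l * y)%g - c (js ord0) y = c (js ord0) l.
  by rewrite cM el mul1r addrK.
rewrite cup_cons cl -map_comp.
congr (_ + _).
  congr (_ * _).
  have := @cup_equivariant [seq js (lift ord0 i) | i <- enum 'I_n.+1] l (y :: h :: x).
  rewrite size_map size_enum_ord => /(_ (congr1 succn xn)) /= ->.
  by rewrite el mul0n expr0 mul1r.
have -> : prism (fun y0 => (l * y0)%g)
    (fun z => cup (js ord0 :: [seq (js \o lift ord0) i | i <- enum 'I_n.+1]) (y :: z))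
    (h :: x) =
    (c (js ord0) h - c (js ord0) y)%:~R *
    prism (fun y0 => (l * y0)%g) (cup [seq (js \o lift ord0) i | i <- enum 'I_n.+1]) (h :: x).
  by rewrite -prismZ.
rewrite IH//= mulr_sumr -sumrN; apply: eq_bigr => p _.
rewrite [bump 0 p](_ : _ = p.+1)// exprS mulN1r !mulNr; congr (- _).
rewrite [in RHS]enum_ordSl map_cons cup_cons -map_comp.
rewrite (_ : lift (lift ord0 p) ord0 = ord0); last exact: val_inj.
rewrite mulrCA; congr (_ * (_ * cup _ _)).
by apply: eq_map => i /=; congr js; apply: val_inj; rewrite /= /bump /=; lia.
Qed.

Lemma detect_cup n (js : 'I_n -> 'I_s) (ls : 'I_n -> G) :
  (forall a, eps (ls a) = false) ->
  detect [seq ls a | a <- enum 'I_n] (cup [seq js i | i <- enum 'I_n]) =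
  \det (\matrix_(a, b) (c (js b) (ls a))%:~R).
Proof.
elim: n js ls => [|n IH] js ls els.
  by rewrite det_mx00 !(size0nil (size_enum_ord 0)).
rewrite (expand_det_row _ ord0) [X in detect (map _ X)]enum_ordSl /=.
rewrite (eq_detect (F' := fun x => \sum_(p < n.+1) (-1) ^+ p * (c (js p) (ls ord0))%:~R *
    cup [seq js (lift p i) | i <- enum 'I_n] x)); last first.
  move=> x; rewrite size_map size_map -cardE card_ord => xn; exact: prism_cup.
rewrite detect_sum; apply: eq_bigr => p _.
rewrite -map_comp IH// mxE /cofactor mulrAC mulrC add0n; congr (_ * (_ * \det _)).
by apply/matrixP => a b; rewrite !mxE.
Qed.

End Cup.

(** The [N + 1] cocycles [f] and [z q] satisfy a non-trivial relation modulo coboundaries. Its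
    coefficient at [f] is non-zero, as otherwise the functionals [phi q] would kill all the
    others. *)
Lemma bounded_span (k : fieldType) (G : groupType) (H : G -> Prop) (mu : G -> k)
    n N (z : 'I_N -> seq G -> k) (phi : 'I_N -> (seq G -> k) -> k) (lam : k) f :
  bounded H mu n N -> lam != 0 ->
  (forall q, hcocycle H mu n (z q)) -> hcocycle H mu n f ->
  (forall q F, hcoboundary H mu n F -> phi q F = 0) ->
  (forall q (I : finType) (u : I -> k) F,
     phi q (fun x => \sum_i u i * F i x) = \sum_i u i * phi q (F i)) ->
  (forall q q', phi q (z q') = if q == q' then lam else 0) ->
  exists a : 'I_N -> k, hcoboundary H mu n (fun x => f x - \sum_q a q * z q x) /\
    forall q, phi q f = a q * lam.
Proof.
move=> bd lam0 zc fc phi0 phiL phiz.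
pose F (i : 'I_N.+1) := if unlift ord0 i is Some q then z q else f.
have [|A AP] := bd _ F.
  by move=> i; rewrite /F; case: unliftP.
have [u /sub_kermxP uA u0] : exists2 u : 'rV_N.+1, (u <= kermx A)%MS & u != 0.
  apply/rowV0Pn; rewrite -mxrank_eq0 mxrank_ker subn_eq0 -ltnNge.
  exact: leq_ltn_trans (rank_leq_col A) _.
have B := AP _ uA.
have phiB q : u 0 ord0 * phi q f + u 0 (lift ord0 q) * lam = 0.
  have := phi0 q _ B; rewrite phiL big_ord_recl {1}/F unlift_none => h.
  rewrite -[RHS]h; congr (_ + _).
  rewrite (bigD1 q)//= /F liftK phiz eqxx big1 ?addr0// => i iq.
  by rewrite liftK phiz eq_sym (negbTE iq) mulr0.
have uz : u 0 ord0 != 0.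
  apply: contraNneq u0 => u00; apply/eqP/rowP => i; rewrite mxE.
  case: (unliftP ord0 i) => [q ->|->//].
  have := phiB q; rewrite u00 mul0r add0r => /eqP; rewrite mulf_eq0 (negbTE lam0) orbF.
  by move/eqP.
exists (fun q => - (u 0 ord0)^-1 * u 0 (lift ord0 q)); split; last first.
  move=> q; have /eqP := phiB q; rewrite addrC addr_eq0 => /eqP e.
  by rewrite !mulNr -mulrA e mulrN opprK mulKf.
have [b [be b0 bE]] := B.
exists (fun x => (u 0 ord0)^-1 * b x); split.
- by move=> h x Hh xn; rewrite be// mulrCA.
- by move=> n0; rewrite b0// mulr0.
- move=> x xn; rewrite hdiffZ -bE// big_ord_recl {1}/F unlift_none mulrDr mulKf//.
  congr (_ + _); rewrite -sumrN mulr_sumr; apply: eq_bigr => q _.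
  by rewrite /F liftK !mulNr opprK mulrA.
Qed.

(** * Homogeneous and inhomogeneous bar cochains *)

Lemma hdiffE (k : fieldType) (T : Type) (F : seq T -> k) x :
  hdiff F x = \sum_(j < size x) (-1) ^+ j * F (take j x ++ drop j.+1 x).
Proof.
elim: x F => [|y x IH] F /=; first by rewrite big_ord0.
rewrite big_ord_recl /= expr0 mul1r drop0 IH -sumrN; congr (_ + _).
by apply: eq_bigr => j _; rewrite /bump /= exprS mulN1r mulNr.
Qed.

Section BarComparison.
Context (k : fieldType) (G : groupType).

Definition homogenize n (F : cochain k G n) (x : seq G) : k :=
  F [ffun i : 'I_n => ((nth 1 x i)^-1 * nth 1 x i.+1)%g].

Fixpoint partial_prod (g : nat -> G) (m : nat) : G :=
  if m is m'.+1 then (partial_prod g m' * g m')%g else 1%g.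

Definition dehomogenize n (H : seq G -> k) : cochain k G n :=
  fun g => H (mkseq (partial_prod (fun m => if insub m is Some i then g i else 1%g)) n.+1).

Arguments dehomogenize n H g : clear implicits.

Lemma homogenize_bar n (F : cochain k G n) x : size x = n.+2 ->
  homogenize (bar_diff F) x = hdiff (homogenize F) x.
Proof.
move=> xn; rewrite hdiffE xn /homogenize /bar_diff; apply: eq_bigr => j _.
congr (_ * F _); apply/ffunP => i; rewrite !ffunE /= /bump leq0n add1n.
have del m : (m <= n)%N -> nth 1%g (take j x ++ drop j.+1 x) m =
    nth 1%g x (if (m < j)%N then m else m.+1).
  move=> mn; rewrite nth_cat size_take xn ltn_ord.
  case: ifP => mj; first by rewrite nth_take.
  by rewrite nth_drop; congr nth; lia.
rewrite !del; try (have := ltn_ord i; lia).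
by case: ltngtP => // ij; rewrite -mulgA mulKVg.
Qed.

Lemma homogenize_equivariant n (F : cochain k G n) :
  equivariant (fun=> True) (fun=> 1) n.+1 (homogenize F).
Proof.
move=> h x _ xn; rewrite mul1r; congr F; apply/ffunP => i; rewrite !ffunE.
have := ltn_ord i; move=> i_n.
by rewrite !(nth_map 1%g) ?xn; [rewrite invMg -mulgA mulKg|lia|lia].
Qed.

Lemma homogenizeK n (F : cochain k G n) : dehomogenize n (homogenize F) = F.
Proof.
apply/funext => g; congr F; apply/ffunP => i; rewrite ffunE.
rewrite !nth_mkseq /=; [|by have := ltn_ord i; lia|by have := ltn_ord i; lia].
by rewrite mulKg valK.
Qed.

Lemma dehomogenizeK n (H : seq G -> k) x :
  equivariant (fun=> True) (fun=> 1) n.+1 H -> size x = n.+1 ->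
  homogenize (dehomogenize n H) x = H x.
Proof.
move=> eH xn; rewrite -[RHS]mul1r -(eH (nth 1%g x 0)^-1%g x I xn).
congr H; apply: (@eq_from_nth _ 1%g); first by rewrite size_mkseq size_map.
move=> m; rewrite size_mkseq => mn.
rewrite nth_mkseq// (nth_map 1%g) ?xn//.
elim: m mn => [|m IH] mn /=; first by rewrite mulVg.
rewrite IH; last exact: ltnW.
have mn' : (m < n)%N by [].
by rewrite (insubT (fun m => m < n)%N mn') ffunE /= -mulgA mulKVg.
Qed.

Lemma eq_dehomogenize n (H H' : seq G -> k) :
  (forall x, size x = n.+1 -> H x = H' x) -> dehomogenize n H = dehomogenize n H'.
Proof. by move=> HH; apply/funext => g; apply: HH; rewrite size_mkseq. Qed.

Lemma homogenize_cocycle n (F : cochain k G n) : bar_diff F = 0 ->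
  hcocycle (fun=> True) (fun=> 1) n (homogenize F).
Proof.
move=> dF; split; first exact: homogenize_equivariant.
by move=> x xn; rewrite -homogenize_bar// dF.
Qed.

Lemma dehomogenize_cocycle n (H : seq G -> k) :
  hcocycle (fun=> True) (fun=> 1) n H -> bar_diff (dehomogenize n H) = 0.
Proof.
move=> [eH dH]; rewrite -[LHS]homogenizeK.
rewrite (eq_dehomogenize (H' := fun=> 0))// => x xn.
rewrite homogenize_bar//; rewrite -[RHS](dH x xn).
by apply: eq_hdiff xn => y yn; rewrite dehomogenizeK.
Qed.

(** In degree 0 only the zero cochain is a coboundary, which corresponds to the condition on [b
    [::]] in [hcoboundary]. *)
Lemma is_coboundaryE n (F : cochain k G n) :
  is_coboundary F <-> hcoboundary (fun=> True) (fun=> 1) n (homogenize F).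
Proof.
case: n F => [|n] F /=; split.
- move=> ->; exists (fun=> 0); split => // [h x _ _|x xn]; first by rewrite mulr0.
  by rewrite hdiff0.
- move=> [b [_ b0 bE]]; rewrite -[LHS]homogenizeK.
  apply/funext => g; rewrite /dehomogenize /= bE//= b0// subr0.
  by [].
- move=> [b ->]; exists (homogenize b); split => //.
    exact: homogenize_equivariant.
  by move=> x xn; rewrite homogenize_bar.
- move=> [b [eb _ bE]]; exists (dehomogenize n b).
  rewrite -[LHS]homogenizeK -[RHS]homogenizeK; apply: eq_dehomogenize => x xn.
  rewrite bE// homogenize_bar//; apply: eq_hdiff xn => y yn.
  by rewrite dehomogenizeK.
Qed.

End BarComparison.
Arguments dehomogenize {k G} n H g.

Lemma homogenize_pullback (k : fieldType) (G K : groupType)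
    (phi : Multiplicative.type G K) n (F : cochain k K n) x : size x = n.+1 ->
  homogenize (pullback_cochain phi F) x = homogenize F (map phi x).
Proof.
move=> xn; rewrite /homogenize /pullback_cochain; congr F.
have phi1 : phi 1%g = 1%g.
  by apply: (mulgI (phi 1%g)); rewrite -gmulfM !mulg1.
have phiV y : phi y^-1%g = (phi y)^-1%g.
  by apply: (mulgI (phi y)); rewrite -gmulfM !mulgV.
apply/ffunP => i; rewrite !ffunE gmulfM phiV.
by rewrite !(nth_map 1%g) ?xn//; have := ltn_ord i; lia.
Qed.

(** * Specht modules of hooks *)

Section Hook.
Context (k : fieldType) (r n : nat).
Hypothesis k0 : [pchar k] =i pred0.
(** Exactly the condition for [la] to be a partition; [r = 0] then occurs only for [s = 0]. *)
Hypothesis rn : (0 < r)%N \/ n = 0%N.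

Local Notation s := (r + n)%N.
Local Notation S := 'S_s.
Local Notation la := (r :: nseq n 1%N).
Local Notation col := (@rshift r n).
Local Notation row := (@lshift r n).
Local Notation act := (@group_algebra_act k s).

Let nat0 m : (m%:R == 0 :> k) = (m == 0%N).
Proof. by move/pcharf0P: k0; apply. Qed.

Lemma find_scanl_subn m N : (m < N)%N ->
  find (pred1 0%N) (scanl subn m.+1 (nseq N 1%N)) = m.
Proof.
elim: m N => [|m IH] [|N]//= mN.
by rewrite subn1 /= IH.
Qed.

Lemma reshape_index_row (a : 'I_r) : reshape_index la (row a) = 0%N.
Proof. by rewrite /reshape_index /=; have := ltn_ord a; rewrite -subn_eq0 => ->. Qed.

Lemma reshape_index_col (m : 'I_n) : reshape_index la (col m) = m.+1.
Proof.
rewrite /reshape_index /= -addnS addKn /=; congr _.+1.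
exact: find_scanl_subn.
Qed.

Lemma reshape_offset_row (a : 'I_r) : reshape_offset la (row a) = a.
Proof. by rewrite /reshape_offset reshape_index_row take0 subn0. Qed.

Lemma reshape_offset_col (m : 'I_n) : reshape_offset la (col m) = 0%N.
Proof.
rewrite /reshape_offset reshape_index_col /= take_nseq ?(ltnW (ltn_ord m))//.
by rewrite sumn_nseq mul1n subnn.
Qed.

Lemma row_groupP (p : S) : reflect (forall m, p (col m) = col m) (p \in row_group s la).
Proof.
rewrite inE; apply: (iffP forallP) => [h m|h a].
  have /eqP := h (col m); rewrite reshape_index_col.
  case: (split_ordP (p (col m))) => [a ->|m' ->].
    by rewrite reshape_index_row.
  by rewrite reshape_index_col => -[/val_inj ->].
case: (split_ordP a) => [b ->|m ->]; last by rewrite h.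
case: (split_ordP (p (row b))) => [b' ->|m' e]; first by rewrite !reshape_index_row.
have /perm_inj/eqP : p (row b) = p (col m') by rewrite e h.
by rewrite eq_lrshift.
Qed.

Lemma col_groupP (q : S) :
  reflect (forall a : 'I_r, (0 < a)%N -> q (row a) = row a) (q \in col_group s la).
Proof.
rewrite inE; apply: (iffP forallP) => [h a a0|h b].
  have /eqP := h (row a); rewrite reshape_offset_row.
  case: (split_ordP (q (row a))) => [a' ->|m ->].
    by rewrite reshape_offset_row => /val_inj ->.
  by rewrite reshape_offset_col => a00; rewrite -a00 in a0.
suff aux (c : 'I_s) : reshape_offset la c = 0%N -> reshape_offset la (q c) = 0%N.
  case: (split_ordP b) => [a ->|m ->]; last by rewrite aux reshape_offset_col.
  have [a0|a0] := posnP a; last by rewrite h.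
  by rewrite aux reshape_offset_row a0.
case: (split_ordP (q c)) => [a e|m -> _]; last by rewrite reshape_offset_col.
have [a0|a0] := posnP a; first by rewrite e reshape_offset_row a0.
have /perm_inj -> : q c = q (row a) by rewrite e h.
by rewrite reshape_offset_row => a00; rewrite a00 in a0.
Qed.

Local Notation Rg := (row_group s la).
Local Notation Cg := (col_group s la).

Lemma row_groupM p p' : p \in Rg -> p' \in Rg -> (p * p')%g \in Rg.
Proof. by move=> /row_groupP h /row_groupP h'; apply/row_groupP => m; rewrite permM h h'. Qed.

Lemma row_groupV p : p \in Rg -> (p^-1)%g \in Rg.
Proof. by move=> /row_groupP h; apply/row_groupP => m; rewrite -{1}(h m) permK. Qed.

Lemma row_group1 : 1%g \in Rg.
Proof. by apply/row_groupP => m; rewrite perm1. Qed.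

Lemma col_groupM q q' : q \in Cg -> q' \in Cg -> (q * q')%g \in Cg.
Proof.
by move=> /col_groupP h /col_groupP h'; apply/col_groupP => a a0; rewrite permM h ?h'.
Qed.

Lemma col_group_tperm (x y : 'I_s) : reshape_offset la x = 0%N -> reshape_offset la y = 0%N ->
  tperm x y \in Cg.
Proof.
move=> x0 y0; apply/col_groupP => a a0; rewrite tpermD//.
  by apply: contraTneq a0 => xa; rewrite -reshape_offset_row -xa x0.
by apply: contraTneq a0 => xa; rewrite -reshape_offset_row -xa y0.
Qed.

(** The permutations of the first row enlarged by the leg cell [b]; summing over them is the
    contraction that polytabloids are to satisfy. *)
Definition row_plus (b : 'I_n) : {set S} :=
  [set p : S | [forall m, (m != b) ==> (p (col m) == col m)]].

Lemma row_plusP b (p : S) : reflect (forall m, m != b -> p (col m) = col m) (p \in row_plus b).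
Proof.
rewrite inE; apply: (iffP forallP) => h m; last by apply/implyP => /h ->.
by move=> mb; have /implyP/(_ mb)/eqP := h m.
Qed.

Lemma row_plusM b p p' : p \in row_plus b -> p' \in row_plus b -> (p * p')%g \in row_plus b.
Proof.
by move=> /row_plusP h /row_plusP h'; apply/row_plusP => m mb; rewrite permM h ?h'.
Qed.

Lemma row_plusV b p : p \in row_plus b -> (p^-1)%g \in row_plus b.
Proof. by move=> /row_plusP h; apply/row_plusP => m mb; rewrite -{1}(h m mb) permK. Qed.

Lemma sub_row_plus b p : p \in Rg -> p \in row_plus b.
Proof. by move=> /row_groupP h; apply/row_plusP => m _; exact: h. Qed.

(* As [p * tau] is the composite of p followed by tau, this describes v as a
   function of the values of tau on the last n positions: it does not depend on
   the others, is alternating, and its sum over one of its entries vanishes. *)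
Definition hook_fun (v : {ffun S -> k^o}) : Prop :=
  [/\ forall p tau, p \in Rg -> v (p * tau)%g = v tau,
      forall a b tau, a != b -> v (tperm (col a) (col b) * tau)%g = - v tau &
      forall b tau, \sum_(p in row_plus b) v (p * tau)%g = 0].

Local Notation e := (@polytabloid k s la).

Lemma polytabloidE tau :
  e tau = \sum_(q in Cg) \sum_(p in Rg | (p * q)%g == tau) (-1) ^+ odd_perm q.
Proof. by rewrite ffunE. Qed.

Lemma hook_fun_lin a u v : hook_fun u -> hook_fun v -> hook_fun (a *: u + v).
Proof.
move=> [u1 u2 u3] [v1 v2 v3]; split.
- by move=> p tau pR; rewrite !ffunE u1// v1.
- by move=> i j tau ij; rewrite !ffunE u2// v2// scalerN opprD.
- move=> b tau; under eq_bigr => p _ do rewrite !ffunE.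
  by rewrite big_split /= -scaler_sumr u3 v3 scaler0 addr0.
Qed.

Lemma hook_fun_act sigma v : hook_fun v -> hook_fun (act sigma v).
Proof.
move=> [v1 v2 v3]; split.
- by move=> p tau pR; rewrite !ffunE -mulgA v1.
- by move=> i j tau ij; rewrite !ffunE -mulgA v2.
- by move=> b tau; under eq_bigr => p _ do rewrite !ffunE -mulgA; exact: v3.
Qed.

Lemma hook_fun_polytabloid : hook_fun e.
Proof.
split.
- move=> p tau pR; rewrite !polytabloidE; apply: eq_bigr => q _.
  rewrite (reindex_onto (mulg p) (mulg p^-1%g)) /=; last by move=> p' _; rewrite mulKVg.
  apply: eq_bigl => p'; rewrite mulKg eqxx andbT -mulgA (inj_eq (mulgI p)).
  congr (_ && _); apply/idP/idP => [h|]; last exact: row_groupM.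
  by rewrite -[p'](mulKg p); apply: row_groupM => //; exact: row_groupV.
- move=> a b tau ab; set t := tperm _ _; rewrite !polytabloidE -sumrN.
  have tC : t \in Cg by apply: col_group_tperm; exact: reshape_offset_col.
  have tt : (t * t)%g = 1%g by exact: tperm2.
  rewrite (reindex_onto (mulg t) (mulg t)) /=; last by move=> q _; rewrite mulgA tt mul1g.
  apply: eq_big => [q|q /andP[tq _]].
    rewrite mulgA tt mul1g eqxx andbT; apply/idP/idP => [h|]; last exact: col_groupM.
    by rewrite -[q]mul1g -tt -mulgA; exact: col_groupM.
  rewrite -sumrN; apply: eq_big => [p|p _].
    case pR : (p \in Rg) => //=.
    (* The transposition moves two leg cells only, and the row group fixes all leg cells. *)
    suff pt : (p * t = t * p)%g by rewrite mulgA pt -mulgA (inj_eq (mulgI t)).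
    apply/permP => i; rewrite !permM.
    have /row_groupP h := pR.
    case: (split_ordP i) => [x ->|m ->].
      rewrite (tpermD (z := row x)) ?eq_rlshift//.
      case: (split_ordP (p (row x))) => [y ->|m e1].
        by rewrite tpermD ?eq_rlshift.
      have /perm_inj/eqP : p (row x) = p (col m) by rewrite e1 h.
      by rewrite eq_lrshift.
    by rewrite h /t; case: tpermP => //= _; rewrite h.
  rewrite odd_permM odd_tperm (inj_eq (@rshift_inj _ _)) ab /=.
  by case: (odd_perm q); rewrite /= ?expr1 ?expr0 ?opprK.
- move=> b tau.
  have r0 : (0 < r)%N by case: rn => // n0; have := ltn_ord b; rewrite {2}n0.
  (* Exchanging the corner with [b] lies both in the column group and in [row_plus b]. It preserves
     the range of summation and reverses the signs, so the sum [Z] equals its negative. *)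
  pose t := tperm (row (Ordinal r0)) (col b).
  have tC : t \in Cg.
    apply: col_group_tperm; last exact: reshape_offset_col.
    by rewrite reshape_offset_row.
  have tP : t \in row_plus b.
    apply/row_plusP => m mb; rewrite tpermD ?eq_lrshift//.
    by rewrite (inj_eq (@rshift_inj _ _)) eq_sym.
  have tt : (t * t)%g = 1%g by exact: tperm2.
  pose Z := \sum_(q in Cg) if (q * tau^-1)%g \in row_plus b then (-1) ^+ odd_perm q else 0 : k.
  have -> : \sum_(p in row_plus b) e (p * tau)%g = #|Rg|%:R * Z.
    under eq_bigr => p _ do rewrite polytabloidE.
    rewrite exchange_big /= mulr_sumr; apply: eq_bigr => q qC.
    under eq_bigr => p _ do rewrite big_mkcondr /=.
    rewrite exchange_big /= mulr_natl -sumr_const; apply: eq_bigr => p' pR.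
    rewrite -big_mkcondr /=.
    case: ifP => qt.
      rewrite (big_pred1 (p' * q * tau^-1)%g) // => p; rewrite /= andbC.
      apply/andP/eqP => [[/eqP e1 _]|->]; first by rewrite e1 mulgK.
      rewrite mulgKV eqxx; split => //; rewrite -mulgA; apply: row_plusM => //.
      exact: sub_row_plus.
    rewrite big_pred0// => p; apply/negbTE/negP => /andP[pP /eqP e1].
    move/negP: qt; apply; rewrite -[q](mulKg p') e1 -!mulgA mulgV mulg1.
    by apply: row_plusM => //; apply: row_plusV; exact: sub_row_plus.
  have ZN : Z = - Z.
    rewrite {1}/Z (reindex_onto (mulg t) (mulg t)) /=; last by move=> q _; rewrite mulgA tt mul1g.
    rewrite -sumrN; apply: eq_big => [q|q /andP[tq _]].
      rewrite mulgA tt mul1g eqxx andbT; apply/idP/idP => [h|]; last exact: col_groupM.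
      by rewrite -[q]mul1g -tt -mulgA; exact: col_groupM.
    have -> : ((t * q * tau^-1)%g \in row_plus b) = ((q * tau^-1)%g \in row_plus b).
      rewrite -mulgA; apply/idP/idP => [h|]; last exact: row_plusM.
      by rewrite -[(q * _)%g]mul1g -tt -mulgA; exact: row_plusM.
    case: ifP => _; last by rewrite oppr0.
    rewrite odd_permM odd_tperm eq_lrshift /=.
    by case: (odd_perm q); rewrite /= ?expr1 ?expr0 ?opprK.
  suff -> : Z = 0 by rewrite mulr0.
  have : 2 * Z = 0 by rewrite mulr_natl mulr2n {1}ZN addNr.
  by move/eqP; rewrite mulf_eq0 nat0 /= => /eqP.
Qed.

End Hook.

(** Both lists are completed to enumerations of [T], which are then matched position by position. *)
Lemma perm_map_seq (T : finType) (A B : seq T) : uniq A -> uniq B ->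
  size A = size B -> exists sigma : {perm T}, map sigma A = B.
Proof.
move=> uA uB AB; pose cmp (C : seq T) := C ++ [seq x <- enum T | x \notin C].
have cmpU C : uniq C -> uniq (cmp C).
  move=> uC; rewrite cat_uniq uC filter_uniq ?enum_uniq// andbT /=.
  by apply/hasPn => x; rewrite mem_filter => /andP[].
have cmpT C x : x \in cmp C by rewrite mem_cat mem_filter mem_enum; case: (x \in C).
have cmpS C : uniq C -> size (cmp C) = #|T|.
  move=> /cmpU uC; rewrite cardT; apply/perm_size/uniq_perm => //.
    exact: enum_uniq.
  by move=> x; rewrite cmpT mem_enum.
have [[x0 _]|noT] := pselect (exists x : T, True); last first.
  exists 1%g; case: A B uA uB AB => [|x A] [|y B]//= _ _ _.
  by exfalso; apply: noT; exists x.
pose f x := nth x0 (cmp B) (index x (cmp A)).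
have iA x : (index x (cmp A) < size (cmp B))%N.
  by rewrite cmpS// -(cmpS A)// index_mem.
have fI : injective f.
  move=> x y /eqP; rewrite nth_uniq// ?cmpU// => /eqP h.
  by rewrite -(nth_index x0 (cmpT A x)) h nth_index.
exists (perm fI); apply: (@eq_from_nth _ x0); rewrite size_map// => i iAs.
rewrite (nth_map x0)// permE /f index_cat mem_nth// index_uniq//.
by rewrite nth_cat -AB iAs.
Qed.

(** * Pairings of alternating functions with products over the leg *)

Section HookSums.
Context (k : fieldType) (r n : nat).
Hypothesis k0 : [pchar k] =i pred0.

Local Notation s := (r + n)%N.
Local Notation S := 'S_s.
Local Notation la := (r :: nseq n 1%N).
Local Notation col := (@rshift r n).
Local Notation row := (@lshift r n).
Local Notation Rg := (row_group s la).
Local Notation Cg := (col_group s la).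
Local Notation e := (@polytabloid k s la).

Let nat0 m : (m%:R == 0 :> k) = (m == 0%N).
Proof. by move/pcharf0P: k0; apply. Qed.

Context (v : {ffun S -> k^o}) (vh : hook_fun v).

Lemma hook_fun_col_perm (pi : 'S_n) : exists rho : S,
  (forall a, rho (col a) = col (pi a)) /\
  forall tau, v (rho * tau)%g = (-1) ^+ odd_perm pi * v tau.
Proof.
have [_ v2 _] := vh; have [ts -> ds] := prod_tpermP pi.
elim: ts ds => [_|t ts IH /= /andP[dt /IH[rho [rE rv]]]].
  exists 1%g; rewrite big_nil; split => [a|tau]; first by rewrite !perm1.
  by rewrite mul1g odd_perm1 expr0 mul1r.
exists (tperm (col t.1) (col t.2) * rho)%g; rewrite big_cons; split => [a|tau].
  rewrite !permM -rE; congr (rho _); rewrite !permE /=.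
  by rewrite !(inj_eq (@rshift_inj _ _)); case: ifP => // _; case: ifP.
rewrite -mulgA v2; last exact: dt.
rewrite rv odd_permM odd_tperm (_ : _ != _ = true) //= -mulNr.
by case: odd_perm => /=; rewrite ?expr1 ?expr0 ?opprK.
Qed.

(** A function of the values of [tau] on the leg is a tensor with [n] slots; this contracts [v] with
    the pure tensor of the [w a]. *)
Definition hook_sum (w : 'I_n -> 'I_s -> k) : k :=
  \sum_(tau : S) v tau * \prod_a w a (tau (col a)).

(** As [v] is alternating in the leg entries, the n! terms of the determinant contribute equally. *)
Lemma hook_sum_det (w : 'I_n -> 'I_s -> k) :
  \sum_(tau : S) v tau * \det (\matrix_(a, b) w a (tau (col b))) =
  (n`!)%:R * hook_sum w.
Proof.
under eq_bigr => tau _ do rewrite mulr_sumr.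
rewrite exchange_big /=; transitivity (\sum_(pi : 'S_n) hook_sum w); last first.
  by rewrite sumr_const card_Sn mulr_natl.
apply: eq_bigr => pi _; have [rho [rE rv]] := hook_fun_col_perm pi.
rewrite /hook_sum [RHS](reindex_inj (mulgI rho)) /=; apply: eq_bigr => tau _.
rewrite rv -mulrA mulrCA; congr (_ * (_ * _)).
by apply: eq_bigr => a _; rewrite mxE permM rE.
Qed.

(** A product whose factor at [b] is constant does not change under [row_plus b], so [v] may be
    replaced by its sums over this group, which vanish. *)
Lemma hook_sum_cst (b : 'I_n) (w : 'I_n -> 'I_s -> k) :
  (forall i j, w b i = w b j) -> hook_sum w = 0.
Proof.
have [_ _ v3] := vh; move=> wb.
have P0 : (#|row_plus r b|%:R : k) != 0.
  rewrite nat0 -lt0n; apply/card_gt0P; exists 1%g.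
  by apply/row_plusP => m _; rewrite perm1.
apply: (mulfI P0); rewrite mulr0 mulr_natl -sumr_const.
transitivity (\sum_(p in row_plus r b) \sum_(tau : S)
    v (p * tau)%g * \prod_a w a (tau (col a))).
  apply: eq_bigr => p /row_plusP pP; rewrite /hook_sum (reindex_inj (mulgI p)) /=.
  apply: eq_bigr => tau _; congr (_ * _); apply: eq_bigr => a _; rewrite permM.
  by have [->|ab] := eqVneq a b; [exact: wb|rewrite pP].
rewrite exchange_big /= big1// => tau _.
by rewrite -mulr_suml v3 mul0r.
Qed.

(* The contraction relation of [hook_fun] kills any factor independent of its
   entry. *)
Lemma hook_sum_shift (w : 'I_n -> 'I_s -> k) (ga : 'I_n -> k) :
  hook_sum (fun a j => w a j - ga a) = hook_sum w.
Proof.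
(* The constants are subtracted one factor at a time: [wm m] is shifted in its first [m] factors,
   and consecutive pairings differ by one with a constant factor. *)
pose wm m := fun (a : 'I_n) j => w a j - (if (a < m)%N then ga a else 0).
have -> : hook_sum (fun a j => w a j - ga a) = hook_sum (wm n).
  by apply: eq_bigr => tau _; congr (_ * _); apply: eq_bigr => a _; rewrite /wm ltn_ord.
have : (n <= n)%N by [].
elim: {-2}n => [_|m IH mn].
  by apply: eq_bigr => tau _; congr (_ * _); apply: eq_bigr => a _; rewrite /wm subr0.
rewrite -IH; last exact: ltnW.
pose b := Ordinal mn.
pose u := fun (a : 'I_n) j => if a == b then ga b else wm m a j.
have u0 : hook_sum u = 0 by apply: (@hook_sum_cst b) => i j; rewrite /u eqxx.
apply/eqP; rewrite -subr_eq0 -oppr0 -[in X in _ == - X]u0 /hook_sum -sumrB -sumrN.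
apply/eqP; apply: eq_bigr => tau _; rewrite -mulrBr -mulrN; congr (_ * _).
rewrite (bigD1 b)//= [X in _ - X](bigD1 b)//= [in RHS](bigD1 b)//=.
rewrite {1 3}/wm /= ltnSn ltnn subr0 {1}/u eqxx.
have -> : \prod_(i < n | i != b) wm m.+1 i (tau (col i)) =
    \prod_(i < n | i != b) wm m i (tau (col i)).
  apply: eq_bigr => a ab; rewrite /wm ltnS leq_eqVlt.
  by rewrite -[_ == m]/(a == b) (negbTE ab).
have -> : \prod_(i < n | i != b) u i (tau (col i)) =
    \prod_(i < n | i != b) wm m i (tau (col i)).
  by apply: eq_bigr => a /negbTE ab; rewrite /u ab.
ring.
Qed.

(** The delta functions select the permutations agreeing with [tau0] on the leg, that is, a coset of
    the row group, on which [v] is constant. *)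
Lemma hook_sum_delta (tau0 : S) :
  hook_sum (fun a j => (j == tau0 (col a))%:R) = #|Rg|%:R * v tau0.
Proof.
have [v1 _ _] := vh.
rewrite /hook_sum (reindex_inj (mulIg tau0)) /=.
rewrite (bigID (mem Rg)) /= [X in _ + X]big1 ?addr0.
  rewrite mulr_natl -sumr_const; apply: eq_bigr => p pR; rewrite v1//.
  rewrite big1 ?mulr1// => a _; have /row_groupP h := pR.
  by rewrite permM h eqxx.
move=> p pR; rewrite [X in _ * X](_ : _ = 0) ?mulr0//; apply/eqP.
rewrite prodf_seq_eq0; apply/hasP.
have [a pa] : exists a, p (col a) != col a.
  apply/existsP; apply: contraNT pR; rewrite negb_exists => /forallP h.
  by apply/row_groupP => m; apply/eqP; have := h m; rewrite negbK.
exists a; first exact: mem_index_enum.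
by rewrite permM (inj_eq perm_inj) (negbTE pa) eqxx.
Qed.

End HookSums.

Section PolytabloidValues.
Context (k : fieldType) (r n : nat) (rn : (0 < r)%N \/ n = 0%N).

Local Notation s := (r + n)%N.
Local Notation S := 'S_s.
Local Notation la := (r :: nseq n 1%N).
Local Notation col := (@rshift r n).
Local Notation row := (@lshift r n).
Local Notation Rg := (row_group s la).
Local Notation Cg := (col_group s la).
Local Notation e := (@polytabloid k s la).

Lemma col_group_fix0 (q : S) : q \in Cg -> (forall i : 'I_s, i = 0%N :> nat -> q i = i) ->
  forall a : 'I_r, q (row a) = row a.
Proof. by move=> /col_groupP qC q0 a; have [a0|/qC//] := posnP a; exact: q0. Qed.

(** The row permutation [p], applied first, keeps the corner in the first row, where [q] can move
    only the corner itself. *)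
Lemma factor_fix0 (p q : S) : p \in Rg -> q \in Cg ->
  (forall i : 'I_s, i = 0%N :> nat -> (p * q)%g i = i) ->
  forall i : 'I_s, i = 0%N :> nat -> q i = i.
Proof.
move=> /row_groupP pR /col_groupP qC pq i i0.
have := pq i i0; rewrite permM.
case: (split_ordP i) i0 => [a ia a0|m ->]; last first.
  rewrite /= => /eqP; rewrite addn_eq0 => /andP[/eqP r0 _].
  exfalso; have mn := ltn_ord m; case: rn => [|n0]; last by rewrite [in X in (_ < X)%N]n0 in mn.
  by rewrite r0.
case: (split_ordP (p i)) => [b e1|m e1]; last first.
  have /perm_inj im : p i = p (col m) by rewrite e1 pR.
  by move/eqP: im; rewrite ia eq_lrshift.
rewrite e1; have [b0|b0] := posnP b; last first.
  by rewrite qC// => bi; rewrite -bi /= in a0; rewrite a0 in b0.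
by rewrite (_ : row b = i) //; apply: val_inj; rewrite /= b0 a0.
Qed.

(** In a factorisation of [tau] into a row and a column permutation, the latter fixes the corner by
    [factor_fix0], hence the whole first row, and so preserves the leg. This yields the
    orthogonality used in [cup_sum_surj]. *)
Lemma polytabloid_col (tau : S) : (forall i : 'I_s, i = 0%N :> nat -> tau i = i) ->
  e tau != 0 -> forall b, exists b', tau (col b) = col b'.
Proof.
move=> tau0; rewrite polytabloidE => eN0 b.
have [q qC [p pR pq]] : exists2 q, q \in Cg & exists2 p, p \in Rg & (p * q)%g = tau.
  apply: contrapT => no; move/eqP: eN0; apply; rewrite big1// => q qC.
  rewrite big_pred0// => p; apply/negbTE/negP => /andP[pR /eqP pq].
  by apply: no; exists q => //; exists p.
rewrite -pq in tau0.
have qrow := col_group_fix0 qC (factor_fix0 pR qC tau0).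
rewrite -pq permM; have /row_groupP -> := pR.
case: (split_ordP (q (col b))) => [a e1|m ->]; last by exists m.
by have /perm_inj/eqP : q (col b) = q (row a); [rewrite e1 qrow|rewrite eq_rlshift].
Qed.

Lemma polytabloid1 : e 1%g = 1.
Proof.
have C1 : 1%g \in Cg by apply/col_groupP => a _; rewrite perm1.
rewrite polytabloidE (bigD1 1%g)//= [X in _ + X]big1 ?addr0.
  rewrite (big_pred1 1%g) ?odd_perm1// => p; rewrite /= mulg1.
  by case: eqP => [->|_]; rewrite ?andbF// row_group1.
move=> q /andP[qC q1]; rewrite big_pred0// => p; apply/negbTE/negP => /andP[pR /eqP pq].
have tau0 (i : 'I_s) : i = 0%N :> nat -> (p * q)%g i = i by rewrite pq perm1.
have qrow := col_group_fix0 qC (factor_fix0 pR qC tau0).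
case/eqP: q1; apply/permP => i; rewrite perm1.
case: (split_ordP i) => [a ->//|m ->].
have /row_groupP pm := pR.
by rewrite -{1}[col m]pm -permM pq perm1.
Qed.

End PolytabloidValues.

(** * The isomorphism *)

Lemma hcoboundary_ext (k : fieldType) (G : groupType) (H : G -> Prop) (mu : G -> k) n F F' :
  (forall x, size x = n.+1 -> F x = F' x) ->
  hcoboundary H mu n F -> hcoboundary H mu n F'.
Proof.
by move=> FF' [b [be b0 bE]]; exists b; split => // x xn; rewrite -FF'// bE.
Qed.

Lemma detect_map (k : fieldType) (G : groupType) (phi : G -> G) ls (F : seq G -> k) :
  {morph phi : g h / (g * h)%g} ->
  detect ls (F \o map phi) = detect (map phi ls) F.
Proof.
move=> phiM.
have phi1 : phi 1%g = 1%g by apply: (mulgI (phi 1%g)); rewrite -phiM !mulg1.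
elim: ls F => [|l ls IH] F /=; first by rewrite phi1.
rewrite -IH; apply: eq_detect => x _ /=.
elim: x F => //= y x IHx F.
rewrite phiM -!map_comp; congr (F (_ :: _ :: _) - _).
  by apply: eq_map => z /=; rewrite phiM.
exact: (IHx (fun z => F (phi y :: z))).
Qed.

(** The n-element subsets of the positive indices are the legs of the standard hook tableaux; [sg q]
    sends the leg onto the q-th subset, so the last condition says that the subsets of [q] and [q']
    coincide. *)
Lemma exists_subset_perms (r n : nat) : (0 < r)%N \/ n = 0%N ->
  exists sg : 'I_('C((r + n).-1, n)) -> 'S_(r + n),
    (forall q (i : 'I_(r + n)), i = 0%N :> nat -> sg q i = i) /\
    forall q q', (forall b, exists b', (sg q' * (sg q)^-1)%g (rshift r b) = rshift r b') ->
      q = q'.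
Proof.
move=> rn; set s := (r + n)%N.
(* This is the list of the single index 0, or the empty list when [s = 0]. *)
pose Z := [seq i : 'I_s <- enum 'I_s | i == 0%N :> nat].
pose DS := [set A : {set 'I_s} | A \subset [set i : 'I_s | (0 < i)%N]%SET & #|A| == n]%SET.
have cardDS : 'C(s.-1, n) = #|DS|.
  rewrite cards_draws; congr 'C(_, _); rewrite cardsE.
  case: (s) => [|s']; first by apply/esym/eq_card0 => -[].
  transitivity #|predC1 (ord0 : 'I_s'.+1)|; first by rewrite cardC1 card_ord.
  by apply: eq_card => i; rewrite !inE -lt0n.
pose K q := enum_val (cast_ord cardDS q).
have KD q : K q \in DS by exact: enum_valP.
have uZ : uniq Z by rewrite filter_uniq// enum_uniq.
pose cols := [seq rshift r m | m <- enum 'I_n] : seq 'I_s.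
have colpos (m : 'I_n) : (0 < (rshift r m : 'I_s))%N.
  case: rn => [r0|n0]; first by rewrite /= addn_gt0 r0.
  by exfalso; have mn := ltn_ord m; rewrite [in X in (_ < X)%N]n0 in mn.
have ex q : exists sigma : 'S_s, map sigma (Z ++ cols) = Z ++ enum (K q).
  have := KD q; rewrite inE => /andP[/fintype.subsetP Kpos /eqP cK].
  apply: perm_map_seq.
  - rewrite cat_uniq uZ /= map_inj_uniq ?enum_uniq ?andbT//; last exact: rshift_inj.
    apply/hasPn => _ /mapP[m _ ->]; rewrite mem_filter negb_and.
    by rewrite -lt0n colpos.
  - rewrite cat_uniq uZ enum_uniq andbT /=.
    apply/hasPn => i; rewrite mem_enum => /Kpos; rewrite inE => i0.
    by rewrite mem_filter negb_and -lt0n i0.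
  - by rewrite !size_cat size_map size_enum_ord -cardE cK.
have [sg sgP] := choice ex.
have sgZ q : map (sg q) Z = Z /\ map (sg q) cols = enum (K q).
  have /eqP := sgP q; rewrite map_cat eqseq_cat ?size_map// => /andP[/eqP -> /eqP ->].
  by [].
have sgK q b : sg q (rshift r b) \in K q.
  rewrite -mem_enum; have [_ <-] := sgZ q.
  by rewrite map_f// map_f// mem_enum.
exists sg; split => [q i i0|q q' h].
  have iZ : i \in Z by rewrite mem_filter i0 eqxx mem_enum.
  have [h _] := sgZ q.
  have : sg q i \in Z by rewrite -h map_f.
  rewrite mem_filter => /andP[/eqP j0 _].
  by apply: val_inj; rewrite /= j0 i0.
have sub : K q' \subset K q.
  apply/fintype.subsetP => i; rewrite -mem_enum; have [_ <-] := sgZ q'.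
  move=> /mapP[_ /mapP[b _ ->] ->].
  have [b' e] := h b.
  have -> : sg q' (rshift r b) = sg q (rshift r b') by rewrite -e permM permKV.
  exact: sgK.
have /eqP KK : K q' == K q.
  rewrite eqEcard sub; have := KD q; have := KD q'; rewrite !inE.
  by move=> /andP[_ /eqP ->] /andP[_ /eqP ->]; rewrite leqnn.
by have /enum_val_inj/cast_ord_inj := KK.
Qed.

Section HookCohomology.
Context (k : fieldType) (k0 : [pchar k] =i pred0) (G : groupType) (r n : nat).
Hypotheses (rn : (0 < r)%N \/ n = 0%N) (n_even : odd n = false).

Local Notation s := (r + n)%N.
Local Notation S := 'S_s.
Local Notation la := (r :: nseq n 1%N).
Local Notation col := (@rshift r n).
Local Notation Rg := (row_group s la).
Local Notation e := (@polytabloid k s la).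
Local Notation act := (@group_algebra_act k s).

Context (eps : G -> bool) (c : 'I_s -> G -> int).
Hypothesis epsM : forall g h, eps (g * h)%g = eps g (+) eps h.
Hypothesis cM : forall i g h, c i (g * h)%g = c i g + (-1) ^+ eps g * c i h.
Hypothesis c0 : forall (i : 'I_s) g, i = 0%N :> nat -> c i g = 0.
Hypothesis c_inj : forall g h, eps g = eps h -> (forall i, c i g = c i h) -> g = h.
Hypothesis c_surj : forall (o : bool) (a : 'I_s -> int),
  (forall i : 'I_s, i = 0%N :> nat -> a i = 0) ->
  exists g, eps g = o /\ forall i, c i g = a i.

Let nat0 m : (m%:R == 0 :> k) = (m == 0%N).
Proof. by move/pcharf0P: k0; apply. Qed.

Let translation g := eps g = false.

Let translation_comm g h : translation g -> translation h -> (g * h)%g = (h * g)%g.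
Proof.
move=> tg th; apply: c_inj; first by rewrite !epsM addbC.
by move=> i; rewrite !cM tg th expr0 !mul1r addrC.
Qed.

Definition cup_sum (v : {ffun S -> k^o}) (x : seq G) : k :=
  \sum_(tau : S) (v tau : k) * cup k c [seq tau (col m) | m <- enum 'I_n] x.

Local Notation cocycle := (hcocycle (fun _ : G => True) (fun=> 1 : k) n).
Local Notation coboundary := (hcoboundary (fun _ : G => True) (fun=> 1 : k) n).

Lemma cup_sum_cocycle v : cocycle (cup_sum v).
Proof.
apply: (hcocycle_lin (fun tau : S => v tau : k)) => tau.
have sz : size [seq tau (col m) | m <- enum 'I_n] = n by rewrite size_map size_enum_ord.
split => [h x _ xn|x xn].
  rewrite (cup_equivariant k cM) ?sz// mul1r.
  by rewrite -signr_odd oddM n_even andbF expr0 mul1r.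
by rewrite hdiff_cup// sz.
Qed.

Lemma cup_sum_lin a u v x : cup_sum (a *: u + v) x = a * cup_sum u x + cup_sum v x.
Proof.
rewrite /cup_sum mulr_sumr -big_split; apply: eq_bigr => tau _ /=.
by rewrite !ffunE mulrDl mulrA.
Qed.

Lemma detect_cup_sum v (ls : 'I_n -> G) : hook_fun v -> (forall a, eps (ls a) = false) ->
  detect [seq ls a | a <- enum 'I_n] (cup_sum v) =
  (n`!)%:R * hook_sum v (fun a j => (c j (ls a))%:~R).
Proof.
move=> vh els; rewrite detect_sum -hook_sum_det//; apply: eq_bigr => tau _.
by rewrite (detect_cup k cM).
Qed.

(** The displacements form the delta function at [tau0 (col a)], normalised to vanish at the index 0
    as all displacements do. The normalising constant is absorbed by [hook_sum_shift]. *)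
Definition dual_class (tau0 : S) (a : 'I_n) : G :=
  xget 1%g [set g | eps g = false /\ forall j, c j g =
     (j == tau0 (col a) : nat)%:Z - (first_index j == tau0 (col a) : nat)%:Z]%classic.

Lemma dual_classP tau0 a : eps (dual_class tau0 a) = false /\
  forall j, c j (dual_class tau0 a) =
     (j == tau0 (col a) : nat)%:Z - (first_index j == tau0 (col a) : nat)%:Z.
Proof.
rewrite /dual_class; case: xgetP => [g _ //|no].
have [|g [eg cg]] := c_surj false (a := fun j =>
    (j == tau0 (col a) : nat)%:Z - (first_index j == tau0 (col a) : nat)%:Z).
  move=> j j0; rewrite (_ : first_index j = j) ?subrr//.
  by apply: val_inj; rewrite /= j0.
by case: (no g).
Qed.

Definition detect_at (tau0 : S) : (seq G -> k) -> k :=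
  detect [seq dual_class tau0 a | a <- enum 'I_n].

(** One factor comes from the terms of a determinant, the other from the coset selected by delta
    functions. *)
Definition hook_norm : k := (n`!)%:R * #|Rg|%:R.

Lemma hook_norm_neq0 : hook_norm != 0.
Proof.
rewrite /hook_norm mulf_neq0// nat0 -lt0n ?fact_gt0//.
by apply/card_gt0P; exists 1%g; exact: row_group1.
Qed.

Lemma detect_at_cup_sum v tau0 : hook_fun v ->
  detect_at tau0 (cup_sum v) = hook_norm * v tau0.
Proof.
move=> vh; rewrite /detect_at detect_cup_sum//; last by move=> a; have [] := dual_classP tau0 a.
rewrite /hook_norm -mulrA -(hook_sum_delta vh); congr (_ * _).
rewrite -(hook_sum_shift k0 vh (fun a j => (j == tau0 (col a))%:R)
  (fun a => (first_index (col a) == tau0 (col a))%:R)).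
apply: eq_bigr => tau _; congr (_ * _); apply: eq_bigr => a _.
have [_ ->] := dual_classP tau0 a.
have -> : first_index (tau (col a)) = first_index (col a) by exact: val_inj.
by rewrite rmorphB.
Qed.

Lemma detect_at_coboundary tau0 F : coboundary F -> detect_at tau0 F = 0.
Proof.
move=> [b [be b0 bE]].
apply: (@detect_coboundary k G translation translation_comm _ _ (fun=> 1)) => //.
- by move=> _ /mapP[a _ ->]; have [] := dual_classP tau0 a.
- rewrite size_map size_enum_ord; exists b; split => // h x _; exact: be.
Qed.

Lemma cup_sum_inj v : hook_fun v -> coboundary (cup_sum v) -> v = 0.
Proof.
move=> vh /detect_at_coboundary vb; apply/ffunP => tau0; rewrite ffunE.
have := vb tau0; rewrite detect_at_cup_sum// => /eqP.
by rewrite mulf_eq0 (negbTE hook_norm_neq0) => /eqP.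
Qed.

Lemma is_partition_hook : is_partition s la.
Proof.
rewrite /is_partition /= sumn_nseq mul1n eqxx andbT.
case: rn => [r0|->//]; case: (n) => //= m; rewrite r0 /=.
by elim: m.
Qed.

Lemma specht_hook_fun v : v \in specht_space k s la -> hook_fun v.
Proof.
rewrite /specht_space is_partition_hook => /coord_span ->.
have h0 : hook_fun (0 : {ffun S -> k^o}).
  split => [p tau _|a b tau _|b tau]; rewrite ?ffunE ?oppr0//.
  by rewrite big1// => p _; rewrite ffunE.
elim/big_ind: _ => // [u w hu hw|i _].
  by rewrite -[u]scale1r; exact: hook_fun_lin.
rewrite -[_ *: _]addr0; apply: hook_fun_lin => //.
rewrite -tnth_nth; set t := (X in tnth X i).
have /mapP[sigma _ ->] := mem_tnth i t; apply: hook_fun_act.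
exact: hook_fun_polytabloid.
Qed.

Lemma act_polytabloid_specht sigma : act sigma e \in specht_space k s la.
Proof.
rewrite /specht_space is_partition_hook; apply: memv_span.
by apply/mapP; exists sigma; rewrite ?mem_enum.
Qed.

(** On the polytabloids moved by [sg], the detectors at the [sg q] form [hook_norm] times the
    identity matrix, so [bounded_span] applies. The second conclusion lets cohomology classes be
    compared through their detected values alone. *)
Lemma cup_sum_surj f : cocycle f ->
  (exists2 v, v \in specht_space k s la & coboundary (fun x => f x - cup_sum v x)) /\
  ((forall tau0, detect_at tau0 f = 0) -> coboundary f).
Proof.
move=> fc; have k2 : (2 : k) != 0 by rewrite nat0.
have [sg [sg0 sgE]] := exists_subset_perms rn.
have bd : bounded (fun _ : G => True) (fun=> 1 : k) n 'C(s.-1, n).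
  have : 'C(s.-1, n) = hook_dim s.-1 n false by rewrite /hook_dim n_even.
  by move=> ->; exact: (bounded_total k2 epsM cM c0 c_inj c_surj).
have eh sigma : hook_fun (act sigma e).
  by apply: hook_fun_act; exact: hook_fun_polytabloid.
have [||q F|q I u F|q q'|a [ab aE]] := @bounded_span k G _ _ n _
    (fun q => cup_sum (act (sg q) e)) (fun q => detect_at (sg q)) hook_norm f bd hook_norm_neq0.
- by move=> q; exact: cup_sum_cocycle.
- exact: fc.
- exact: detect_at_coboundary.
- exact: detect_sum.
- rewrite detect_at_cup_sum// ffunE.
  case: eqP => [->|qq']; first by rewrite mulgV polytabloid1 ?mulr1.
  have [->|ne] := eqVneq (e (sg q * (sg q')^-1)%g) 0; first by rewrite mulr0.
  exfalso; apply: qq'; apply/esym; apply: sgE; apply: (polytabloid_col rn) ne.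
  move=> i i0; rewrite permM sg0//; apply: (canLR (permK _)).
  by rewrite sg0.
have sumE x : \sum_q a q * cup_sum (act (sg q) e) x =
    cup_sum (\sum_q a q *: act (sg q) e) x.
  rewrite /cup_sum; under eq_bigr => q _ do rewrite mulr_sumr.
  rewrite exchange_big /=; apply: eq_bigr => tau _.
  rewrite sum_ffunE mulr_suml; apply: eq_bigr => q _.
  by rewrite [in RHS]ffunE mulrA.
split.
  exists (\sum_q a q *: act (sg q) e).
    by apply: memv_suml => q _; apply: memvZ; exact: act_polytabloid_specht.
  by apply: hcoboundary_ext ab => x _; rewrite sumE.
move=> f0; apply: hcoboundary_ext ab => x _; rewrite big1 ?subr0// => q _.
have /eqP := aE q; rewrite f0 eq_sym mulf_eq0 (negbTE hook_norm_neq0) orbF => /eqP ->.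
by rewrite mul0r.
Qed.

(** The detectors see only translations, where [phi] is known. They separate classes by
    [cup_sum_surj]; the constant displacement at the image of the index 0 disappears by
    [hook_sum_shift], and the sign [eta] because [n] is even. *)
Lemma cup_sum_act (phi : G -> G) (sigma : S) (eta : int) v :
  {morph phi : g h / (g * h)%g} -> eta * eta = 1 ->
  (forall g, eps g = false -> eps (phi g) = false /\
     forall i, c i (phi g) = eta * (c (sigma i) g - c (sigma (first_index i)) g)) ->
  hook_fun v ->
  coboundary (fun x => cup_sum (act sigma v) x - cup_sum v (map phi x)).
Proof.
move=> phiM eta2 phic vh.
have [c1e c1d] := cup_sum_cocycle (act sigma v).
have [c2e c2d] := cup_sum_cocycle v.
have fc : cocycle (fun x => cup_sum (act sigma v) x - cup_sum v (map phi x)).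
  split => [h x _ xn|x xn].
    rewrite c1e// -map_comp (eq_map (g := fun y => (phi h * phi y)%g)); last first.
      by move=> y /=; rewrite phiM.
    rewrite map_comp c2e ?size_map// !mul1r//.
  have := hdiffB (cup_sum (act sigma v)) (cup_sum v \o map phi) x => ->.
  by rewrite c1d// -hdiff_map c2d ?size_map// subrr.
apply: (cup_sum_surj fc).2 => tau0.
rewrite /detect_at; set ls := dual_class tau0.
have els a : eps (ls a) = false by have [] := dual_classP tau0 a.
transitivity (detect [seq ls a | a <- enum 'I_n] (cup_sum (act sigma v)) -
   detect [seq ls a | a <- enum 'I_n] (cup_sum v \o map phi)).
  pose F (o : bool) := if o then cup_sum (act sigma v) else cup_sum v \o map phi.
  pose u (o : bool) : k := if o then 1 else -1.
  have := @detect_sum k G bool [seq ls a | a <- enum 'I_n] u F.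
  rewrite big_bool /u /F mul1r mulN1r => <-; apply: eq_detect => x _.
  by rewrite big_bool mul1r mulN1r.
rewrite detect_map// -map_comp [X in _ - X]detect_cup_sum//; last first.
  by move=> a; have [] := phic _ (els a).
rewrite detect_cup_sum//; last exact: hook_fun_act.
apply/eqP; rewrite subr_eq0; apply/eqP; congr (_ * _).
have -> : hook_sum (act sigma v) (fun a j => (c j (ls a))%:~R) =
    hook_sum v (fun a j => (c (sigma j) (ls a))%:~R).
  rewrite /hook_sum (reindex_inj (mulIg sigma)) /=; apply: eq_bigr => tau _.
  rewrite ffunE mulgK; congr (_ * _); apply: eq_bigr => a _; by rewrite permM.
rewrite -(hook_sum_shift k0 vh _ (fun a => (c (sigma (first_index (col a))) (ls a))%:~R)).
apply: eq_bigr => tau _; congr (_ * _).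
transitivity ((eta%:~R : k) ^+ n * \prod_a ((c (sigma (tau (col a))) (ls a))%:~R -
    (c (sigma (first_index (col a))) (ls a))%:~R)).
  have etan : (eta%:~R : k) ^+ n = 1.
    have -> : n = (n./2 * 2)%N by rewrite muln2 -[LHS]odd_double_half n_even.
    by rewrite mulnC exprM expr2 -intrM eta2 expr1n.
  by rewrite etan mul1r.
rewrite -[X in _ ^+ X](card_ord n) -prodr_const -big_split; apply: eq_bigr => a _ /=.
have [_ ->] := phic _ (els a).
have -> : first_index (tau (col a)) = first_index (col a) by exact: val_inj.
by rewrite rmorphM rmorphB.
Qed.

End HookCohomology.

Lemma rep_iso_sym (k : fieldType) (s : nat) (V W : lmodType k)
    (actV : 'S_s -> V -> V) (actW : 'S_s -> W -> W) :
  rep_iso actV actW -> rep_iso actW actV.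
Proof.
move=> [f [[g fK gK] fact]].
have glin : linear g by move=> a u v; apply: (can_inj fK); rewrite linearP !gK.
pose gl : {linear W -> V} := HB.pack g (GRing.isLinear.Build k W V _ g glin).
exists gl; split; first by exists f.
by move=> sigma v /=; apply: (can_inj fK); rewrite fact !gK.
Qed.

Section HookIso.
Context (k : fieldType) (k0 : [pchar k] =i pred0) (G : groupType) (r n : nat).
Hypotheses (rn : (0 < r)%N \/ n = 0%N) (n_even : odd n = false).

Local Notation s := (r + n)%N.
Local Notation S := 'S_s.
Local Notation la := (r :: nseq n 1%N).

Context (eps : G -> bool) (c : 'I_s -> G -> int).
Hypothesis epsM : forall g h, eps (g * h)%g = eps g (+) eps h.
Hypothesis cM : forall i g h, c i (g * h)%g = c i g + (-1) ^+ eps g * c i h.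
Hypothesis c0 : forall (i : 'I_s) g, i = 0%N :> nat -> c i g = 0.
Hypothesis c_inj : forall g h, eps g = eps h -> (forall i, c i g = c i h) -> g = h.
Hypothesis c_surj : forall (o : bool) (a : 'I_s -> int),
  (forall i : 'I_s, i = 0%N :> nat -> a i = 0) ->
  exists g, eps g = o /\ forall i, c i g = a i.
Context (phi : S -> Multiplicative.type G G).
Hypothesis phic : forall sigma, exists eta : int, eta * eta = 1 /\
  forall g, eps g = false -> eps (phi sigma g) = false /\
    forall i, c i (phi sigma g) = eta * (c (sigma i) g - c (sigma (first_index i)) g).

Lemma cup_cocycle_subproof (v : {ffun S -> k^o}) :
  dehomogenize n (cup_sum c v) \in @cocycles k G n.
Proof.
rewrite unfold_in; apply/eqP; apply: dehomogenize_cocycle.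
exact: (cup_sum_cocycle n_even cM v).
Qed.

Definition cup_cocycle (v : {ffun S -> k^o}) : cocycle k G n :=
  exist _ (dehomogenize n (cup_sum c v)) (cup_cocycle_subproof v).

Lemma homogenize_cup_cocycle v x : size x = n.+1 ->
  homogenize (val (cup_cocycle v)) x = cup_sum c v x.
Proof.
by move=> xn; apply: dehomogenizeK xn; have [] := cup_sum_cocycle n_even cM v.
Qed.

Local Notation pi_coh := (\pi_(cohomology k G n)%qT).

Lemma cohomologous (z z' : cocycle k G n) : pi_coh z = pi_coh z' <->
  hcoboundary (fun _ : G => True) (fun=> 1 : k) n
    (fun x => homogenize (val z) x - homogenize (val z') x).
Proof.
by split => [/cohomology_eqP/is_coboundaryE//|h]; apply/cohomology_eqP/is_coboundaryE.
Qed.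

Definition specht_class (v : specht k s la) : cohomology k G n :=
  pi_coh (cup_cocycle (vsval v)).

Lemma specht_class_linear : linear specht_class.
Proof.
move=> a u v; rewrite /specht_class.
have -> : a *: pi_coh (cup_cocycle (vsval u)) = pi_coh (a *: cup_cocycle (vsval u)).
  exact: cohomology_scaleE.
have piD (z z' : cocycle k G n) : pi_coh z + pi_coh z' = pi_coh (z + z').
  by rewrite !piE.
rewrite piD; congr pi_coh; apply: val_inj; apply/funext => g.
rewrite linearP /=; exact: cup_sum_lin.
Qed.

Lemma specht_class_eq0 u v : specht_class u = specht_class v -> u = v.
Proof.
move=> /cohomologous uv; apply: val_inj; apply: subr0_eq.
apply: (cup_sum_inj k0 epsM cM c_inj c_surj).
  by apply: (specht_hook_fun k0 rn); apply: memvB; exact: subvsP.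
apply: hcoboundary_ext uv => x xn; rewrite !homogenize_cup_cocycle//.
rewrite -[\val u - \val v]/(vsval u - vsval v) [vsval u - vsval v]addrC -scaleN1r.
by rewrite cup_sum_lin mulN1r addrC.
Qed.

Lemma specht_class_surj h : exists v, specht_class v = h.
Proof.
elim/quotW: h => z.
have /homogenize_cocycle zc : bar_diff (val z) = 0 by apply/eqP; exact: (valP z).
have [[v vS vE] _] := cup_sum_surj k0 rn n_even epsM cM c0 c_inj c_surj zc.
exists (vsproj _ v); apply/esym/cohomologous.
apply: hcoboundary_ext vE => x xn.
by rewrite homogenize_cup_cocycle// vsprojK.
Qed.

Lemma specht_class_act sigma v :
  specht_class (specht_act sigma v) = pullback (phi sigma) (specht_class v).
Proof.
rewrite /specht_class pullbackE; apply/cohomologous.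
have [eta [eta2 etaE]] := phic sigma.
have vh : hook_fun (vsval v) by apply: (specht_hook_fun k0 rn); exact: subvsP.
have := cup_sum_act k0 rn n_even epsM cM c0 c_inj c_surj
  (@gmulfM _ _ (phi sigma)) eta2 etaE vh.
apply: hcoboundary_ext => x xn; rewrite homogenize_cup_cocycle// specht_actE.
by rewrite homogenize_pullback// homogenize_cup_cocycle ?size_map.
Qed.

Lemma specht_cohomology_iso :
  rep_iso (fun sigma (h : cohomology k G n) => pullback (phi sigma) h)
    (@specht_act k s la).
Proof.
apply: rep_iso_sym.
pose fl : {linear specht k s la -> cohomology k G n} :=
  HB.pack specht_class (GRing.isLinear.Build k (specht k s la) (cohomology k G n) _
    specht_class specht_class_linear).
exists fl; split; last exact: specht_class_act.
have [g gP] := choice specht_class_surj.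
by exists g => v //=; apply: specht_class_eq0; rewrite gP.
Qed.

End HookIso.

Section Vanishing.
Context (k : fieldType) (G : groupType) (n : nat).

Lemma bounded0_cohomology :
  bounded (fun _ : G => True) (fun=> 1 : k) n 0 -> forall h : cohomology k G n, h = 0.
Proof.
move=> bd h; elim/quotW: h => a; rewrite -[RHS]reprK.
move: (generic_quotient.repr (0 : cohomology k G n)) => b; apply/cohomologous.
have zc : hcocycle (fun _ : G => True) (fun=> 1 : k) n (homogenize (val a - val b)).
  apply: homogenize_cocycle; rewrite linearB /=.
  have /eqP -> : bar_diff (val a) == 0 by exact: (valP a).
  have /eqP -> : bar_diff (val b) == 0 by exact: (valP b).
  by rewrite subrr.
(* The matrix has no columns, so the coefficient 1 lies in its kernel and the cocycle itself is a
   coboundary. *)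
have [A /(_ (const_mx 1) (thinmx0 _))] := bd 1%N _ (fun=> zc).
by apply: hcoboundary_ext => x _; rewrite big_ord1 mxE mul1r.
Qed.

End Vanishing.

Lemma rep_iso_trivial (k : fieldType) (s : nat) (V W : lmodType k)
    (actV : 'S_s -> V -> V) (actW : 'S_s -> W -> W) :
  (forall v : V, v = 0) -> (forall w : W, w = 0) -> rep_iso actV actW.
Proof.
move=> V0 W0.
have zl : linear (fun _ : V => 0 : W) by move=> a u v; rewrite scaler0 addr0.
pose fl : {linear V -> W} := HB.pack (fun _ : V => 0 : W)
  (GRing.isLinear.Build k V W _ (fun _ : V => 0 : W) zl).
exists fl; split => [|sigma v]; last by rewrite /= [RHS]W0.
by exists (fun=> 0) => z; [rewrite [RHS]V0|rewrite [RHS]W0 /=].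
Qed.

Section Sign.
Context (k : fieldType) (n : nat).
Local Notation s := (1 + n)%N.
Local Notation la := (nseq s 1%N).
Local Notation e := (@polytabloid k s la).

(** For a single column the row group is trivial and the column group is everything. The shape is
    convertible to the hook with [r = 1], so the lemmas on hooks apply. *)
Lemma polytabloid_sign tau : e tau = (-1) ^+ odd_perm tau.
Proof.
have R1 (p : 'S_s) : (p \in row_group s la) = (p == 1%g).
  apply/idP/eqP => [/row_groupP h|->]; last exact: (row_group1 1 n).
  apply/permP => i; rewrite perm1; case: (split_ordP i) => [a ->|m ->]; last exact: h.
  case: (split_ordP (p (lshift n a))) => [b ->|m em]; first by rewrite [a]ord1 [b]ord1.
  have /perm_inj/eqP : p (lshift n a) = p (rshift 1 m) by rewrite em h.
  by rewrite eq_lrshift.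
have Call (q : 'S_s) : q \in col_group s la.
  by apply/col_groupP => a; rewrite [a]ord1.
rewrite polytabloidE (bigD1 tau) ?Call//= [X in _ + X]big1 ?addr0.
  rewrite (big_pred1 1%g)// => p; rewrite [p \in _]R1 /=.
  by case: (eqVneq p 1%g) => [->|//]; rewrite mul1g eqxx.
move=> q /andP[_ qt]; rewrite big_pred0// => p; rewrite [p \in _]R1.
by case: (eqVneq p 1%g) => [->|//]; rewrite mul1g (negbTE qt).
Qed.

Lemma act_polytabloid_sign sigma :
  group_algebra_act sigma e = (-1) ^+ odd_perm sigma *: e.
Proof.
apply/ffunP => tau; rewrite !ffunE -!/(e _).
have := polytabloid_sign (tau * sigma^-1)%g; have := polytabloid_sign tau.
rewrite !ffunE => -> ->.
by rewrite odd_permM odd_permV signr_addb mulrC.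
Qed.

Lemma specht_sign : rep_iso (@specht_act k s la) (@sign_act k s).
Proof.
have line v : v \in specht_space k s la -> v = v 1%g *: e.
  have e1 : e 1%g = 1 by rewrite polytabloid_sign odd_perm1.
  have part : is_partition s la by apply: (is_partition_hook (r := 1) (n := n)); left.
  rewrite /specht_space part => vS.
  have : v \in <[e]>%VS.
    move: vS; apply: subvP; apply/span_subvP => _ /mapP[sigma _ ->].
    by rewrite act_polytabloid_sign memvZ// memv_line.
  move=> /vlineP[a ->]; rewrite [(a *: e) 1%g]ffunE e1.
  by congr (_ *: _); exact: (esym (mulr1 a)).
have eS : e \in specht_space k s la.
  by have := act_polytabloid_specht k (r := 1) (n := n) (or_introl isT) 1%g;
    rewrite act_polytabloid_sign odd_perm1 expr0 scale1r.
pose ev (v : specht k s la) : k^o := vsval v 1%g.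
have evl : linear ev by move=> a u v; rewrite /ev linearP !ffunE.
pose fl : {linear specht k s la -> k^o} :=
  HB.pack ev (GRing.isLinear.Build k (specht k s la) k^o _ ev evl).
exists fl; split => [|sigma v].
  exists (fun a : k^o => vsproj (specht_space k s la) (a *: e)).
    move=> v /=; apply: val_inj; rewrite /= vsprojK ?memvZ//.
    by rewrite [RHS]line// subvsP.
  move=> a /=; rewrite /ev vsprojK ?memvZ// ffunE.
  by rewrite polytabloid_sign odd_perm1 expr0; exact: mulr1.
rewrite /= /ev specht_actE /sign_act.
have vE := line _ (subvsP v); rewrite {1}vE linearZ /= act_polytabloid_sign.
rewrite scalerA ffunE polytabloid_sign odd_perm1 expr0.
by rewrite [_ *: _]mulr1 mulrC.
Qed.

End Sign.

Theorem proposition2p7 (R : realType) (k : fieldType)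
    (char0 : [pchar k] =i pred0)
    (X : topologicalType) (Xgraph : finite_graph R X)
    (Xconn : connected [set: X]) (Xrank : has_rank R X 1) :
  (forall (s i : nat) (x : 'I_s -> X), injective x ->
     if odd i then forall h : cohomology k (Gamma R x) i, h = 0
     else rep_iso (@Gamma_act k R X s x i)
                  (@specht_act k s ((s - i)%N :: nseq i 1%N))) /\
  (forall (m : nat) (x : 'I_(m.*2.+1) -> X), injective x ->
     rep_iso (@Gamma_act k R X m.*2.+1 x m.*2)
             (@specht_act k m.*2.+1 (nseq m.*2.+1 1%N)) /\
     rep_iso (@specht_act k m.*2.+1 (nseq m.*2.+1 1%N))
             (@sign_act k m.*2.+1)).
Proof.
have k2 : (2 : k) != 0 by move/pcharf0P: char0 => ->.
have main (s i : nat) (x : 'I_s -> X) : injective x ->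
     if odd i then forall h : cohomology k (Gamma R x) i, h = 0
     else rep_iso (@Gamma_act k R X s x i)
                  (@specht_act k s ((s - i)%N :: nseq i 1%N)).
  move=> xinj.
  have [eps [c [[epsM cM c0 c_inj c_surj] phic]]] :=
    exists_displacement Xgraph Xconn Xrank xinj.
  have bd : bounded (fun _ : Gamma R x => True) (fun=> 1 : k) i (hook_dim s.-1 i false).
    exact: (bounded_total k2 epsM cM c0 c_inj c_surj).
  case oi : (odd i).
    by apply: bounded0_cohomology; rewrite /hook_dim oi in bd.
  have [si|si] := boolP ((i == 0)%N || (i < s)%N).
    have [r sE] : exists r, s = (r + i)%N.
      by exists (s - i)%N; rewrite subnK//; case/orP: si => [/eqP ->//|/ltnW].
    subst s; rewrite addnK.
    have rn : (0 < r)%N \/ i = 0%N by case/orP: si => [/eqP ->|]; [right|left; lia].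
    exact: (specht_cohomology_iso char0 rn oi epsM cM c0 c_inj c_surj phic).
  (* What remains is [0 < i] and [s <= i]: the truncated first part is 0, so the shape is not a
     partition, and the binomial coefficient bounding the cohomology vanishes too. *)
  move: si; rewrite negb_or -lt0n -leqNgt => /andP[i0 si].
  apply: rep_iso_trivial.
    apply: bounded0_cohomology.
    by rewrite /hook_dim oi bin_small in bd => //; lia.
  move=> v; apply: val_inj; change (vsval v = 0).
  move: (vsval v) (subvsP v) => u; rewrite /specht_space ifF.
    by rewrite memv0 => /eqP.
  by rewrite /is_partition (_ : s - i = 0)%N; [case: (i) i0|lia].
split => // m x xinj; split.
  have := main m.*2.+1 m.*2 x xinj; rewrite odd_double.
  by rewrite (_ : m.*2.+1 - m.*2 = 1)%N//; lia.
exact: (specht_sign k m.*2).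
Qed.
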